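(* Let $M$ be a compact connected oriented $n$-dimensional Riemannian manifold without boundary with a $Spin^r(n)$ structure ($r\ge 2$), with auxiliary rank $r$ oriented Riemannian bundle $F$ endowed with a metric connection $\nabla^F$, and let $m\in\mathbb N$ be such that $S=S(TM)\otimes S(F)^{\otimes m}$ is globally defined. Let $\mathrm R$ be the scalar curvature of $M$. Suppose $0\ne\phi\in\Gamma(S)$ is a Killing spinor with Killing constant $\mu\in\mathbb C$, i.e. $\nabla^\theta_X\phi=\mu X\cdot\phi$ for all $X\in\Gamma(TM)$. Then $\mu$ is either real or imaginary, and $$\mu^2\ \ge\ \frac1{4n^2}\min_M\big(\mathrm R-2|\tilde\Theta^m|\big)\ \ge\ \frac1{4n^2}\min_M\big(\mathrm R-2m|\tilde\Theta^1|\big).$$ If $\mu^2$ equals either of these two lower bounds, then $\phi$ is parallel, i.e. $\mu=0$.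
   Context: Clifford algebra: $Cl_n$ is generated by an orthonormal basis $e_1,\dots,e_n$ of $\mathbb R^n$ with $e_ie_j+e_je_i=-2\delta_{ij}$; $\Delta_n=\mathbb C^{2^{[n/2]}}$ is the complex spinor space, on which $Cl_n$ acts via $\kappa$ (the isomorphism $Cl_n\otimes\mathbb C\cong\mathrm{End}(\Delta_n)$ for $n$ even; for $n$ odd the isomorphism with $\mathrm{End}(\Delta_n)\oplus\mathrm{End}(\Delta_n)$ followed by the projection to the first summand), with Hermitian product for which Clifford multiplication $x\cdot\phi=\kappa(x)\phi$ by vectors is skew. $Spin(n)\subset Cl_n$ has Lie algebra spanned by $e_ie_j$, $i<j$; $\lambda_n:Spin(n)\to SO(n)$ is the double cover, with $\lambda_{n*}(e_ie_j)=2E_{ij}$, $E_{ij}:e_i\mapsto e_j,\ e_j\mapsto -e_i$. $\kappa^m_r$ is the representation of $Spin(r)$ on $\Delta_r^{\otimes m}$, and $\kappa^m_{r*}(f_kf_l)$ is the sum over $a=1,\dots,m$ of Clifford multiplication by $f_kf_l$ in the $a$-th factor. On $\Delta_n\otimes\Delta_r^{\otimes m}$, vectors of $\mathbb R^n$ act on $\Delta_n$ and $\kappa^m_{r*}(f_kf_l)$ acts on $\Delta_r^{\otimes m}$. $Spin^r(n)=(Spin(n)\times Spin(r))/\{\pm(1,1)\}$. A $Spin^r(n)$ structure on $M$ is a principal $SO(r)$-bundle $P_{SO(r)}$ and a principal $Spin^r(n)$-bundle $P$ with a 2:1 covering $P\to P_{SO(M)}\tilde\times P_{SO(r)}$ (fibered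 product) equivariant with respect to $\lambda_n\times\lambda_r$. $F$ is the rank $r$ vector bundle associated to $P_{SO(r)}$, and $S=S(TM)\otimes S(F)^{\otimes m}$ is the bundle with fiber $\Delta_n\otimes\Delta_r^{\otimes m}$ associated to $\kappa_n\otimes\kappa_r^m$; it is globally defined if $m$ is odd (structure group $Spin^r(n)$), or if $M$ and $F$ are both Spin (group $Spin(n)\times Spin(r)$, any $m$), or if $M$ is Spin and $m$ is even (group $Spin(n)\times SO(r)$). $\nabla^\theta$ is the covariant derivative on $S$ induced by the Levi-Civita connection and $\nabla^F$; $\phi$ is parallel if $\nabla^\theta\phi=0$. For local orthonormal frames $(e_i)$ of $TM$ and $(f_k)$ of $F$: $\Theta_{kl}(X,Y)=\langle R^F(X,Y)f_k,f_l\rangle$ with $R^F$ the curvature of $\nabla^F$; $\tilde\Theta^m\cdot\phi=\sum_{k<l}\sum_{i<j}\Theta_{kl}(e_i,e_j)\,e_ie_j\cdot\kappa^m_{r*}(f_kf_l)\cdot\phi$; $|\tilde\Theta^m|$ is its point-wise operator norm, and $|\tilde\Theta^1|$ is the point-wise operator norm of $\tilde\Theta^1$ on $\Delta_n\otimes\Delta_r$ (computed in local frames, independent of the frames). *)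

(* Defs.v *)
From HB Require Import structures.
From mathcomp Require Export all_boot all_order all_algebra.
From mathcomp Require Export all_classical all_reals all_analysis.
From mathcomp.real_closed Require Export complex mxtens.
Set Implicit Arguments.
Unset Strict Implicit.
Unset Printing Implicit Defensive.
Export Order.TTheory GRing.Theory Num.Theory numFieldNormedType.Exports.
#[export] Set Warnings "-notation-overridden,-ambiguous-paths".
Local Open Scope classical_set_scope.
Local Open Scope ring_scope.
Local Open Scope complex_scope.

(** * Smooth oriented manifolds

  Vectors are row vectors; the rows of a matrix are the members of a frame. *)

Section Smooth.
Variables (R : realType) (n : nat).

(* C^k on an open set, by iterated partial derivatives *)
Fixpoint Ck (k : nat) (D : set 'rV[R]_n) (f : 'rV[R]_n -> R) : Prop :=
  (forall x, D x -> {for x, continuous f}) /\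
  if k is k'.+1 then
    forall i : 'I_n,
      (forall x, D x -> derivable f x (delta_mx 0 i)) /\
      Ck k' D (fun x => 'D_(delta_mx 0 i) f x)
  else True.

Definition smooth (D : set 'rV[R]_n) (f : 'rV[R]_n -> R) : Prop :=
  forall k, Ck k D f.

End Smooth.

(* An oriented smooth n-manifold without boundary: Hausdorff, second countable,
   with an oriented smooth atlas of homeomorphisms between open subsets of the
   manifold and open subsets of R^n. [chart_at p] is a preferred chart at p; the
   tangent space T_pM is R^n, read in that chart. *)
Record manifold (R : realType) (n : nat) := Manifold {
  mpt :> topologicalType;
  chart : Type;
  dom : chart -> set mpt;
  cod : chart -> set 'rV[R]_n;
  to_coord : chart -> mpt -> 'rV[R]_n;
  of_coord : chart -> 'rV[R]_n -> mpt;
  chart_at : mpt -> chart;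
  chart_atP : forall p, dom (chart_at p) p;
  mpt_hausdorff : hausdorff_space mpt;
  mpt_second_countable : @second_countable mpt;
  dom_open : forall c, open (dom c);
  cod_open : forall c, open (cod c);
  to_coord_cod : forall c p, dom c p -> cod c (to_coord c p);
  of_coord_dom : forall c x, cod c x -> dom c (of_coord c x);
  to_coordK : forall c p, dom c p -> of_coord c (to_coord c p) = p;
  of_coordK : forall c x, cod c x -> to_coord c (of_coord c x) = x;
  to_coord_continuous : forall c p, dom c p -> {for p, continuous (to_coord c)};
  of_coord_continuous : forall c x, cod c x -> {for x, continuous (of_coord c)};
  transition_smooth : forall c c' (j : 'I_n),
    smooth (cod c `&` of_coord c @^-1` dom c') (fun x => to_coord c' (of_coord c x) 0 j);
  transition_oriented : forall c c' p, dom c p -> dom c' p ->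
    0 < \det (\matrix_(i < n, j < n)
      'D_(delta_mx 0 i) (fun x => to_coord c' (of_coord c x) 0 j) (to_coord c p))
}.

Section Manifold.
Variables (R : realType) (n : nat) (M : manifold R n).
Implicit Types (c : chart M) (p : M) (U : set M) (X : 'rV[R]_n).

Definition smooth_on U (f : M -> R) : Prop :=
  forall c, smooth (cod c `&` of_coord c @^-1` U) (f \o of_coord c).

(* derivative of f at p along the vector with components X in the chart c *)
Definition deriv c X (f : M -> R) p : R := 'D_X (f \o of_coord c) (to_coord c p).

Definition pd c (i : 'I_n) := deriv c (delta_mx 0 i).

(* X *m jac c c' p are the components in c' of the tangent vector at p whose
   components in c are X *)
Definition jac c c' p : 'M[R]_n :=
  \matrix_(i, j) pd c i (fun q => to_coord c' q 0 j) p.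

(* components in c of a family of tangent vectors (given in T_pM) at each p *)
Definition frame_in k c (e : M -> 'M[R]_(k, n)) p : 'M[R]_(k, n) :=
  e p *m jac (chart_at p) c p.

Definition smooth_frame k U (e : M -> 'M[R]_(k, n)) : Prop :=
  forall c i j, smooth_on (U `&` dom c) (fun p => frame_in c e p i j).

(* the element of T_pM with components X in the chart c *)
Definition tangent c X p : 'rV[R]_n := X *m jac c (chart_at p) p.

End Manifold.

(** * Riemannian metrics, the Levi-Civita connection and scalar curvature *)

(* [gram p] is the Gram matrix of the metric on T_pM, [metric_in c] its
   components in the chart c. *)
Definition gram_in (R : realType) (n : nat) (M : manifold R n)
    (g : M -> 'M[R]_n) (c : chart M) (p : M) : 'M[R]_n :=
  jac c (chart_at p) p *m g p *m (jac c (chart_at p) p)^T.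

Record metric (R : realType) (n : nat) (M : manifold R n) := Metric {
  gram : M -> 'M[R]_n;
  gram_sym : forall p, (gram p)^T = gram p;
  gram_pos : forall p (X : 'rV[R]_n), X != 0 -> 0 < (X *m gram p *m X^T) 0 0;
  gram_smooth : forall c i j, smooth_on (dom c) (fun p => gram_in gram c p i j)
}.

Section Riemann.
Variables (R : realType) (n : nat) (M : manifold R n) (g : metric M).
Implicit Types (c : chart M) (p : M) (X : 'rV[R]_n).

Definition metric_in := gram_in (gram g).

(* nabla_(d_i) d_j = \sum_k (christoffel c k i j) d_k *)
Definition christoffel c (k i j : 'I_n) p : R :=
  2^-1 * \sum_(l < n) invmx (metric_in c p) k l *
    (pd c i (fun q => metric_in c q j l) p +
     pd c j (fun q => metric_in c q i l) p -
     pd c l (fun q => metric_in c q i j) p).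

(* R(d_i, d_j) d_k = \sum_l (riemann c l k i j) d_l, where
   R(X, Y) = [nabla_X, nabla_Y] - nabla_[X, Y] *)
Definition riemann c (l k i j : 'I_n) p : R :=
  pd c i (christoffel c l j k) p - pd c j (christoffel c l i k) p +
  \sum_(h < n) (christoffel c l i h p * christoffel c h j k p -
                christoffel c l j h p * christoffel c h i k p).

Definition ricci c (j k : 'I_n) p : R := \sum_(i < n) riemann c i k i j p.

Definition scalar_curvature p : R :=
  let c := chart_at p in
  \sum_(j < n) \sum_(k < n) invmx (metric_in c p) j k * ricci c j k p.

(* components in c of the covariant derivatives nabla_X e_i at p, where X is
   given by its components in c *)
Definition nabla_frame c X (e : M -> 'M[R]_n) p : 'M[R]_n :=
  \matrix_(i, k) (deriv c X (fun q => frame_in c e q i k) p +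
    \sum_(a < n) \sum_(b < n)
      X 0 a * christoffel c k a b p * frame_in c e p i b).

(* omega_ij(X) = <nabla_X e_i, e_j> *)
Definition lc_form c X (e : M -> 'M[R]_n) p : 'M[R]_n :=
  nabla_frame c X e p *m metric_in c p *m (frame_in c e p)^T.

End Riemann.

(** * Principal bundles *)

(* A Lie group, as the quotient of a set [gset] of elements of a linear model
   (with coordinates [gcoord]) by a discrete central subgroup [gker]. *)
Record lie_group (R : realType) := LieGroup {
  gsort : Type;
  gindex : Type;
  gcoord : gsort -> gindex -> R;
  gset : set gsort;
  gker : set gsort;
  gone : gsort;
  gmul : gsort -> gsort -> gsort
}.

(* The smooth structure of the total space is the one for which the local
   sections [sec a] over the open sets [tdom a] are smooth. A smooth map to the
   quotient gset / gker is one that locally lifts to a smooth map to gset. *)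
Record principal_bundle (R : realType) (n : nat) (M : manifold R n)
    (G : lie_group R) := PrincipalBundle {
  total :> Type;
  bproj : total -> M;
  act : total -> gsort G -> total;
  triv : Type;
  tdom : triv -> set M;
  sec : triv -> M -> total;
  triv_at : M -> triv;
  act_proj : forall q u, gset u -> bproj (act q u) = bproj q;
  act_one : forall q, act q (gone G) = q;
  act_mul : forall q u v, gset u -> gset v ->
    act (act q u) v = act q (gmul u v);
  act_stab : forall q u, gset u -> (act q u = q <-> gker u);
  act_trans : forall q q', bproj q = bproj q' ->
    exists2 u, gset u & q' = act q u;
  tdom_open : forall a, open (tdom a);
  triv_atP : forall p, tdom (triv_at p) p;
  sec_proj : forall a p, tdom a p -> bproj (sec a p) = p;
  sec_smooth : forall a b p, tdom a p -> tdom b p ->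
    exists (V : set M) (u : M -> gsort G),
      [/\ open V, V p,
          forall i, smooth_on V (fun x => gcoord (u x) i) &
          forall x, V x -> gset (u x) /\ sec b x = act (sec a x) (u x)]
}.

Definition smooth_section (R : realType) (n : nat) (M : manifold R n)
    (G : lie_group R) (Q : principal_bundle M G) (U : set M) (s : M -> Q) :=
  forall p, U p -> bproj (s p) = p /\
    forall a, tdom a p -> exists (V : set M) (u : M -> gsort G),
      [/\ open V, V p,
          forall i, smooth_on V (fun x => gcoord (u x) i) &
          forall x, V x -> gset (u x) /\ s x = act (sec a x) (u x)].

Definition SO_set (R : realType) (r : nat) : set 'M[R]_r :=
  [set A | A^T *m A = 1%:M /\ \det A = 1].

Definition SO (R : realType) (r : nat) : lie_group R :=
  @LieGroup R 'M[R]_r ('I_r * 'I_r)%type (fun A i => A i.1 i.2)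
    (@SO_set R r) [set 1%:M] 1%:M (fun A B => A *m B).

(** * The vector bundle F associated to a principal SO(r)-bundle *)

(* A of_coord q of Q is an oriented orthonormal frame (f_1, .., f_r) of the fibre
   of F at bproj q. A section of F is given by its row v q of coordinates in each
   frame q; the frame q.A has f'_k = \sum_l A l k *: f_l. *)

Section AssociatedBundle.
Variables (R : realType) (n r : nat) (M : manifold R n).
Variable Q : principal_bundle M (SO R r).
Implicit Types (U : set M) (v w : Q -> 'rV[R]_r).

Definition F_section U v : Prop :=
  (forall (q : Q) (A : 'M[R]_r), U (bproj q) -> @SO_set R r A ->
     v (act q A) = v q *m A) /\
  (forall (a : triv Q) k, smooth_on (U `&` tdom a) (fun p => v (sec a p) 0 k)).

Definition F_inner v w (p : M) : R :=
  let q := sec (triv_at Q p) p in (v q *m (w q)^T) 0 0.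

(* the section f_k of F defined by a local section s = (f_1, .., f_r) of Q *)
Definition F_frame (s : M -> Q) (k : 'I_r) : Q -> 'rV[R]_r := fun q =>
  row k (xget 1%:M [set A : 'M[R]_r | @SO_set R r A /\
                                      q = @act _ _ _ (SO R r) Q (s (bproj q)) A]).

End AssociatedBundle.

(* A metric connection on F, acting on sections of F over open sets:
   [cov v q X] is the row of coordinates of nabla^F_X v in the frame q, for X in
   the tangent space at bproj q. *)
Record metric_connection (R : realType) (n r : nat) (M : manifold R n)
    (Q : principal_bundle M (SO R r)) := MetricConnection {
  cov : (Q -> 'rV[R]_r) -> Q -> 'rV[R]_n -> 'rV[R]_r;
  cov_local : forall U v w, open U -> F_section U v -> F_section U w ->
    (forall q, U (bproj q) -> v q = w q) ->
    forall q X, U (bproj q) -> cov v q X = cov w q X;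
  cov_section : forall U v (X : M -> 'rV[R]_n), open U -> F_section U v ->
    smooth_frame U X -> F_section U (fun q => cov v q (X (bproj q)));
  cov_linear : forall U v q (t : R) X Y, open U -> F_section U v ->
    U (bproj q) -> cov v q (t *: X + Y) = t *: cov v q X + cov v q Y;
  cov_add : forall U v w q X, open U -> F_section U v -> F_section U w ->
    U (bproj q) -> cov (fun q' => v q' + w q') q X = cov v q X + cov w q X;
  cov_leibniz : forall U v (f : M -> R) q X, open U -> F_section U v ->
    smooth_on U f -> U (bproj q) ->
    cov (fun q' => f (bproj q') *: v q') q X =
    deriv (chart_at (bproj q)) X f (bproj q) *: v q + f (bproj q) *: cov v q X;
  cov_metric : forall U v w q X, open U -> F_section U v -> F_section U w ->
    U (bproj q) ->
    deriv (chart_at (bproj q)) X (F_inner v w) (bproj q) =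
    (cov v q X *m (w q)^T + v q *m (cov w q X)^T) 0 0
}.

Section FConnection.
Variables (R : realType) (n r : nat) (M : manifold R n).
Variables (Q : principal_bundle M (SO R r)) (D : metric_connection Q).
Implicit Types (c : chart M) (s : M -> Q) (p : M) (X : 'rV[R]_n).

(* <nabla^F_X f_k, f_l> at p for the local frame s, X being given by its
   components in c *)
Definition F_form c X s p : 'M[R]_r :=
  \matrix_(k, l) cov D (F_frame s k) (s p) (tangent c X p) 0 l.

Definition F_nabla_pd c (a : 'I_n) (v : Q -> 'rV[R]_r) : Q -> 'rV[R]_r :=
  fun q => cov D v q (tangent c (delta_mx 0 a) (bproj q)).

(* R^F(d_a, d_b) v; coordinate fields commute *)
Definition F_curvature c (a b : 'I_n) (v : Q -> 'rV[R]_r) (q : Q) : 'rV[R]_r :=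
  F_nabla_pd c a (F_nabla_pd c b v) q - F_nabla_pd c b (F_nabla_pd c a v) q.

(* Theta_kl(e_i, e_j) = <R^F(e_i, e_j) f_k, f_l> at p *)
Definition Theta (e : M -> 'M[R]_n) s (k l : 'I_r) (i j : 'I_n) p : R :=
  let c := chart_at p in
  \sum_(a < n) \sum_(b < n) frame_in c e p i a * frame_in c e p j b *
    F_curvature c a b (F_frame s k) (s p) 0 l.

End FConnection.

(** * Clifford algebras, spin groups and spinors *)

Section Clifford.
Variables (R : realType) (n : nat).

(* Cl_n in its basis e_A = e_(i_1) .. e_(i_k), A = {i_1 < .. < i_k} *)
Definition Cl := {ffun {set 'I_n} -> R}.

(* e_A e_B = (-1)^(number of (i, j) in A x B with j <= i) e_(A delta B): each
   j < i is a transposition and each j = i a factor e_i^2 = -1 *)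
Definition cl_sign (A B : {set 'I_n}) : R :=
  (-1) ^+ #|[set ij : 'I_n * 'I_n |
              [&& ij.1 \in A, ij.2 \in B & (ij.2 <= ij.1)%N]]|.

Definition cl_mul (x y : Cl) : Cl :=
  [ffun C : {set 'I_n} => \sum_(A : {set 'I_n}) \sum_(B : {set 'I_n} |
     (A :\: B) :|: (B :\: A) == C) cl_sign A B * x A * y B].

Definition cl_one : Cl := [ffun A : {set 'I_n} => (A == finset.set0)%:R].

Definition cl_vec (v : 'rV[R]_n) : Cl :=
  [ffun A : {set 'I_n} => \sum_(i < n) v 0 i * (A == [set i]%SET)%:R].

(* products of an even number of unit vectors *)
Definition Spin : set Cl := [set x | exists us : seq 'rV[R]_n,
  [/\ ~~ odd (size us), forall u, u \in us -> u *m u^T = 1%:M &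
      x = foldr (fun u y => cl_mul (cl_vec u) y) cl_one us]].

(* A is the matrix of lambda_n(x), i.e. x v x^-1 = A v for all vectors v *)
Definition spin_covers (x : Cl) (A : 'M[R]_n) : Prop :=
  forall v, cl_mul x (cl_vec v) = cl_mul (cl_vec (v *m A^T)) x.

(* An action of Cl_n on Delta_n = C^(2^[n/2]) with skew-Hermitian vectors. By
   dimension it is irreducible, so it is kappa up to unitary equivalence; for
   odd n there are two such actions, according to which summand of
   Cl_n (x) C = End + End is called the first one. *)
Record spinor_rep := SpinorRep {
  gam : 'I_n -> 'M[R[i]]_(2 ^ n./2);
  gam_clifford : forall i j,
    gam i *m gam j + gam j *m gam i = (- (2 * (i == j)%:R))%:M;
  gam_skew : forall i, (map_mx conjc (gam i))^T = - gam i
}.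

Definition kappa (K : spinor_rep) (x : Cl) : 'M[R[i]]_(2 ^ n./2) :=
  \sum_(A : {set 'I_n}) (x A)%:C *: \prod_(i in A) gam K i.

End Clifford.

(* The groups through which kappa_n (x) kappa_r^m may be required to factor:
   Spin^r(n), Spin(n) x Spin(r) and Spin(n) x SO(r) = Spin(n) x Spin(r) / {1} x
   {1, -1}. *)
Inductive spin_kind := SpinTwisted | SpinSpin | SpinSO.

Definition globally_defined (k : spin_kind) (m : nat) : bool :=
  match k with
  | SpinTwisted => odd m
  | SpinSpin => true
  | SpinSO => ~~ odd m
  end.

Section SpinGroups.
Variables (R : realType) (n r : nat).

Definition spin_ker (k : spin_kind) : set (Cl R n * Cl R r) :=
  let one := (cl_one R n, cl_one R r) in
  match k with
  | SpinTwisted => [set one; (- one.1, - one.2)]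
  | SpinSpin => [set one]
  | SpinSO => [set one; (one.1, - one.2)]
  end.

Definition spin_group (k : spin_kind) : lie_group R :=
  @LieGroup R (Cl R n * Cl R r)%type ({set 'I_n} + {set 'I_r})%type
    (fun x i => match i with inl A => x.1 A | inr B => x.2 B end)
    [set x | @Spin R n x.1 /\ @Spin R r x.2] (spin_ker k)
    (cl_one R n, cl_one R r)
    (fun x y => (cl_mul x.1 y.1, cl_mul x.2 y.2)).

End SpinGroups.

(* A principal bundle for one of these groups with a smooth map (frT, frF) to
   the fibred product of the oriented orthonormal frame bundle of M with Q,
   equivariant with respect to lambda_n x lambda_r; being equivariant it is a
   covering with fibres the kernel of the induced map onto SO(n) x SO(r), of
   order 2 for Spin^r(n). *)
Record spin_structure (R : realType) (n r : nat) (M : manifold R n)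
    (g : metric M) (Q : principal_bundle M (SO R r)) (k : spin_kind) :=
  SpinStructure {
  spin_bundle :> principal_bundle M (spin_group R n r k);
  frT : spin_bundle -> 'M[R]_n;
  frF : spin_bundle -> Q;
  frT_orthonormal : forall q,
    frT q *m gram g (bproj q) *m (frT q)^T = 1%:M;
  frT_oriented : forall q, 0 < \det (frT q);
  frF_proj : forall q, bproj (frF q) = bproj q;
  fr_act : forall (q : spin_bundle) x y A B, @Spin R n x -> @Spin R r y ->
    spin_covers x A -> spin_covers y B ->
    frT (act q (x, y)) = A^T *m frT q /\
    frF (act q (x, y)) = act (frF q) B;
  frT_smooth : forall a : triv spin_bundle,
    smooth_frame (tdom a) (fun p => frT (sec a p));
  frF_smooth : forall a : triv spin_bundle,
    smooth_section (tdom a) (fun p => frF (sec a p))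
}.

Section TensorPower.
Variables (R : realType) (N : nat).

Definition tens_dim (m : nat) : nat := iter m (muln N) 1%N.

(* A (x) .. (x) A *)
Fixpoint tens_pow (A : 'M[R[i]]_N) (m : nat) : 'M[R[i]]_(tens_dim m) :=
  if m is m'.+1 then A *t tens_pow A m' else 1%:M.

(* \sum_a 1 (x) .. (x) A (x) .. (x) 1, with A in the a-th factor *)
Fixpoint tens_der (A : 'M[R[i]]_N) (m : nat) : 'M[R[i]]_(tens_dim m) :=
  if m is m'.+1 then A *t 1%:M + 1%:M *t tens_der A m' else 0.

End TensorPower.

Section OperatorNorm.
Variables (R : realType) (N : nat).

Definition hnorm (v : 'cV[R[i]]_N) : R :=
  Num.sqrt (\sum_(i < N) (complex.Re (v i 0) ^+ 2 + complex.Im (v i 0) ^+ 2)).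

Definition opnorm (A : 'M[R[i]]_N) : R :=
  sup [set hnorm (A *m v) | v in [set v | hnorm v <= 1]].

End OperatorNorm.

(** * Twisted spinors *)

Section Spinors.
Variables (R : realType) (n r : nat) (M : manifold R n) (g : metric M).
Variables (Q : principal_bundle M (SO R r)) (D : metric_connection Q).
Variables (k : spin_kind) (P : spin_structure g Q k).
Variables (Kn : spinor_rep R n) (Kr : spinor_rep R r) (m : nat).

(* Delta_n (x) Delta_r^(x)m *)
Definition spinor_dim : nat := (2 ^ n./2 * tens_dim (2 ^ r./2) m)%N.
Notation V := 'cV[R[i]]_spinor_dim.
Notation EndV := 'M[R[i]]_spinor_dim.

Definition spin_action (x : Cl R n) (y : Cl R r) : EndV :=
  kappa Kn x *t tens_pow (kappa Kr y) m.

Definition cliffT (A : 'M[R[i]]_(2 ^ n./2)) : EndV := A *t 1%:M.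

(* kappa^m_{r*}(f_k f_l) *)
Definition cliffF (h l : 'I_r) : EndV :=
  1%:M *t tens_der (gam Kr h *m gam Kr l) m.

(* smooth sections of S, as equivariant maps from P to the spinor space *)
Definition spinor_section (psi : P -> V) : Prop :=
  (forall (q : P) x y, @Spin R n x -> @Spin R r y ->
     spin_action x y *m psi (act q (x, y)) = psi q) /\
  (forall (a : triv P) i,
     smooth_on (tdom a) (fun p => complex.Re (psi (sec a p) i 0)) /\
     smooth_on (tdom a) (fun p => complex.Im (psi (sec a p) i 0))).

Section LocalFrames.
Variable a : triv P.

Definition local_e (p : M) : 'M[R]_n := frT (sec a p).
Definition local_f (p : M) : Q := frF (sec a p).

(* nabla^theta_X psi at p in the local section [sec a], where X is given by its
   components in the chart c; the infinitesimal action of omega(X) follows from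
   lambda_*(e_i e_j) = 2 E_ij, and similarly for F *)
Definition nabla (c : chart M) (X : 'rV[R]_n) (psi : P -> V) (p : M) : V :=
  \col_i (deriv c X (fun q => complex.Re (psi (sec a q) i 0)) p +i*
          deriv c X (fun q => complex.Im (psi (sec a q) i 0)) p) +
  (\sum_(i < n) \sum_(j < n | (i < j)%N)
     (2^-1 * lc_form g c X local_e p i j)%:C *: cliffT (gam Kn i *m gam Kn j) +
   \sum_(h < r) \sum_(l < r | (h < l)%N)
     (2^-1 * F_form D c X local_f p h l)%:C *: cliffF h l) *m psi (sec a p).

(* Clifford multiplication by the tangent vector \sum_i <X, e_i> e_i *)
Definition cliff_mul (c : chart M) (X : 'rV[R]_n) (p : M) : EndV :=
  \sum_(i < n) ((X *m metric_in g c p *m (frame_in c local_e p)^T) 0 i)%:C *: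
    cliffT (gam Kn i).

Definition Theta_op (p : M) : EndV :=
  \sum_(h < r) \sum_(l < r | (h < l)%N)
  \sum_(i < n) \sum_(j < n | (i < j)%N)
    (Theta D local_e local_f h l i j p)%:C *:
    (cliffT (gam Kn i *m gam Kn j) *m cliffF h l).

End LocalFrames.

Definition parallel (psi : P -> V) : Prop :=
  forall (a : triv P) (c : chart M) (X : 'rV[R]_n) (p : M),
    tdom a p -> dom c p -> nabla a c X psi p = 0.

Definition killing (mu : R[i]) (psi : P -> V) : Prop :=
  forall (a : triv P) (c : chart M) (X : 'rV[R]_n) (p : M),
    tdom a p -> dom c p ->
    nabla a c X psi p = mu *: (cliff_mul a c X p *m psi (sec a p)).

(* computed in the local frames at p given by P; it does not depend on them *)
Definition Theta_norm (p : M) : R := opnorm (Theta_op (triv_at P p) p).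

End Spinors.

(* On a compact manifold the minimum of a continuous function is its infimum.
   Taken in \bar R, where it needs no a priori bound on f. *)
Definition min_on (R : realType) (T : Type) (f : T -> R) : \bar R :=
  ereal_inf (range (fun p => (f p)%:E)).

(* Main.v *)
From HB Require Import structures.
Require Import Defs.
From mathcomp Require Import ring lra.

Set Implicit Arguments.
Unset Strict Implicit.
Unset Printing Implicit Defensive.

Local Open Scope classical_set_scope.
Local Open Scope ring_scope.
Local Open Scope complex_scope.

(** Let |phi|^2 be the squared length of the Killing spinor phi. The proof has
   three parts.

   _The constant mu is real._ The structure group acts by isometries
   ([spin_action_isometry]), so |phi|^2 is a smooth function on M
   ([sqnorm_smooth]). Differentiating the Killing equation twice, its Hessian at
   a critical point is 4 (Im mu)^2 |phi|^2 times the metric ([hess_sqnorm]). On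
   the compact manifold M the function attains its maximum, which is positive,
   and there the Hessian is not positive definite; hence Im mu = 0
   ([killing_constant_real]).

   _The bound._ In a local frame the Killing equation is a linear system
   d_j psi = B_j psi. Symmetry of second derivatives and vanishing of the torsion
   give the integrability condition
     (R(e_i, e_j) + R^F(e_i, e_j)) psi = - mu^2 (e_i e_j - e_j e_i) psi,
   where R and R^F act through the spin representations ([curvature_killing]).
   Multiply by e_i e_j, sum over i and j and take the inner product with psi. The
   Levi-Civita curvature contributes scal / 2 by the first Bianchi identity
   ([contraction_quad]), the curvature of F contributes Theta
   ([twisting_term]), and the right hand side a multiple of n (n - 1)
   ([gT_contraction]):
     scal / 2 |psi|^2 + <Theta psi, psi> = 2 n (n - 1) mu^2 |psi|^2
   ([killing_identity]). So at each point where phi does not vanish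
     scal - 2 |Theta| <= 4 n (n - 1) mu^2
   ([killing_scalar_bound]), and the minimum of the left hand side divided by
   4 n^2 is at most (1 - 1 / n) mu^2 <= mu^2. Equality leaves mu^2 / n <= 0, that
   is mu = 0, and then the Killing equation says that phi is parallel. The second
   bound is below the first, so equality there implies equality in the first.

   _Comparison of the two bounds._ The operator Theta for m is the sum over the
   m tensor factors of a copy of the operator for m = 1 acting on Delta_n and that
   factor; up to a unitary map this copy is a direct sum of copies of the operator
   for m = 1, so it has the same norm ([norm_le_slice], [twist_norm_le]). Hence
   |Theta^m| <= m |Theta^1|. *)

(** * Differential calculus in R^n *)

Section Lines.
Variables (R : realType) (V : normedModType R).

Lemma derive_line (f : V -> R) (y v : V) (s : R) :
  derivable f (s *: v + y) v ->
  is_derive s 1 (fun t : R => f (t *: v + y)) ('D_v f (s *: v + y)).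
Proof.
move=> df.
have E : (fun h : R => h^-1 *: (((fun t : R => f (t *: v + y)) \o shift s) (h *: 1) -
                   f (s *: v + y)))
   = (fun h : R => h^-1 *: ((f \o shift (s *: v + y)) (h *: v) - f (s *: v + y))).
  apply/funext => h /=; congr (_ *: (f _ - _)).
  by rewrite scalerDl addrA -[h *: 1]/(h * 1) mulr1.
by split; rewrite /derivable /derive E.
Qed.

Lemma line_MVT (f : V -> R) (y v : V) (t : R) :
  (forall s : R, `|s| <= `|t| -> derivable f (s *: v + y) v) ->
  exists2 s : R, `|s| <= `|t| & f (t *: v + y) - f y = t * 'D_v f (s *: v + y).
Proof.
move=> df; pose g (s : R) := f (s *: v + y).
have dg (s : R) : `|s| <= `|t| -> is_derive s 1 g ('D_v f (s *: v + y)).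
  by move=> /df; apply: derive_line.
have cg (a b : R) : (forall s : R, a <= s <= b -> `|s| <= `|t|) ->
    {within `[a, b], continuous g}.
  move=> ab; apply: derivable_within_continuous => s; rewrite in_itv /= => /ab.
  by move=> /dg ds; apply: ex_derive.
have g0 : g 0 = f y by rewrite /g scale0r add0r.
have [t0|t0] := leP 0 t.
- have sub (s : R) : 0 <= s <= t -> `|s| <= `|t|.
    by move=> /andP[s0 st]; rewrite !ger0_norm.
  have [||s] := @MVT_segment R g (fun s => 'D_v f (s *: v + y)) 0 t t0.
  + by move=> s; rewrite in_itv /= => /andP[/ltW s0 /ltW st]; apply/dg/sub/andP.
  + exact: cg.
  by rewrite in_itv /= subr0 g0 mulrC => /sub st E; exists s.
- have sub (s : R) : t <= s <= 0 -> `|s| <= `|t|.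
    by move=> /andP[ts s0]; rewrite !ler0_norm ?lerN2 // ltW.
  have [||s] := @MVT_segment R g (fun s => 'D_v f (s *: v + y)) t 0 (ltW t0).
  + by move=> s; rewrite in_itv /= => /andP[/ltW s0 /ltW st]; apply/dg/sub/andP.
  + exact: cg.
  rewrite in_itv /= sub0r g0 => /sub st E; exists s => //.
  by rewrite -/(g t) -opprB E mulrN opprK mulrC.
Qed.

(** The second difference of f over a small square is, by two applications of
   the mean value theorem in either order, the square of its side times a value
   of either mixed derivative near x; let the side tend to 0. *)
Lemma derive_comm (f : V -> R) (u v x : V) :
  (\forall y \near x, derivable f y u) -> (\forall y \near x, derivable f y v) ->
  (\forall y \near x, derivable ('D_u f) y v) ->
  (\forall y \near x, derivable ('D_v f) y u) ->
  {for x, continuous ('D_v ('D_u f))} -> {for x, continuous ('D_u ('D_v f))} ->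
  'D_v ('D_u f) x = 'D_u ('D_v f) x.
Proof.
have half (u1 v1 : V) (h : R) :
    (forall s t : R, `|s| <= `|h| -> `|t| <= `|h| -> derivable f (s *: u1 + (t *: v1 + x)) u1) ->
    (forall s t : R, `|s| <= `|h| -> `|t| <= `|h| -> derivable ('D_u1 f) (t *: v1 + (s *: u1 + x)) v1) ->
    exists s t : R, [/\ `|s| <= `|h|, `|t| <= `|h| &
      f (h *: u1 + (h *: v1 + x)) - f (h *: v1 + x) - f (h *: u1 + x) + f x =
      h * (h * 'D_v1 ('D_u1 f) (t *: v1 + (s *: u1 + x)))].
  move=> d1 d2.
  pose F y := f (h *: v1 + y) - f y.
  have sh (s : R) y : derivable f (h *: v1 + (s *: u1 + y)) u1 ->
      is_derive (s *: u1 + y) u1 (fun y => f (h *: v1 + y)) ('D_u1 f (h *: v1 + (s *: u1 + y))).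
    have E : (fun k : R => k^-1 *: (((fun y => f (h *: v1 + y)) \o shift (s *: u1 + y)) (k *: u1) -
                   f (h *: v1 + (s *: u1 + y))))
      = (fun k : R => k^-1 *: ((f \o shift (h *: v1 + (s *: u1 + y))) (k *: u1)
             - f (h *: v1 + (s *: u1 + y)))).
      by apply/funext => k /=; congr (_ *: (f _ - _)); rewrite addrCA.
    by move=> df; split; rewrite /derivable /derive E.
  have dF (s : R) : `|s| <= `|h| -> is_derive (s *: u1 + x) u1 F
      ('D_u1 f (h *: v1 + (s *: u1 + x)) - 'D_u1 f (s *: u1 + x)).
    move=> sh'; apply: is_deriveB.
      by apply: sh; rewrite addrCA; apply: d1.
    by apply/derivableP; have := d1 s 0 sh'; rewrite normr0 scale0r add0r; apply.
  have [s sh' E] : exists2 s : R, `|s| <= `|h| &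
     F (h *: u1 + x) - F x = h * 'D_u1 F (s *: u1 + x).
    by apply: line_MVT => s /dF ds; apply: ex_derive.
  have [t th E'] : exists2 t : R, `|t| <= `|h| &
     'D_u1 f (h *: v1 + (s *: u1 + x)) - 'D_u1 f (s *: u1 + x) =
      h * 'D_v1 ('D_u1 f) (t *: v1 + (s *: u1 + x)).
    by apply: (@line_MVT ('D_u1 f) (s *: u1 + x) v1 h) => t th; apply: d2.
  exists s, t; split => //; rewrite -E' -(derive_val (is_derive := dF s sh')) -E /F.
  rewrite (addrCA (h *: v1)); ring.
move=> du dv duv dvu cuv cvu; apply/eqP; rewrite -subr_eq0 -normr_le0.
apply/ler_addgt0Pr => e e0; rewrite add0r.
have e2 : 0 < e / 2 by rewrite divr_gt0.
move/cvgrPdist_lt/(_ _ e2): cuv => cuv; move/cvgrPdist_lt/(_ _ e2): cvu => cvu.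
have [d /= d0 B] : exists2 d : R, 0 < d & forall y, ball x d y ->
   [/\ derivable f y u, derivable f y v,
   derivable ('D_u f) y v, derivable ('D_v f) y u &
   `|'D_v ('D_u f) x - 'D_v ('D_u f) y| < e / 2 /\
   `|'D_u ('D_v f) x - 'D_u ('D_v f) y| < e / 2].
  have fI := @filterI V (nbhs x) (nbhs_filter x).
  have N := fI _ _ (fI _ _ du dv) (fI _ _ (fI _ _ duv dvu) (fI _ _ cuv cvu)).
  have [d /= d0 B] := (nbhs_ballP x _).1 N.
  exists d; first exact: d0.
  by move=> y /B[[a b] [[c e'] [f' g]]]; exact: (And5 a b c e' (conj f' g)).
(* h is so small that all points s u + t v + x with |s|, |t| <= h lie in the
   ball of radius d around x *)
have [h h0 E3] : exists2 h : R, 0 < h & h * (`|u| + `|v| + 1) * 2 = d.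
  have D0 : 0 < `|u| + `|v| + 1 by rewrite ltr_wpDl // addr_ge0.
  exists (d / (`|u| + `|v| + 1) / 2); first by rewrite !divr_gt0.
  by field; rewrite lt0r_neq0.
have near_x (s t : R) : `|s| <= `|h| -> `|t| <= `|h| -> ball x d (s *: u + (t *: v + x)).
  move=> sh th; rewrite -ball_normE /ball_ /= addrA opprD addrCA subrr addr0 normrN.
  have H : `|h| * (`|u| + `|v|) < d.
    have q0 : 0 <= h * (`|u| + `|v|) by rewrite mulr_ge0 ?addr_ge0 // ltW.
    rewrite gtr0_norm //; move: E3 q0 h0; rewrite (mulrDr h) mulr1.
    by move: (h * _) => q E3' q0 hp; lra.
  apply: le_lt_trans H; rewrite mulrDr.
  apply: le_trans (ler_normD _ _) _; rewrite !normrZ.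
  by rewrite lerD // ler_wpM2r.
have near_x' (s t : R) : `|s| <= `|h| -> `|t| <= `|h| ->
    ball x d (s *: v + (t *: u + x)).
  by move=> sh th; rewrite addrCA; apply: near_x.
have [||s [t [sh th E1]]] := half u v h.
- by move=> s t sh th; case: (B _ (near_x s t sh th)) => a _ _ _ _; exact: a.
- by move=> s t sh th; case: (B _ (near_x' t s th sh)) => _ _ a _ _; exact: a.
have [||s' [t' [sh' th' E2]]] := half v u h.
- by move=> i j ih jh; case: (B _ (near_x' i j ih jh)) => _ a _ _ _; exact: a.
- by move=> i j ih jh; case: (B _ (near_x j i jh ih)) => _ _ _ a _; exact: a.
have E : 'D_v ('D_u f) (t *: v + (s *: u + x)) =
         'D_u ('D_v f) (t' *: u + (s' *: v + x)).
  move: ('D_v ('D_u f) _) ('D_u ('D_v f) _) E1 E2 => a b E1 E2.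
  apply: (mulfI (lt0r_neq0 h0)); apply: (mulfI (lt0r_neq0 h0)).
  by rewrite -E1 -E2 (addrCA (h *: u)); congr (_ + _); rewrite addrAC.
case: (B _ (near_x' t s th sh)) => _ _ _ _ [b1 _].
case: (B _ (near_x t' s' th' sh')) => _ _ _ _ [_ b2].
rewrite -E in b2.
have tri (a b c : R) : `|a - c| < e / 2 -> `|b - c| < e / 2 -> `|a - b| <= e.
  move=> ac bc; rewrite (_ : a - b = (a - c) - (b - c)); last by rewrite opprB addrA subrK.
  rewrite (splitr e); apply: le_trans (ler_normB _ _) _.
  exact: lerD (ltW ac) (ltW bc).
exact: tri b1 b2.
Qed.

End Lines.

Section C1.
Variables (R : realType) (n : nat).
Implicit Types (f : 'rV[R]_n -> R) (x y h : 'rV[R]_n).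

Lemma coord_le_norm h j : `|h 0 j| <= `|h|.
Proof.
rewrite [leRHS]/Num.Def.normr /= mx_normrE.
exact: (le_bigmax _ (fun ij : 'I_1 * 'I_n => `|h ij.1 ij.2|) (0, j)).
Qed.

Lemma norm_le_coord h (e : R) : 0 <= e -> (forall j, `|h 0 j| <= e) -> `|h| <= e.
Proof.
move=> e0 he; rewrite [leLHS]/Num.Def.normr /= mx_normrE.
by apply: bigmax_le => // -[i j] _ /=; rewrite (ord1 i).
Qed.

Definition lincomb (D : 'I_n -> R) h : R := \sum_i h 0 i * D i.

Lemma lincomb_linear D : linear (lincomb D : 'rV[R]_n -> R).
Proof.
move=> a u v; rewrite /lincomb scaler_sumr -big_split /=; apply: eq_bigr => i _.
by rewrite !mxE mulrDl -mulrA.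
Qed.

Lemma lincomb_continuous D : continuous (lincomb D).
Proof.
move=> x; rewrite /lincomb.
apply: (@cvg_big R 'I_n +%R 0 xpredT (@add_continuous R) _ (nbhs x) _
  (fun i (y : 'rV[R]_n) => y 0 i * D i)) => i _.
by apply: cvgM; [exact: coord_continuous | exact: cvg_cst].
Qed.

Definition trunc (k : nat) h : 'rV[R]_n := \row_j (if (j < k)%N then h 0 j else 0).

Lemma truncS (k : 'I_n) h : trunc k.+1 h = h 0 k *: delta_mx 0 k + trunc k h.
Proof.
apply/rowP => j; rewrite !mxE eqxx /= ltnS leq_eqVlt.
case: (eqVneq j k) => [->|jk]; first by rewrite eqxx ltnn mulr1 addr0.
by rewrite val_eqE (negbTE jk) /= mulr0 add0r.
Qed.

(** Going from x to x + h one coordinate at a time, the mean value theorem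
   turns each increment into h_k times a value of the k-th partial derivative
   near x. *)
Lemma C1_littleo f x :
  (forall i, \forall y \near x, derivable f y (delta_mx 0 i)) ->
  (forall i, {for x, continuous ('D_(delta_mx 0 i) f)}) ->
  forall e, 0 < e -> \forall h \near (0 : 'rV[R]_n),
    `|f (h + x) - f x - lincomb (fun i => 'D_(delta_mx 0 i) f x) h| <= e * `|h|.
Proof.
move=> df cf e e0.
pose e1 := e / (n%:R + 1).
have n0 : 0 < n%:R + 1 :> R by rewrite ltr_wpDl.
have e10 : 0 < e1 by rewrite divr_gt0.
have N : \forall y \near x, forall i, derivable f y (delta_mx 0 i) /\
    `|'D_(delta_mx 0 i) f x - 'D_(delta_mx 0 i) f y| <= e1.
  apply: (@filter_forall _ 'I_n (fun i y => derivable f y (delta_mx 0 i) /\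
    `|'D_(delta_mx 0 i) f x - 'D_(delta_mx 0 i) f y| <= e1) (nbhs x) (nbhs_filter x)) => i.
  have /cvgrPdist_le /(_ _ e10) ci := cf i.
  exact: (@filterI _ _ (nbhs_filter x) _ _ (df i) ci).
have [d /= d0 B] := (nbhs_ballP x _).1 N.
apply/nbhs_ballP; exists d; first exact: d0.
move=> h; rewrite -ball_normE /ball_ /= sub0r normrN => hd.
have inB (k : 'I_n) (s : R) : `|s| <= `|h 0 k| ->
    ball x d (s *: delta_mx 0 k + (trunc k h + x)).
  move=> sk; rewrite -ball_normE /ball_ /= addrA opprD addrCA subrr addr0 normrN.
  apply: le_lt_trans hd; apply: norm_le_coord => // j; rewrite !mxE eqxx /=.
  case: (eqVneq j k) => [->|jk].
    by rewrite ltnn mulr1 addr0 (le_trans sk) // coord_le_norm.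
  by rewrite mulr0 add0r; case: ifP => _; rewrite ?normr0 // coord_le_norm.
have step (k : 'I_n) : `|f (trunc k.+1 h + x) - f (trunc k h + x) -
      h 0 k * 'D_(delta_mx 0 k) f x| <= `|h| * e1.
  have [s sk E] := @line_MVT R _ f (trunc k h + x) (delta_mx 0 k) (h 0 k)
    (fun s sk => (B _ (inB k s sk) k).1).
  rewrite truncS -(addrA _ (trunc k h) x) E -mulrBr normrM; apply: ler_pM => //.
    exact: coord_le_norm.
  by rewrite distrC; exact: (B _ (inB k s sk) k).2.
have T : f (h + x) - f x = \sum_(k < n) (f (trunc k.+1 h + x) - f (trunc k h + x)).
  rewrite -(big_mkord xpredT (fun k => f (trunc k.+1 h + x) - f (trunc k h + x))).
  rewrite telescope_sumr //; congr (f (_ + x) - f _).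
    by apply/rowP => j; rewrite mxE ltn_ord.
  by apply/rowP => j; rewrite !mxE add0r.
rewrite T /lincomb -sumrB; apply: le_trans (ler_norm_sum _ _ _) _.
apply: (@le_trans _ _ (\sum_(k < n) `|h| * e1)); first by apply: ler_sum => k _.
rewrite sumr_const card_ord -mulr_natr /e1.
rewrite (_ : _ * _ * _ = (n%:R / (n%:R + 1)) * (e * `|h|)); last first.
  by field; rewrite lt0r_neq0.
by rewrite ler_piMl ?mulr_ge0 // ?ltW // ltr_pdivrMr // mul1r ltrDl.
Qed.

Lemma C1_diff f x :
  (forall i, \forall y \near x, derivable f y (delta_mx 0 i)) ->
  (forall i, {for x, continuous ('D_(delta_mx 0 i) f)}) ->
  differentiable f x /\
  forall v, 'D_v f x = lincomb (fun i => 'D_(delta_mx 0 i) f x) v.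
Proof.
move=> df cf; set D := fun i => _.
pose linM := GRing.isLinear.Build _ _ _ _ _ (lincomb_linear D).
pose L : {linear 'rV[R]_n -> R} := HB.pack (lincomb D) linM.
have fo : f \o shift x = cst (f x) + (L : 'rV[R]_n -> R) +o_ (0 : 'rV[R]_n) id.
  apply/eqaddoP => e e0; have := C1_littleo df cf e0.
  rewrite !near_simpl; apply: filter_app; near=> h => H.
  by rewrite -[X in `|X|](addrA) -opprD in H.
have dfE : 'd f x = L :> ('rV[R]_n -> R).
  by apply: diff_unique; [exact: lincomb_continuous | exact: fo].
have dfx : differentiable f x.
  apply/diff_locallyP; rewrite dfE; split; first exact: lincomb_continuous.
  exact: fo.
by split=> // v; rewrite deriveE // dfE.
Unshelve. all: by end_near. Qed.

End C1.

Section CkAlgebra.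
Variables (R : realType) (n : nat).
Implicit Types (D : set 'rV[R]_n) (f g : 'rV[R]_n -> R) (x : 'rV[R]_n).

Lemma Ck_cont k D f x : Ck k D f -> D x -> {for x, continuous f}.
Proof. by case: k => [|k] [cf _] /cf. Qed.

Lemma CkS k D f : Ck k.+1 D f -> Ck k D f.
Proof.
elim: k f => [|k IH] f [cf df]; first by split.
by split=> // i; have [dfi ckf] := df i; split=> //; apply: IH.
Qed.

Lemma Ck_sub k D D' f : D' `<=` D -> Ck k D f -> Ck k D' f.
Proof.
move=> DD; elim: k f => [|k IH] f [cf df]; first by split=> // x /DD /cf.
split=> [x /DD /cf //|i]; have [dfi ckf] := df i.
by split; [move=> x /DD; exact: dfi | exact: IH].
Qed.

Lemma near_open D (P : 'rV[R]_n -> Prop) x :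
  open D -> D x -> (forall y, D y -> P y) -> \forall y \near x, P y.
Proof.
move=> oD Dx H; have := open_nbhs_nbhs (conj oD Dx).
by apply: filterS => y; exact: H.
Qed.

Lemma Ck_ext k D f g :
  open D -> (forall x, D x -> f x = g x) -> Ck k D f -> Ck k D g.
Proof.
move=> oD; have near_fg (f' g' : 'rV[R]_n -> R) x (fg : forall y, D y -> f' y = g' y) (Dx : D x) :
    \forall y \near x, f' y = g' y := near_open oD Dx fg.
have cts (f' g' : 'rV[R]_n -> R) x (fg : forall y, D y -> f' y = g' y) (Dx : D x) :
    {for x, continuous f'} -> {for x, continuous g'}.
  rewrite /prop_for /continuous_at -(fg x Dx) => cf.
  exact: cvg_trans (near_eq_cvg (near_fg f' g' x fg Dx)) cf.
elim: k f g => [|k IH] f g fg [cf df].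
  by split=> // x Dx; apply: cts fg Dx (cf x Dx).
split=> [x Dx|i]; first exact: cts fg Dx (cf x Dx).
have [dfi ckf] := df i; split=> [x Dx|].
  by apply: near_eq_derivable (dfi x Dx); exact: near_fg.
apply: IH ckf => x Dx; apply: near_eq_derive; exact: near_fg.
Qed.

Lemma Ck_local k D f :
  (forall x, D x -> exists2 V : set 'rV[R]_n, V x & Ck k V f) -> Ck k D f.
Proof.
elim: k f => [|k IH] f H.
  by split=> // x /H[V Vx Vf]; exact: (Ck_cont Vf Vx).
split=> [x /H[V Vx Vf]|i]; first exact: (Ck_cont Vf Vx).
split=> [x /H[V Vx [_ /(_ i)[Vf _]]]|]; first exact: Vf.
by apply: IH => x /H[V Vx [_ /(_ i)[_ Vf]]]; exists V.
Qed.

Lemma Ck_cst k D (a : R) : open D -> Ck k D (fun=> a).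
Proof.
move=> oD; elim: k a => [|k IH] a; first by split=> // x _; exact: cst_continuous.
split=> [x _|i]; first exact: cst_continuous.
split=> [x _|]; first exact: derivable_cst.
apply: Ck_ext (IH 0) => // x _.
by rewrite -[LHS]/(0 : R) -[RHS]/('D_('e_i) (cst a) x) derive_cst.
Qed.

Lemma CkD k D f g : open D -> Ck k D f -> Ck k D g -> Ck k D (fun x => f x + g x).
Proof.
move=> oD; elim: k f g => [|k IH] f g [cf df] [cg dg].
  by split=> // x Dx; apply: continuousD; [exact: cf | exact: cg].
split=> [x Dx|i]; first by apply: continuousD; [exact: cf | exact: cg].
have [dfi ckf] := df i; have [dgi ckg] := dg i; split=> [x Dx|].
  by apply: derivableD; [exact: dfi | exact: dgi].
apply: Ck_ext (IH _ _ ckf ckg) => // x Dx.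
by rewrite -[RHS]/('D_('e_i) (f + g) x) deriveD; [|exact: dfi|exact: dgi].
Qed.

Lemma CkM k D f g : open D -> Ck k D f -> Ck k D g -> Ck k D (fun x => f x * g x).
Proof.
move=> oD; elim: k f g => [|k IH] f g ckf ckg.
  by split=> // x Dx; apply: continuousM; [exact: ckf.1 | exact: ckg.1].
have [cf df] := ckf; have [cg dg] := ckg.
split=> [x Dx|i]; first by apply: continuousM; [exact: cf | exact: cg].
have [dfi ckfi] := df i; have [dgi ckgi] := dg i; split=> [x Dx|].
  by apply: derivableM; [exact: dfi | exact: dgi].
have := CkD oD (IH _ _ (CkS ckf) ckgi) (IH _ _ (CkS ckg) ckfi).
apply: Ck_ext => // x Dx.
by rewrite -[RHS]/('D_('e_i) (f * g) x) deriveM; [|exact: dfi|exact: dgi].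
Qed.

Lemma Ck_sum k D (I : Type) (r : seq I) (P : pred I) (F : I -> 'rV[R]_n -> R) :
  open D -> (forall i, P i -> Ck k D (F i)) ->
  Ck k D (fun x => \sum_(i <- r | P i) F i x).
Proof.
move=> oD H.
suff : Ck k D (\sum_(i <- r | P i) F i).
  by apply: Ck_ext => // x _; rewrite fct_sumE.
elim/big_ind : _ => //; first exact: Ck_cst.
by move=> f g cf cg; apply: CkD.
Qed.

Lemma Ck1_diff k D f x : open D -> Ck k.+1 D f -> D x ->
  differentiable f x /\
  forall v, 'D_v f x = lincomb (fun i => 'D_(delta_mx 0 i) f x) v.
Proof.
move=> oD [_ df] Dx; apply: C1_diff => i; have [dfi ckf] := df i.
  by apply: near_open oD Dx _ => y; exact: dfi.
exact: Ck_cont ckf Dx.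
Qed.

Lemma Ck_schwarz D f x i j : open D -> Ck 2 D f -> D x ->
  'D_(delta_mx 0 i) ('D_(delta_mx 0 j) f) x = 'D_(delta_mx 0 j) ('D_(delta_mx 0 i) f) x.
Proof.
move=> oD [_ df] Dx; have [di [_ /(_ j)[dij [cij _]]]] := df i.
have [dj [_ /(_ i)[dji [cji _]]]] := df j.
apply: derive_comm.
- exact: near_open oD Dx dj.
- exact: near_open oD Dx di.
- exact: near_open oD Dx dji.
- exact: near_open oD Dx dij.
- exact: cji.
- exact: cij.
Qed.

Lemma continuous_coords (t : 'rV[R]_n -> 'rV[R]_n) x :
  (forall j, {for x, continuous (fun y => t y 0 j)}) -> {for x, continuous t}.
Proof.
move=> ct; apply: (cvgrPdist_le (FF := nbhs_filter x) t (t x)).2 => e e0.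
have N : \forall y \near x, forall j, `|t x 0 j - t y 0 j| <= e.
  apply: (@filter_forall _ 'I_n (fun j y => `|t x 0 j - t y 0 j| <= e)
    (nbhs x) (nbhs_filter x)) => j.
  by have /cvgrPdist_le /(_ _ e0) := ct j.
apply: filterS N => y H; apply: norm_le_coord; first exact: ltW.
by move=> j; rewrite !mxE; exact: H.
Qed.

Lemma derive_comp_coords (t : 'rV[R]_n -> 'rV[R]_n) f x v :
  (forall j, differentiable (fun y => t y 0 j) x) -> differentiable f (t x) ->
  differentiable (f \o t) x /\
  'D_v (f \o t) x = 'D_(\row_j 'D_v (fun y => t y 0 j) x) f (t x).
Proof.
move=> dt df.
have dtx : differentiable t x.
  have -> : t = \sum_(j < n) (fun y => t y 0 j *: (delta_mx 0 j : 'rV[R]_n)).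
    by apply/funext => y; rewrite fct_sumE -row_sum_delta.
  by apply: differentiable_sum => j; apply: differentiableZl.
split; first exact: differentiable_comp.
rewrite deriveE; last exact: differentiable_comp.
rewrite diff_comp //= -(deriveE _ dtx) -(deriveE _ df); congr ('D_ _ f (t x)).
by rewrite derive_mx //; [apply/rowP => j; rewrite !mxE | exact: diff_derivable].
Qed.

(** By the chain rule the partial derivatives of f o t are sums of products of
   partial derivatives of t and functions (D_j f) o t, which are of class C^k by
   induction. *)
Lemma Ck_comp k D D' (t : 'rV[R]_n -> 'rV[R]_n) f : open D -> open D' ->
  (forall x, D x -> D' (t x)) -> (forall j, Ck k D (fun x => t x 0 j)) ->
  Ck k D' f -> Ck k D (fun x => f (t x)).
Proof.
move=> oD oD' DD'; elim: k f => [|k IH] f ct cf.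
  split=> // x Dx; apply: (@continuous_comp _ _ _ t f).
    by apply: continuous_coords => j; apply: Ck_cont (ct j) Dx.
  exact: Ck_cont cf (DD' x Dx).
have dc x v (Dx : D x) := @derive_comp_coords t f x v
  (fun j => (Ck1_diff oD (ct j) Dx).1) (Ck1_diff oD' cf (DD' x Dx)).1.
split=> [x Dx|i].
  apply: differentiable_continuous; exact: (dc x 0 Dx).1.
split=> [x Dx|]; first exact: diff_derivable (dc x 0 Dx).1.
have ck : Ck k D (fun x => \sum_j ('D_(delta_mx 0 i) (fun y => t y 0 j) x *
     'D_(delta_mx 0 j) f (t x))).
  apply: Ck_sum => // j _; apply: CkM => //; first by have [_ /(_ i)[_]] := ct j.
  apply: (IH ('D_('e_j) f)); first by move=> l; apply: CkS.
  by have [_ /(_ j)[_]] := cf.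
apply: Ck_ext ck => // x Dx; rewrite -[RHS]/('D_('e_i) (f \o t) x) (dc _ _ Dx).2.
by rewrite (Ck1_diff oD' cf (DD' x Dx)).2; apply: eq_bigr => j _; rewrite mxE.
Qed.

End CkAlgebra.

(** * Smooth functions on a manifold *)

Section ManifoldCalculus.
Variables (R : realType) (n : nat) (M : manifold R n).
Implicit Types (c : chart M) (p q : M) (U V : set M) (f g : M -> R) (X : 'rV[R]_n).

Definition chart_image c U : set 'rV[R]_n := cod c `&` of_coord c @^-1` U.

Lemma open_chart_image c U : open U -> open (chart_image c U).
Proof.
move=> oU; rewrite openE => x [cx Ux].
apply: (@filterI _ _ (nbhs_filter x)).
  exact: open_nbhs_nbhs (conj (@cod_open _ _ M c) cx).
by apply: (of_coord_continuous cx); exact: open_nbhs_nbhs.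
Qed.

Lemma to_chart_image c U p : dom c p -> U p -> chart_image c U (to_coord c p).
Proof. by move=> cp Up; split; [exact: to_coord_cod | rewrite /= to_coordK]. Qed.

Lemma smooth_on_sub U V f : V `<=` U -> smooth_on U f -> smooth_on V f.
Proof. by move=> VU sf c k; apply: Ck_sub (sf c k) => x [cx /VU]. Qed.

Lemma smooth_on_ext U f g :
  open U -> (forall p, U p -> f p = g p) -> smooth_on U f -> smooth_on U g.
Proof.
move=> oU fg sf c k; apply: Ck_ext (sf c k); first exact: open_chart_image.
by move=> x [_ /fg].
Qed.

Lemma smooth_on_local U f :
  (forall p, U p -> exists2 V : set M, V p & smooth_on V f) -> smooth_on U f.
Proof.
move=> H c k; apply: Ck_local => x [cx /H[V Vx sV]].
by exists (chart_image c V); [split | exact: sV].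
Qed.

Lemma smooth_on_cst U (a : R) : open U -> smooth_on U (fun=> a).
Proof. by move=> oU c k; apply: Ck_cst; exact: open_chart_image. Qed.

Lemma smooth_onD U f g : open U -> smooth_on U f -> smooth_on U g ->
  smooth_on U (fun p => f p + g p).
Proof.
move=> oU sf sg c k.
by apply: (CkD (open_chart_image oU) (sf c k) (sg c k)).
Qed.

Lemma smooth_onM U f g : open U -> smooth_on U f -> smooth_on U g ->
  smooth_on U (fun p => f p * g p).
Proof.
move=> oU sf sg c k.
by apply: (CkM (open_chart_image oU) (sf c k) (sg c k)).
Qed.

Lemma smooth_on_sum U (I : Type) (r : seq I) (P : pred I) (F : I -> M -> R) :
  open U -> (forall i, P i -> smooth_on U (F i)) ->
  smooth_on U (fun p => \sum_(i <- r | P i) F i p).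
Proof.
move=> oU sF c k; apply: (@Ck_sum _ _ k _ I r P (fun i => F i \o of_coord c)).
  exact: open_chart_image.
by move=> i Pi; exact: sF.
Qed.

(** Any other chart differs from c by a smooth change of coordinates, so one
   chart decides. *)
Lemma smooth_on_chart c U f : open U -> U `<=` dom c ->
  smooth (chart_image c U) (f \o of_coord c) -> smooth_on U f.
Proof.
move=> oU Uc sf c' k.
have co : Ck k (chart_image c' U)
    (fun x => (f \o of_coord c) (to_coord c (of_coord c' x))).
  apply: (@Ck_comp _ _ k _ (chart_image c U) (fun x => to_coord c (of_coord c' x))).
  - exact: open_chart_image.
  - exact: open_chart_image.
  - by move=> x [cx Ux]; apply: to_chart_image => //; exact: Uc.
  - move=> j; apply: Ck_sub (@transition_smooth _ _ M c' c j k) => x [cx Ux].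
    by split=> //; exact: Uc.
  - exact: sf.
apply: Ck_ext co; first exact: open_chart_image.
by move=> x [cx Ux] /=; rewrite to_coordK //; exact: Uc.
Qed.

Lemma smooth_coord c j : smooth_on (dom c) (fun q => to_coord c q 0 j).
Proof. by move=> c' k; exact: transition_smooth. Qed.

Lemma pd_smooth U c i f :
  open U -> smooth_on U f -> smooth_on (U `&` dom c) (pd c i f).
Proof.
move=> oU sf; have oUc := openI oU (@dom_open _ _ M c).
apply: (@smooth_on_chart c); [by []|by move=> p []|move=> k].
apply: (@Ck_ext _ _ k _ ('D_(delta_mx 0 i) (f \o of_coord c))).
- exact: open_chart_image.
- by move=> x [cx _]; rewrite /pd /deriv /= of_coordK.
have [_ /(_ i)[_]] := sf c k.+1.
by apply: Ck_sub => x [cx [Ux _]].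
Qed.

Section AtPoint.
Variables (U : set M) (c : chart M) (p : M).
Hypotheses (oU : open U) (Up : U p) (cp : dom c p).

Let Ix : chart_image c U (to_coord c p) := to_chart_image cp Up.
Let oI : open (chart_image c U) := open_chart_image oU.

Lemma deriv_ext X f g : (forall q, U q -> f q = g q) -> deriv c X f p = deriv c X g p.
Proof.
move=> fg; apply: near_eq_derive; apply: (near_open oI Ix) => x [_ Ux] /=.
exact: fg.
Qed.

Lemma pd_ext i f g : (forall q, U q -> f q = g q) -> pd c i f p = pd c i g p.
Proof. exact: deriv_ext. Qed.

Lemma deriv_lin X f : smooth_on U f -> deriv c X f p = \sum_i X 0 i * pd c i f p.
Proof. by move=> sf; rewrite /deriv (Ck1_diff oI (sf c 1%N) Ix).2. Qed.

Lemma pd_cst i (a : R) : pd c i (fun=> a) p = 0.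
Proof. exact: derive_cst. Qed.

Lemma pdD i f g : smooth_on U f -> smooth_on U g ->
  pd c i (fun q => f q + g q) p = pd c i f p + pd c i g p.
Proof.
move=> sf sg; rewrite /pd /deriv.
have [_ /(_ i)[df _]] := sf c 1%N; have [_ /(_ i)[dg _]] := sg c 1%N.
by rewrite -(deriveD (df _ Ix) (dg _ Ix)).
Qed.

Lemma pdM i f g : smooth_on U f -> smooth_on U g ->
  pd c i (fun q => f q * g q) p = pd c i f p * g p + f p * pd c i g p.
Proof.
move=> sf sg; rewrite /pd /deriv.
have [_ /(_ i)[df _]] := sf c 1%N; have [_ /(_ i)[dg _]] := sg c 1%N.
rewrite -[LHS]/('D_('e_i) ((f \o of_coord c) * (g \o of_coord c)) (to_coord c p)).
rewrite (deriveM (df _ Ix) (dg _ Ix)) /= !to_coordK // addrC.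
by congr (_ + _); rewrite [LHS]mulrC.
Qed.

Lemma pd_sum i (I : Type) (r : seq I) (P : pred I) (F : I -> M -> R) :
  (forall j, P j -> smooth_on U (F j)) ->
  pd c i (fun q => \sum_(j <- r | P j) F j q) p =
  \sum_(j <- r | P j) pd c i (F j) p.
Proof.
move=> sF; elim: r => [|j r IH].
  rewrite big_nil -[RHS](pd_cst i 0); apply: pd_ext => q _.
  by rewrite big_nil.
rewrite big_cons -IH; case: ifPn => [Pj|Pj].
  rewrite -pdD; [|exact: sF|exact: smooth_on_sum].
  by apply: pd_ext => q _; rewrite big_cons Pj.
by apply: pd_ext => q _; rewrite big_cons (negbTE Pj).
Qed.

Lemma pd_comm i j f : smooth_on U f -> pd c i (pd c j f) p = pd c j (pd c i f) p.
Proof.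
move=> sf.
have E k l : pd c k (pd c l f) p =
    'D_('e_k) ('D_('e_l) (f \o of_coord c)) (to_coord c p).
  apply: near_eq_derive; apply: (near_open oI Ix) => x [cx _].
  by rewrite /pd /deriv /= of_coordK.
by rewrite !E; apply: (Ck_schwarz _ _ oI (sf c 2%N) Ix).
Qed.

End AtPoint.

(** ** Change of chart *)

Lemma jac_id c p : dom c p -> jac c c p = 1%:M.
Proof.
move=> cp; apply/matrixP => i j; rewrite !mxE /pd /deriv.
have cx : chart_image c (dom c) (to_coord c p) := to_chart_image cp cp.
rewrite (@near_eq_derive _ _ _ _ (fun x : 'rV[R]_n => x 0 j)); last first.
  apply: (near_open (open_chart_image (@dom_open _ _ M c)) cx) => x [cox _] /=.
  by rewrite of_coordK.
have dx : derivable (id : 'rV[R]_n -> 'rV[R]_n) (to_coord c p) 'e_i.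
  exact: derivable_id.
have := congr1 (fun A : 'rV[R]_n => A 0 j) (derive_mx dx).
by rewrite derive_id !mxE eqxx /= eq_sym => <-.
Qed.

Lemma deriv_change U c c' X f p : open U -> U p -> dom c p -> dom c' p ->
  smooth_on U f -> deriv c X f p = deriv c' (X *m jac c c' p) f p.
Proof.
move=> oU Up cp cp' sf.
pose W := U `&` (dom c `&` dom c').
have oW : open W by apply: openI => //; apply: openI; exact: dom_open.
have Wp : W p by [].
have IW := to_chart_image cp Wp; have oI := open_chart_image (c := c) oW.
have sc j : smooth_on W (fun q => to_coord c' q 0 j).
  by apply: smooth_on_sub (@smooth_coord c' j) => q [_ []].
have sfW : smooth_on W f by apply: smooth_on_sub sf => q [].
have dt j := (Ck1_diff oI (sc j c 1%N) IW).1.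
have df := (Ck1_diff (open_chart_image oW) (sfW c' 1%N) (to_chart_image cp' Wp)).1.
pose t (x : 'rV[R]_n) := to_coord c' (of_coord c x).
have tp : t (to_coord c p) = to_coord c' p by rewrite /t to_coordK.
have := (@derive_comp_coords _ _ t (f \o of_coord c') (to_coord c p) X dt).
rewrite tp => /(_ df)[_ E]; rewrite /deriv.
transitivity ('D_X ((f \o of_coord c') \o t) (to_coord c p)).
  apply: near_eq_derive; apply: (near_open oI IW) => x [_ [_ [_ cx']]].
  by rewrite /t /= to_coordK.
rewrite E; congr ('D_ _ _ _); apply/rowP => j; rewrite !mxE.
rewrite -[LHS]/(deriv c X (fun q => to_coord c' q 0 j) p) (deriv_lin oW Wp cp _ (sc j)).
by apply: eq_bigr => i _; rewrite mxE.
Qed.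

Lemma jac_cocycle c c' c'' p : dom c p -> dom c' p -> dom c'' p ->
  jac c c' p *m jac c' c'' p = jac c c'' p.
Proof.
move=> cp cp' cp''; apply/matrixP => i j; rewrite [RHS]mxE /pd.
have sj := @smooth_coord c'' j.
rewrite (deriv_change _ (@dom_open _ _ M c'') cp'' cp cp' sj).
rewrite (deriv_lin (@dom_open _ _ M c'') cp'' cp' _ sj) !mxE.
apply: eq_bigr => k _; rewrite -rowE !mxE; congr (_ * _).
Qed.

Lemma jac_smooth c c' i j : smooth_on (dom c' `&` dom c) (fun p => jac c c' p i j).
Proof.
have := pd_smooth c i (@dom_open _ _ M c') (@smooth_coord c' j).
apply: smooth_on_ext; first by apply: openI; exact: dom_open.
by move=> p _; rewrite mxE.
Qed.

Lemma tangent_in c c' X p : dom c p -> dom c' p ->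
  tangent c X p *m jac (chart_at p) c' p = X *m jac c c' p.
Proof.
by move=> cp cp'; rewrite -mulmxA jac_cocycle //; exact: chart_atP.
Qed.

Lemma tangent_smooth c X : smooth_frame (dom c) (tangent c X).
Proof.
move=> c' i j.
have oU : open (dom c `&` dom c') by apply: openI; exact: dom_open.
apply: (@smooth_on_ext _ (fun p => \sum_k X i k * jac c c' p k j)) => //.
  by move=> p [cp cp']; rewrite /frame_in tangent_in // mxE.
apply: smooth_on_sum => // k _; apply: smooth_onM => //.
  exact: smooth_on_cst.
by apply: smooth_on_sub (@jac_smooth c c' k j) => p [].
Qed.

Lemma deriv_tangent U c X f p : open U -> U p -> dom c p -> smooth_on U f ->
  deriv (chart_at p) (tangent c X p) f p = deriv c X f p.
Proof.
move=> oU Up cp sf; rewrite [RHS](deriv_change _ oU Up cp (chart_atP p) sf) //.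
Qed.

(** ** Matrix-valued functions *)

Definition smooth_mx k l U (A : M -> 'M[R]_(k, l)) :=
  forall i j, smooth_on U (fun q => A q i j).

Definition dmx k l c a (A : M -> 'M[R]_(k, l)) p : 'M[R]_(k, l) :=
  \matrix_(i, j) pd c a (fun q => A q i j) p.

Lemma smooth_mxM k l s U (A : M -> 'M[R]_(k, l)) (B : M -> 'M[R]_(l, s)) :
  open U -> smooth_mx U A -> smooth_mx U B -> smooth_mx U (fun q => A q *m B q).
Proof.
move=> oU sA sB i j.
apply: (@smooth_on_ext _ (fun q => \sum_h A q i h * B q h j)) => //.
  by move=> q _; rewrite mxE.
by apply: smooth_on_sum => // h _; apply: smooth_onM.
Qed.

Lemma smooth_mxD k l U (A B : M -> 'M[R]_(k, l)) :
  open U -> smooth_mx U A -> smooth_mx U B -> smooth_mx U (fun q => A q + B q).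
Proof.
move=> oU sA sB i j.
apply: (@smooth_on_ext _ (fun q => A q i j + B q i j)) => //.
  by move=> q _; rewrite mxE.
exact: smooth_onD.
Qed.

Lemma smooth_mx_tr k l U (A : M -> 'M[R]_(k, l)) :
  open U -> smooth_mx U A -> smooth_mx U (fun q => (A q)^T).
Proof.
move=> oU sA i j; apply: smooth_on_ext (sA j i) => // q _.
by rewrite mxE.
Qed.

Lemma smooth_mx_ext k l U (A B : M -> 'M[R]_(k, l)) :
  open U -> (forall q, U q -> A q = B q) -> smooth_mx U A -> smooth_mx U B.
Proof.
by move=> oU AB sA i j; apply: smooth_on_ext (sA i j) => // q /AB->.
Qed.

Lemma smooth_mx_sub k l U V (A : M -> 'M[R]_(k, l)) :
  V `<=` U -> smooth_mx U A -> smooth_mx V A.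
Proof. by move=> VU sA i j; exact: smooth_on_sub (sA i j). Qed.

Lemma dmx_smooth k l c a U (A : M -> 'M[R]_(k, l)) :
  open U -> smooth_mx U A -> smooth_mx (U `&` dom c) (dmx c a A).
Proof.
move=> oU sA i j; apply: smooth_on_ext (pd_smooth c a oU (sA i j)).
  by apply: openI => //; exact: dom_open.
by move=> q _; rewrite mxE.
Qed.

Section MxAtPoint.
Variables (U : set M) (c : chart M) (p : M).
Hypotheses (oU : open U) (Up : U p) (cp : dom c p).

Lemma dmx_ext k l a (A B : M -> 'M[R]_(k, l)) :
  (forall q, U q -> A q = B q) -> dmx c a A p = dmx c a B p.
Proof.
move=> AB; apply/matrixP => i j; rewrite !mxE; apply: (pd_ext oU Up cp) => q /AB.
by move->.
Qed.

Lemma dmx_cst k l a (A : 'M[R]_(k, l)) : dmx c a (fun=> A) p = 0.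
Proof. by apply/matrixP => i j; rewrite !mxE pd_cst. Qed.

Lemma dmxM k l s a (A : M -> 'M[R]_(k, l)) (B : M -> 'M[R]_(l, s)) :
  smooth_mx U A -> smooth_mx U B ->
  dmx c a (fun q => A q *m B q) p = dmx c a A p *m B p + A p *m dmx c a B p.
Proof.
move=> sA sB; apply/matrixP => i j; rewrite !mxE -big_split /=.
transitivity (pd c a (fun q => \sum_h A q i h * B q h j) p).
  by apply: (pd_ext oU Up cp) => q _; rewrite mxE.
rewrite (pd_sum oU Up cp) => [|h _]; last exact: smooth_onM.
by apply: eq_bigr => h _; rewrite (pdM Up cp) // !mxE.
Qed.

Lemma dmxD k l a (A B : M -> 'M[R]_(k, l)) :
  smooth_mx U A -> smooth_mx U B ->
  dmx c a (fun q => A q + B q) p = dmx c a A p + dmx c a B p.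
Proof.
move=> sA sB; apply/matrixP => i j; rewrite !mxE.
transitivity (pd c a (fun q => A q i j + B q i j) p).
  by apply: (pd_ext oU Up cp) => q _; rewrite mxE.
by rewrite (pdD Up cp).
Qed.

Lemma dmx_tr k l a (A : M -> 'M[R]_(k, l)) :
  dmx c a (fun q => (A q)^T) p = (dmx c a A p)^T.
Proof.
apply/matrixP => i j; rewrite [LHS]mxE [RHS]mxE [RHS]mxE.
by apply: (pd_ext oU Up cp) => q _; rewrite mxE.
Qed.

Lemma dmx_comm k l a b (A : M -> 'M[R]_(k, l)) : smooth_mx U A ->
  dmx c a (dmx c b A) p = dmx c b (dmx c a A) p.
Proof.
move=> sA; apply/matrixP => i j; rewrite [LHS]mxE [RHS]mxE.
transitivity (pd c a (pd c b (fun q => A q i j)) p).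
  by apply: (pd_ext oU Up cp) => q _; rewrite mxE.
rewrite (pd_comm oU Up cp _ _ (sA i j)).
by apply: (pd_ext oU Up cp) => q _; rewrite mxE.
Qed.

End MxAtPoint.

End ManifoldCalculus.

(** * The Levi-Civita connection in an orthonormal frame *)

(** Matrices form a noncommutative ring, out of reach of the tactic for
   commutative ones; but after expansion every product can be treated as an atom,
   and the identity is checked on entries. *)
Ltac mx_ring :=
  rewrite ?(mulmxDl, mulmxDr, mulmxBl, mulmxBr, mulNmx, mulmxN, mulmxA);
  repeat match goal with |- context [mulmx ?A ?B] =>
    let P := fresh "P" in set P := mulmx A B; clearbody P end;
  apply/matrixP => ? ?; rewrite ?mxE; ring.

Lemma eq_of_sub2 (V : zmodType) (x y z w u v : V) :
  x = y -> z = w -> u - v = (y - x) - (w - z) -> u = v.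
Proof. by move=> -> ->; rewrite !subrr => /subr0_eq. Qed.

Lemma d_inverse (R : comPzRingType) n (C E dC dE w Gm : 'M[R]_n) :
  C *m E = 1%:M -> E *m C = 1%:M -> dC *m E + C *m dE = 0 ->
  dE + E *m Gm = w *m E -> dC = Gm *m C - C *m w.
Proof.
move=> CE EC H F; apply/eqP; rewrite -subr_eq0; apply/eqP.
have {}F : dE = w *m E - E *m Gm by rewrite -F addrK.
rewrite -[RHS](mul0mx _ C) -H F !(mulmxDl, mulmxDr, mulmxN, mulNmx) -!mulmxA.
by rewrite EC !mulmx1 (mulmxA C E) CE mul1mx opprB.
Qed.

Lemma antisym_of_metric (R : comPzRingType) n (E G dE Gm : 'M[R]_n) : G^T = G ->
  ((dE + E *m Gm) *m (G *m E^T))^T + (dE + E *m Gm) *m (G *m E^T) =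
  dE *m (G *m E^T) + E *m ((Gm *m G + G *m Gm^T) *m E^T + G *m dE^T).
Proof. by move=> GT; rewrite !trmx_mul trmxK GT linearD /= trmx_mul; mx_ring. Qed.

Lemma curvature_algebra (R : comPzRingType) n
    (E wa wb Ga Gb dwab dwba dGab dGba X : 'M[R]_n) :
  X + (wa *m E - E *m Ga) *m Gb + E *m dGab =
    dwab *m E + wb *m (wa *m E - E *m Ga) ->
  X + (wb *m E - E *m Gb) *m Ga + E *m dGba =
    dwba *m E + wa *m (wb *m E - E *m Gb) ->
  (dwab - dwba - (wa *m wb - wb *m wa)) *m E =
    E *m (dGab - dGba + (Gb *m Ga - Ga *m Gb)).
Proof. by move=> Hab Hba; apply: (eq_of_sub2 Hab Hba); mx_ring. Qed.

Lemma antisym_algebra (R : comPzRingType) n (x y wa wb : 'M[R]_n) :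
  x^T = - x -> y^T = - y -> wa^T = - wa -> wb^T = - wb ->
  (x - y - (wa *m wb - wb *m wa))^T = - (x - y - (wa *m wb - wb *m wa)).
Proof.
by move=> xT yT aT bT; rewrite !linearB /= !trmx_mul xT yT aT bT; mx_ring.
Qed.

Lemma entry_opp (R : pzRingType) m n (A B : 'M[R]_(m, n)) i j :
  A = - B -> A i j = - B i j.
Proof. by move=> ->; rewrite mxE. Qed.

Lemma antisym_entry (R : pzRingType) n (A : 'M[R]_n) :
  A^T = - A -> forall i j, A i j = - A j i.
Proof. by move=> AT i j; rewrite -(entry_opp j i AT) mxE. Qed.

Section LeviCivita.
Variables (R : realType) (n : nat) (M : manifold R n) (g : metric M).
Variables (c : chart M) (U : set M) (e : M -> 'M[R]_n).
Hypotheses (oU : open U) (e_smooth : smooth_frame U e).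
Hypothesis e_ortho : forall q, U q -> e q *m gram g q *m (e q)^T = 1%:M.
Implicit Types (p q : M) (a b : 'I_n).

Local Notation W := (U `&` dom c).
Local Notation E := (frame_in c e).
Local Notation G := (metric_in g c).

(** The rows of E are the components of the frame vectors, and row j of the
   coframe holds the components of d_j in the frame. *)
Definition coframe q : 'M[R]_n := G q *m (E q)^T.
Definition Gam a q : 'M[R]_n := \matrix_(b, k) christoffel g c k a b q.
Definition om a q : 'M[R]_n := lc_form g c (delta_mx 0 a) e q.
Definition Rm a b q : 'M[R]_n := \matrix_(k, l) riemann g c l k a b q.
(** The frame index acts on E from the left and the coordinate index from the
   right, so that nabla_a E = d_a E + E Gam_a = om_a E. As matrices compose in
   the opposite order to the endomorphisms of which they are the rows, the
   commutator enters the curvature with a minus sign. *)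
Definition Om a b q : 'M[R]_n :=
  dmx c a (om b) q - dmx c b (om a) q - (om a q *m om b q - om b q *m om a q).

Let oW : open W := openI oU (@dom_open _ _ M c).

Lemma metric_in_sym q : (G q)^T = G q.
Proof. by rewrite /metric_in /gram_in !trmx_mul trmxK gram_sym mulmxA. Qed.

Lemma metric_in_symE q i j : G q i j = G q j i.
Proof. by rewrite -[in LHS]metric_in_sym mxE. Qed.

Lemma frame_coframe q : W q -> E q *m coframe q = 1%:M.
Proof.
move=> [Uq cq]; rewrite /coframe /frame_in /metric_in /gram_in trmx_mul.
have J := jac_cocycle (chart_atP q) cq (chart_atP q).
have JT : (jac c (chart_at q) q)^T *m (jac (chart_at q) c q)^T = 1%:M.
  by rewrite -trmx_mul J jac_id ?trmx1 //; exact: chart_atP.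
rewrite -[RHS](e_ortho Uq) !mulmxA -(mulmxA (e q)) J jac_id; last exact: chart_atP.
by rewrite mulmx1 -(mulmxA _ _ (jac (chart_at q) c q)^T) JT mulmx1.
Qed.

Lemma coframe_frame q : W q -> coframe q *m E q = 1%:M.
Proof. by move=> Wq; apply: mulmx1C; exact: frame_coframe. Qed.

Lemma invmx_metric q : W q -> invmx (G q) = (E q)^T *m E q.
Proof.
move=> Wq; have GE : G q *m ((E q)^T *m E q) = 1%:M.
  by rewrite mulmxA; exact: coframe_frame.
have [uG _] := mulmx1_unit GE.
by rewrite -[RHS](mulKmx uG) GE mulmx1.
Qed.

Lemma frame_in_smooth : smooth_mx W E.
Proof. by move=> i j; exact: e_smooth. Qed.

Lemma metric_smooth : smooth_mx W G.
Proof. by move=> i j; apply: smooth_on_sub (@gram_smooth _ _ _ g c i j) => q []. Qed.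

Lemma coframe_smooth : smooth_mx W coframe.
Proof.
exact: smooth_mxM oW metric_smooth (smooth_mx_tr oW frame_in_smooth).
Qed.

(** ** The Christoffel symbols *)

Lemma christoffelC k a b : christoffel g c k a b = christoffel g c k b a.
Proof.
apply/funext => q; rewrite /christoffel; congr (_ * _); apply: eq_bigr => l _.
congr (_ * (_ - _)); first by rewrite addrC.
by congr (pd c l _ q); apply/funext => x; exact: metric_in_symE.
Qed.

Lemma Gam_metric a q : W q -> Gam a q *m G q = \matrix_(b, l)
  (2^-1 * (pd c a (fun x => G x b l) q + pd c b (fun x => G x a l) q -
           pd c l (fun x => G x a b) q)).
Proof.
move=> Wq; pose T : 'M[R]_n := \matrix_(b, l) 
  (2^-1 * (pd c a (fun x => G x b l) q + pd c b (fun x => G x a l) q -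
           pd c l (fun x => G x a b) q)).
have uG : G q \in unitmx.
  have GE : G q *m ((E q)^T *m E q) = 1%:M.
    by rewrite mulmxA; exact: coframe_frame.
  by have [] := mulmx1_unit GE.
rewrite -/T -[RHS](mulmxKV uG); congr (_ *m _); apply/matrixP => b k.
rewrite !mxE /christoffel mulr_sumr; apply: eq_bigr => l _; rewrite mxE.
rewrite (_ : invmx (G q) k l = invmx (G q) l k); first by rewrite mulrCA mulrC.
by rewrite -[in LHS]metric_in_sym -trmx_inv mxE.
Qed.

(** Adding the transpose cancels the derivatives of G in the directions of the
   two other indices. *)
Lemma metric_compat a q : W q ->
  Gam a q *m G q + G q *m (Gam a q)^T = dmx c a G q.
Proof.
move=> Wq; rewrite -[X in X *m (Gam a q)^T]metric_in_sym -trmx_mul Gam_metric //.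
apply/matrixP => b l; rewrite !mxE.
have S i j k : pd c k (fun x => G x i j) q = pd c k (fun x => G x j i) q.
  by congr (pd c k _ q); apply/funext => x; exact: metric_in_symE.
rewrite (S l b).
by set x := pd _ _ _ _; set y := pd _ _ _ _; set z := pd _ _ _ _; field.
Qed.

Lemma Gam_smooth a : smooth_mx W (Gam a).
Proof.
move=> b k; apply: (@smooth_on_ext _ _ _ _ (fun q => 2^-1 * \sum_(l < n)
   (((E q)^T *m E q) k l * (pd c a (fun x => G x b l) q +
     (pd c b (fun x => G x a l) q + (-1) * pd c l (fun x => G x a b) q))))) => //.
  move=> q Wq; rewrite mxE /christoffel -invmx_metric //; congr (_ * _).
  by apply: eq_bigr => l _; rewrite mulN1r addrA.
have sG i j l : smooth_on W (pd c l (fun x => G x i j)).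
  apply: smooth_on_sub (pd_smooth c l oW (@metric_smooth i j)) => q [Uq cq].
  by [].
have sE : smooth_mx W (fun q => (E q)^T *m E q).
  exact: smooth_mxM oW (smooth_mx_tr oW frame_in_smooth) frame_in_smooth.
apply: smooth_onM => //; first exact: smooth_on_cst.
apply: smooth_on_sum => // l _; apply: smooth_onM => //.
apply: smooth_onD => //; apply: smooth_onD => //; apply: smooth_onM => //.
exact: smooth_on_cst.
Qed.

(** ** The connection form *)

Lemma omE a q : om a q = (dmx c a E q + E q *m Gam a q) *m coframe q.
Proof.
rewrite /om /lc_form -mulmxA; congr (_ *m _); apply/matrixP => i k; rewrite !mxE.
congr (_ + _); rewrite (bigD1 a) //= [X in _ + X]big1 ?addr0.
  by apply: eq_bigr => b _; rewrite !mxE !eqxx mul1r mulrC.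
by move=> b ba; apply: big1 => l _; rewrite !mxE (negbTE ba) andbF !mul0r.
Qed.

Lemma d_frame a q : W q -> dmx c a E q + E q *m Gam a q = om a q *m E q.
Proof. by move=> Wq; rewrite omE -mulmxA coframe_frame // mulmx1. Qed.

Lemma om_smooth a : smooth_mx W (om a).
Proof.
apply: (@smooth_mx_ext _ _ _ _ _ _ (fun q => (dmx c a E q + E q *m Gam a q) *m coframe q)) => //.
  by move=> q _; rewrite omE.
apply: (smooth_mxM oW _ coframe_smooth); apply: (smooth_mxD oW).
  by apply: smooth_mx_sub (dmx_smooth c a oW frame_in_smooth) => q [].
exact: smooth_mxM oW frame_in_smooth (Gam_smooth a).
Qed.

Lemma d_coframe a q : W q ->
  dmx c a coframe q = Gam a q *m coframe q - coframe q *m om a q.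
Proof.
move=> Wq; have cq := Wq.2.
have : dmx c a (fun x => coframe x *m E x) q = 0.
  rewrite (dmx_ext oW Wq cq _ (B := fun=> 1%:M)) ?dmx_cst //.
  by move=> x Wx; rewrite coframe_frame.
rewrite (dmxM oW Wq cq _ coframe_smooth frame_in_smooth) => H.
exact: d_inverse (coframe_frame Wq) (frame_coframe Wq) H (d_frame a Wq).
Qed.

Lemma om_antisym a q : W q -> (om a q)^T = - om a q.
Proof.
move=> Wq; have cq := Wq.2; apply/eqP; rewrite -addr_eq0; apply/eqP.
have sG := metric_smooth; have sE := frame_in_smooth; have sT := smooth_mx_tr oW sE.
have : dmx c a (fun x => E x *m (G x *m (E x)^T)) q = 0.
  rewrite (dmx_ext oW Wq cq _ (B := fun=> 1%:M)) ?dmx_cst //.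
  by move=> x Wx; rewrite -[RHS](frame_coframe Wx).
rewrite (dmxM oW Wq cq _ sE (smooth_mxM oW sG sT)) (dmxM oW Wq cq _ sG sT).
rewrite (dmx_tr oW Wq cq) -metric_compat // => H.
rewrite -[RHS]H omE /coframe; exact: antisym_of_metric (metric_in_sym q).
Qed.

(** ** Curvature *)

Lemma RmE a b q : Rm a b q =
  dmx c a (Gam b) q - dmx c b (Gam a) q + (Gam b q *m Gam a q - Gam a q *m Gam b q).
Proof.
apply/matrixP => k l; rewrite [LHS]mxE /riemann.
have P i j : pd c i (christoffel g c l j k) q = dmx c i (Gam j) q k l.
  rewrite mxE; congr (pd c i _ q); apply/funext => x; by rewrite mxE.
have mxBDE (A B C D : 'M[R]_n) : (A - B + (C - D)) k l = A k l - B k l + (C k l - D k l).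
  by rewrite !mxE.
rewrite !P mxBDE; congr (_ + _); rewrite big_split /= sumrN.
rewrite [(Gam b q *m _) k l]mxE [(Gam a q *m _) k l]mxE /Gam.
by congr (_ - _); apply: eq_bigr => h _; rewrite [_ k h]mxE [_ h l]mxE mulrC.
Qed.

(** Differentiate d_b E = om_b E - E Gam_b along a and antisymmetrize in a and b:
   the second derivatives of E cancel, and the two curvatures remain. *)
Lemma Om_frame a b q : W q -> Om a b q *m E q = E q *m Rm a b q.
Proof.
move=> Wq; have cq := Wq.2; have sE := frame_in_smooth.
have dd i j : dmx c i (dmx c j E) q + dmx c i E q *m Gam j q + E q *m dmx c i (Gam j) q
   = dmx c i (om j) q *m E q + om j q *m dmx c i E q.
  rewrite -(dmxM oW Wq cq _ (om_smooth j) sE) -addrA.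
  rewrite -(dmxM oW Wq cq _ sE (Gam_smooth j)) -(dmxD oW Wq cq).
  - by apply: (dmx_ext oW Wq cq) => x Wx; exact: d_frame.
  - by apply: smooth_mx_sub (dmx_smooth c j oW sE) => x [].
  - exact: smooth_mxM sE (Gam_smooth j).
have d1 i : dmx c i E q = om i q *m E q - E q *m Gam i q.
  by rewrite -d_frame // addrK.
have Hba := dd b a; have := dd a b; rewrite (dmx_comm oW Wq cq a b sE).
rewrite (d1 a) => Hab; rewrite (d1 b) in Hba; rewrite RmE /Om.
exact: curvature_algebra Hab Hba.
Qed.

Lemma Om_antisym_idx a b q : Om a b q = - Om b a q.
Proof. by rewrite /Om !opprB addrC. Qed.

Lemma Om_antisym a b q : W q -> (Om a b q)^T = - Om a b q.
Proof.
move=> Wq; have cq := Wq.2.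
have dT i j : (dmx c i (om j) q)^T = - dmx c i (om j) q.
  apply/eqP; rewrite -addr_eq0 -(dmx_tr oW Wq cq); apply/eqP.
  rewrite -(dmxD oW Wq cq _ (smooth_mx_tr oW (om_smooth j)) (om_smooth j)).
  rewrite -[RHS](dmx_cst c q i (0 : 'M[R]_n)).
  by apply: (dmx_ext oW Wq cq) => x Wx; rewrite om_antisym // addNr.
exact: antisym_algebra (dT a b) (dT b a) (om_antisym a Wq) (om_antisym b Wq).
Qed.

(** Torsion-freeness: the Christoffel symbols are symmetric in the lower
   indices, so all terms cancel in pairs. *)
Lemma riemann_bianchi l k a b q :
  riemann g c l k a b q + riemann g c l a b k q + riemann g c l b k a q = 0.
Proof.
rewrite /riemann.
rewrite (christoffelC l k a) (christoffelC l b a) (christoffelC l k b).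
set x1 := pd _ _ _ _; set x2 := pd _ _ _ _; set x3 := pd _ _ _ _.
set s1 := \sum_h _; set s2 := \sum_h _; set s3 := \sum_h _.
have S : s1 + s2 + s3 = 0.
  rewrite /s1 /s2 /s3 -!big_split /=; apply: big1 => h _.
  rewrite (christoffelC h k a) (christoffelC h b a) (christoffelC h k b).
  by move: (christoffel g c h a k q) (christoffel g c h a b q) => y1 y2; ring.
by rewrite -[RHS]S; ring.
Qed.

(** The curvature tensor in the orthonormal frame: [rho q s t u v] is
   <R(e_s, e_t) e_u, e_v>. *)
Definition rho q s t : 'M[R]_n := \sum_a \sum_b (E q s a * E q t b) *: Om a b q.

Lemma rho_entry q s t u v :
  rho q s t u v = \sum_a \sum_b E q s a * E q t b * Om a b q u v.
Proof.
rewrite summxE; apply: eq_bigr => a _; rewrite summxE; apply: eq_bigr => b _.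
by rewrite mxE.
Qed.

Lemma rho_antisym_idx q s t u v : rho q s t u v = - rho q t s u v.
Proof.
rewrite !rho_entry exchange_big /= -sumrN; apply: eq_bigr => a _.
rewrite -sumrN; apply: eq_bigr => b _.
by rewrite (entry_opp u v (Om_antisym_idx b a q)) mulrN (mulrC (E q t a)).
Qed.

Lemma rho_antisym q s t u v : W q -> rho q s t u v = - rho q s t v u.
Proof.
move=> Wq; rewrite !rho_entry -sumrN; apply: eq_bigr => a _.
rewrite -sumrN; apply: eq_bigr => b _; rewrite -mulrN; congr (_ * _).
exact: antisym_entry (Om_antisym a b Wq) u v.
Qed.

Lemma rhoE q s t u v : W q -> rho q s t u v = \sum_k \sum_a \sum_b
  E q u k * E q s a * E q t b * (Rm a b q *m coframe q) k v.
Proof.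
move=> Wq.
have OmE a b : Om a b q = E q *m (Rm a b q *m coframe q).
  by rewrite mulmxA -Om_frame // -mulmxA frame_coframe // mulmx1.
rewrite rho_entry.
under eq_bigr do under eq_bigr do rewrite OmE [(E q *m _) u v]mxE mulr_sumr.
under eq_bigr do rewrite exchange_big /=.
rewrite exchange_big /=; apply: eq_bigr => k _; apply: eq_bigr => a _.
by apply: eq_bigr => b _; rewrite !mulrA; congr (_ * _); rewrite mulrC mulrA.
Qed.

Lemma rho_bianchi q s t u v : W q ->
  rho q s t u v + rho q t u s v + rho q u s t v = 0.
Proof.
move=> Wq; rewrite !rhoE //.
have rot (f : 'I_n -> 'I_n -> 'I_n -> R) :
    \sum_k \sum_a \sum_b f k a b = \sum_k \sum_a \sum_b f a b k.
  by rewrite [RHS]exchange_big; apply: eq_bigr => k _; rewrite exchange_big.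
rewrite [X in _ + X + _]rot [X in _ + X]rot [X in _ + X]rot -!big_split.
apply: big1 => k _; rewrite -!big_split; apply: big1 => a _.
rewrite -!big_split; apply: big1 => b _ /=.
have RC i j h : (Rm i j q *m coframe q) h v =
    \sum_l riemann g c l h i j q * coframe q l v.
  by rewrite mxE; apply: eq_bigr => l _; rewrite mxE.
rewrite !RC !mulr_sumr -!big_split; apply: big1 => l _ /=.
have := riemann_bianchi l k a b q.
move: (riemann g c l k a b q) (riemann g c l a b k q) (riemann g c l b k a q).
move: (E q u k) (E q s a) (E q t b) (coframe q l v) => x1 x2 x3 x4 x y z H.
transitivity (x1 * x2 * x3 * x4 * (x + y + z)); first by ring.
by rewrite H mulr0.
Qed.

(** The trace does not depend on the frame: E^T E is the inverse of the
   metric. *)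
Lemma rho_scal q : W q -> \sum_s \sum_t rho q s t t s =
  \sum_j \sum_k invmx (G q) j k * ricci g c j k q.
Proof.
move=> Wq.
transitivity (\sum_a \sum_b ((E q)^T *m Om a b q *m E q) b a).
  under eq_bigr do under eq_bigr do rewrite rho_entry.
  under eq_bigr do rewrite exchange_big /=.
  rewrite exchange_big /=; apply: eq_bigr => a _.
  under eq_bigr do rewrite exchange_big /=.
  rewrite exchange_big /=; apply: eq_bigr => b _.
  rewrite mxE; apply: eq_bigr => s _.
  rewrite [((E q)^T *m _) b s]mxE mulr_suml; apply: eq_bigr => t _.
  by rewrite [(E q)^T b t]mxE -mulrA mulrC.
under eq_bigr do under eq_bigr do rewrite -mulmxA Om_frame // mulmxA -invmx_metric //.
rewrite exchange_big /=; apply: eq_bigr => b _.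
under [RHS]eq_bigr do rewrite /ricci mulr_sumr.
rewrite [RHS]exchange_big /=; apply: eq_bigr => a _.
rewrite [(invmx _ *m _) b a]mxE; apply: eq_bigr => k _.
by rewrite [Rm a b q k a]mxE.
Qed.

End LeviCivita.

(** * The auxiliary connection in a local frame *)

Section AuxConnection.
Variables (R : realType) (n r : nat) (M : manifold R n).
Variables (Q : principal_bundle M (SO R r)) (D : metric_connection Q).
Implicit Types (U V : set M) (p : M) (q : Q) (v w : Q -> 'rV[R]_r) (A B : 'M[R]_r).

Local Notation actQ := (@act _ _ _ (SO R r) Q).

Lemma SO_set1 : @SO_set R r 1%:M.
Proof. by split; rewrite ?trmx1 ?mul1mx ?det1. Qed.

Lemma SO_set_tr A : @SO_set R r A -> @SO_set R r A^T.
Proof. by move=> [AA dA]; split; rewrite ?det_tr // trmxK; apply: mulmx1C. Qed.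

Lemma SO_setM A B : @SO_set R r A -> @SO_set R r B -> @SO_set R r (A *m B).
Proof.
move=> [AA dA] [BB dB]; split; last by rewrite det_mulmx dA dB mulr1.
by rewrite trmx_mul mulmxA -(mulmxA _ A^T) AA mulmx1.
Qed.

Lemma SO_actK q A : @SO_set R r A -> actQ (actQ q A) A^T = q.
Proof.
move=> sA; have sAT := SO_set_tr sA; have [AA _] := sAT; rewrite trmxK in AA.
by rewrite act_mul //= AA; exact: (act_one q).
Qed.

Lemma SO_act_inj q A B :
  @SO_set R r A -> @SO_set R r B -> actQ q A = actQ q B -> A = B.
Proof.
move=> sA sB E; have sBT := SO_set_tr sB.
have : actQ q (A *m B^T) = q.
  by rewrite -[RHS](SO_actK q sB) -E act_mul.
move/(act_stab q (SO_setM sA sBT)).1 => /= AB.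
have [BB _] := sB.
by rewrite -[A]mulmx1 -BB mulmxA AB mul1mx.
Qed.

Section Frame.
Variables (U : set M) (s : M -> Q).
Hypotheses (oU : open U) (s_smooth : smooth_section U s).

Lemma section_proj p : U p -> bproj (s p) = p.
Proof. by move=> /s_smooth[]. Qed.

Lemma frame_exists q : U (bproj q) ->
  exists2 A, @SO_set R r A & q = actQ (s (bproj q)) A.
Proof.
move=> Uq; have [A sA E] := @act_trans _ _ _ _ Q (s (bproj q)) q (section_proj Uq).
by exists A.
Qed.

Lemma F_frameE k q A :
  @SO_set R r A -> q = actQ (s (bproj q)) A -> F_frame s k q = row k A.
Proof.
move=> sA E; rewrite /F_frame; congr (row k _).
apply: xget_unique; first by split.
by move=> B [sB EB]; exact: SO_act_inj sB sA (etrans (esym EB) E).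
Qed.

Lemma F_frame_self k p : U p -> F_frame s k (s p) = delta_mx 0 k.
Proof.
move=> Up; rewrite (@F_frameE k (s p) 1%:M) ?row1 //; first exact: SO_set1.
by rewrite section_proj //; symmetry; exact: (act_one (s p)).
Qed.

Lemma F_frame_act k q A : U (bproj q) -> @SO_set R r A ->
  F_frame s k (actQ q A) = F_frame s k q *m A.
Proof.
move=> Uq sA; have [B sB E] := frame_exists Uq.
rewrite (F_frameE k sB E) -row_mul; apply: F_frameE; first exact: SO_setM.
have -> : bproj (actQ q A) = bproj q by apply: act_proj.
by rewrite [in LHS]E act_mul.
Qed.

Lemma F_frame_section k : F_section U (F_frame s k).
Proof.
split; first by move=> q A Uq sA; exact: F_frame_act.
move=> a j; apply: smooth_on_local => p [Up ap].
have [_ /(_ a ap)[V [u [oV Vp us uV]]]] := s_smooth Up.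
exists (V `&` (U `&` tdom a)) => //.
have oW : open (V `&` (U `&` tdom a)).
  by apply: openI => //; apply: openI => //; exact: tdom_open.
apply: (@smooth_on_ext _ _ _ _ (fun x => u x j k)) => //.
  move=> x [Vx [Ux ax]]; have [sux sE] := uV x Vx.
  rewrite (@F_frameE k (sec a x) (u x)^T); first by rewrite !mxE.
    exact: SO_set_tr.
  by rewrite sec_proj // sE SO_actK.
by apply: smooth_on_sub (us (j, k)) => x [].
Qed.

(** Sections are smooth by definition in the frames sec a, and s differs from
   these by a smooth map to SO(r). *)
Lemma section_coord_smooth v l : F_section U v -> smooth_on U (fun p => v (s p) 0 l).
Proof.
move=> [va vs]; apply: smooth_on_local => p Up; pose a := triv_at Q p.
have ap : tdom a p := triv_atP Q p.
have [_ /(_ a ap)[V [u [oV Vp us uV]]]] := s_smooth Up.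
exists (V `&` (U `&` tdom a)) => //.
have oW : open (V `&` (U `&` tdom a)).
  by apply: openI => //; apply: openI => //; exact: tdom_open.
apply: (@smooth_on_ext _ _ _ _ (fun x => \sum_h v (sec a x) 0 h * u x h l)) => //.
  move=> x [Vx [Ux ax]]; have [sux sE] := uV x Vx.
  by rewrite sE va ?mxE // sec_proj.
apply: smooth_on_sum => // h _; apply: smooth_onM => //.
  by apply: smooth_on_sub (vs a h) => x [_].
by apply: smooth_on_sub (us (h, l)) => x [].
Qed.

Lemma section_expand v q : F_section U v -> U (bproj q) ->
  v q = \sum_l v (s (bproj q)) 0 l *: F_frame s l q.
Proof.
move=> [va vs] Uq; have [A sA E] := frame_exists Uq.
have Us : U (bproj (s (bproj q))) by rewrite section_proj.
rewrite [in LHS]E va // mulmx_sum_row; apply: eq_bigr => l _.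
by rewrite (F_frameE l sA E).
Qed.

Lemma F_section_comb (h : 'I_r -> M -> R) (ls : seq 'I_r) :
  (forall l, smooth_on U (h l)) ->
  F_section U (fun q => \sum_(l <- ls) h l (bproj q) *: F_frame s l q).
Proof.
move=> sh; split.
  move=> q A Uq sA; rewrite mulmx_suml; apply: eq_bigr => l _.
  by rewrite F_frame_act // -scalemxAl; congr (h l _ *: _); apply: act_proj.
move=> a j; have oW : open (U `&` tdom a) by apply: openI => //; exact: tdom_open.
apply: (@smooth_on_ext _ _ _ _
  (fun x => \sum_(l <- ls) h l x * F_frame s l (sec a x) 0 j)) => //.
  move=> x [Ux ax]; rewrite summxE; apply: eq_bigr => l _.
  by rewrite sec_proj // [RHS]mxE.
apply: smooth_on_sum => // l _; apply: smooth_onM => //.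
  by apply: smooth_on_sub (sh l) => x [].
by have [_] := F_frame_section l; apply.
Qed.

Lemma cov_comb (h : 'I_r -> M -> R) (ls : seq 'I_r) q X :
  (forall l, smooth_on U (h l)) -> U (bproj q) ->
  cov D (fun q => \sum_(l <- ls) h l (bproj q) *: F_frame s l q) q X =
  \sum_(l <- ls) (deriv (chart_at (bproj q)) X (h l) (bproj q) *: F_frame s l q +
                  h l (bproj q) *: cov D (F_frame s l) q X).
Proof.
move=> sh Uq.
have sF := F_frame_section; have sC := F_section_comb.
elim: ls => [|l ls IH].
  rewrite big_nil; case: (posnP r) => [r0|r0].
    by apply/rowP => -[j jr]; exfalso; rewrite r0 in jr.
  (* the zero section is 0 f_l, to which the Leibniz rule applies *)
  pose l0 := Ordinal r0.
  have -> : (fun q => \sum_(l <- [::]) h l (bproj q) *: F_frame s l q) =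
            (fun q => (fun=> 0 : R) (bproj q) *: F_frame s l0 q).
    by apply/funext => x; rewrite big_nil scale0r.
  rewrite (cov_leibniz D X oU (sF l0) (smooth_on_cst 0 oU) Uq).
  by rewrite /deriv derive_cst !scale0r addr0.
rewrite big_cons -IH.
have -> : (fun q => \sum_(l <- l :: ls) h l (bproj q) *: F_frame s l q) =
   (fun q => h l (bproj q) *: F_frame s l q +
             \sum_(l <- ls) h l (bproj q) *: F_frame s l q).
  by apply/funext => x; rewrite big_cons.
have sl : F_section U (fun q => h l (bproj q) *: F_frame s l q).
  have := sC h [:: l] sh.
  by congr (F_section U _); apply/funext => x; rewrite big_seq1.
by rewrite (cov_add D X oU sl (sC h ls sh) Uq) (cov_leibniz D X oU (sF l) (sh l) Uq).
Qed.

End Frame.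

Section Chart.
Variables (c : chart M) (U : set M) (s : M -> Q).
Hypotheses (oU : open U) (s_smooth : smooth_section U s).
Implicit Types a b : 'I_n.
Local Notation W := (U `&` dom c).

Definition th a p : 'M[R]_r := F_form D c (delta_mx 0 a) s p.
Definition Th a b p : 'M[R]_r :=
  dmx c a (th b) p - dmx c b (th a) p - (th a p *m th b p - th b p *m th a p).

Let oW : open W := openI oU (@dom_open _ _ M c).
Let sW : smooth_section W s.
Proof. by move=> p [/s_smooth]. Qed.

Lemma nabla_section b k : F_section W (F_nabla_pd D c b (F_frame s k)).
Proof.
apply: (cov_section D oW (F_frame_section oW sW k)).
move=> c' i j; apply: smooth_on_sub (@tangent_smooth _ _ _ c (delta_mx 0 b) c' i j).
by move=> x [[_ cx] cx'].
Qed.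

Lemma thE b p k l : W p -> th b p k l = F_nabla_pd D c b (F_frame s k) (s p) 0 l.
Proof. by move=> Wp; rewrite mxE /F_nabla_pd (section_proj sW). Qed.

Lemma th_smooth b : smooth_mx W (th b).
Proof.
move=> k l; have := section_coord_smooth oW sW l (nabla_section b k).
by apply: smooth_on_ext => // p Wp; rewrite thE.
Qed.

Lemma th_antisym a p : W p -> (th a p)^T = - th a p.
Proof.
move=> Wp; have Up := Wp.1; have bp := section_proj sW Wp.
have WF : W (bproj (s p)) by rewrite bp.
apply/matrixP => l k; rewrite mxE [(- th a p) l k]mxE.
have sF := F_frame_section oW sW.
have := cov_metric D (tangent c (delta_mx 0 a) p) oW (sF k) (sF l) WF.
have dots (u : 'rV[R]_r) j : (u *m (delta_mx 0 j : 'rV[R]_r)^T) 0 0 = u 0 j.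
  by rewrite trmx_delta -colE mxE.
have inner x : W x -> F_inner (F_frame s k) (F_frame s l) x = (k == l)%:R.
  move=> Wx; rewrite /F_inner.
  have Wq : W (bproj (sec (triv_at Q x) x)) by rewrite sec_proj //; exact: triv_atP.
  have [A sA E] := frame_exists sW Wq.
  rewrite !(F_frameE _ sA E).
  have [AA _] := SO_set_tr sA; rewrite trmxK in AA.
  have := congr1 (fun B : 'M[R]_r => B k l) AA; rewrite !mxE => <-.
  by apply: eq_bigr => h _; rewrite !mxE.
rewrite (deriv_ext oW WF (chart_atP _) _ inner) /deriv derive_cst.
have dots' (u : 'rV[R]_r) j : ((delta_mx 0 j : 'rV[R]_r) *m u^T) 0 0 = u 0 j.
  by rewrite -rowE !mxE.
rewrite !(F_frame_self sW) // mxE dots dots' => H.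
rewrite [th a p k l]mxE [th a p l k]mxE; apply/eqP; rewrite -addr_eq0.
by apply/eqP; exact: esym H.
Qed.

Lemma Th_antisym a b p : W p -> (Th a b p)^T = - Th a b p.
Proof.
move=> Wp; have cp := Wp.2.
have dT i j : (dmx c i (th j) p)^T = - dmx c i (th j) p.
  apply/eqP; rewrite -addr_eq0 -(dmx_tr oW Wp cp); apply/eqP.
  rewrite -(dmxD oW Wp cp _ (smooth_mx_tr oW (th_smooth j)) (th_smooth j)).
  rewrite -[RHS](dmx_cst c p i (0 : 'M[R]_r)).
  by apply: (dmx_ext oW Wp cp) => x Wx; rewrite th_antisym // addNr.
exact: antisym_algebra (dT a b) (dT b a) (th_antisym a Wp) (th_antisym b Wp).
Qed.

(** Expand nabla_b f_k = sum_h (th_b)_kh f_h near p, differentiate along a by the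
   Leibniz rule and antisymmetrize. *)
Lemma F_curvatureE a b p k l : W p ->
  F_curvature D c a b (F_frame s k) (s p) 0 l = Th a b p k l.
Proof.
move=> Wp; have bp := section_proj sW Wp.
have WF : W (bproj (s p)) by rewrite bp.
have half i j : F_nabla_pd D c i (F_nabla_pd D c j (F_frame s k)) (s p) 0 l =
    dmx c i (th j) p k l + (th j p *m th i p) k l.
  rewrite {1}/F_nabla_pd bp.
  have sj := nabla_section j k.
  have st h : smooth_on W (fun x => th j x k h) := th_smooth j k h.
  rewrite (cov_local D oW sj (F_section_comb oW sW (index_enum 'I_r) st)) //; last first.
    move=> q Wq; rewrite (section_expand sW sj Wq); apply: eq_bigr => h _.
    by rewrite thE.
  rewrite (@cov_comb W s oW sW (fun l x => th j x k l) (index_enum 'I_r) (s p) _ st WF).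
  rewrite summxE [(_ *m _) k l]mxE.
  have -> : dmx c i (th j) p k l =
      \sum_h pd c i (fun x => th j x k h) p * (h == l)%:R.
    rewrite (bigD1 l) //= eqxx mulr1 [X in _ + X]big1 ?addr0 ?mxE //.
    by move=> h /negbTE ->; rewrite mulr0.
  rewrite -big_split /=; apply: eq_bigr => h _.
  rewrite [LHS]mxE [X in X + _]mxE [X in _ + X]mxE bp.
  rewrite (deriv_tangent _ oW Wp Wp.2 (st h)) (F_frame_self sW) //.
  by rewrite [delta_mx _ _ _ _]mxE eqxx eq_sym [th i p h l]mxE.
rewrite /F_curvature [LHS]mxE [X in _ + X]mxE !half /Th.
move: (dmx c a (th b) p) (dmx c b (th a) p) (th b p *m _) (th a p *m _) => x1 x2 y1 y2.
by rewrite !mxE; ring.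
Qed.

Lemma ThetaE (e : M -> 'M[R]_n) h l i j p : c = chart_at p -> W p ->
  Theta D e s h l i j p =
  \sum_a \sum_b frame_in c e p i a * frame_in c e p j b * Th a b p h l.
Proof.
move=> cE Wp; rewrite /Theta -cE; apply: eq_bigr => a _; apply: eq_bigr => b _.
by rewrite F_curvatureE.
Qed.

End Chart.

End AuxConnection.

(** * The real inner product on complex vectors and operator norms *)

Section Adjoint.
Variable R : realType.
Local Notation C := R[i].

Lemma ReD (x y : C) : complex.Re (x + y) = complex.Re x + complex.Re y.
Proof. by case: x y => [? ?] [? ?]. Qed.

Lemma ReZ (a : R) (x : C) : complex.Re (a%:C * x) = a * complex.Re x.
Proof. by case: x => [u v] /=; rewrite mul0r subr0. Qed.

Lemma Re_conj (x : C) : complex.Re (conjc x) = complex.Re x.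
Proof. by case: x. Qed.

Lemma Re_sum I (s : seq I) (P : pred I) (F : I -> C) :
  complex.Re (\sum_(i <- s | P i) F i) = \sum_(i <- s | P i) complex.Re (F i).
Proof. by elim/big_ind2: _ => // x1 x2 y1 y2 <- <-; rewrite ReD. Qed.

Definition adj m n (A : 'M[C]_(m, n)) : 'M[C]_(n, m) := (map_mx conjc A)^T.

Lemma adjM m n p (A : 'M[C]_(m, n)) (B : 'M[C]_(n, p)) :
  adj (A *m B) = adj B *m adj A.
Proof. by rewrite /adj map_mxM trmx_mul. Qed.

Lemma adjD m n (A B : 'M[C]_(m, n)) : adj (A + B) = adj A + adj B.
Proof. by rewrite /adj map_mxD linearD. Qed.

Lemma adjN m n (A : 'M[C]_(m, n)) : adj (- A) = - adj A.
Proof. by rewrite /adj map_mxN linearN. Qed.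

Lemma adjZ m n (a : C) (A : 'M[C]_(m, n)) : adj (a *: A) = conjc a *: adj A.
Proof. by rewrite /adj map_mxZ linearZ. Qed.

Lemma adj0 m n : adj (0 : 'M[C]_(m, n)) = 0.
Proof. by rewrite /adj map_mx0 trmx0. Qed.

Lemma adj1 n : adj (1%:M : 'M[C]_n) = 1%:M.
Proof. by rewrite /adj map_mx1 trmx1. Qed.

Lemma adjK m n (A : 'M[C]_(m, n)) : adj (adj A) = A.
Proof. by apply/matrixP => i j; rewrite !mxE conjcK. Qed.

Lemma adj_sum m n I (s : seq I) (P : pred I) (F : I -> 'M[C]_(m, n)) :
  adj (\sum_(i <- s | P i) F i) = \sum_(i <- s | P i) adj (F i).
Proof. by apply: (big_morph (@adj m n) (@adjD m n) (adj0 m n)). Qed.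

Lemma adj_tens m n p q (A : 'M[C]_(m, n)) (B : 'M[C]_(p, q)) :
  adj (A *t B) = adj A *t adj B.
Proof. by rewrite /adj map_mxT trmx_tens. Qed.

Section InnerProduct.
Variable N : nat.
Implicit Types (u v w : 'cV[C]_N) (A : 'M[C]_N).

Definition ip u v : R := complex.Re ((adj u *m v) 0 0).

Lemma ipDl u v w : ip (u + v) w = ip u w + ip v w.
Proof. by rewrite /ip adjD mulmxDl mxE ReD. Qed.

Lemma ipDr u v w : ip w (u + v) = ip w u + ip w v.
Proof. by rewrite /ip mulmxDr mxE ReD. Qed.

Lemma ipC u v : ip u v = ip v u.
Proof. by rewrite /ip -[adj u *m v]adjK adjM adjK [adj _ 0 0]mxE mxE Re_conj. Qed.

Lemma ipZr (a : R) u v : ip u (a%:C *: v) = a * ip u v.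
Proof. by rewrite /ip -scalemxAr mxE ReZ. Qed.

Lemma ipZl (a : R) u v : ip (a%:C *: u) v = a * ip u v.
Proof. by rewrite ipC ipZr ipC. Qed.

Lemma ipNr u v : ip u (- v) = - ip u v.
Proof. by rewrite -mulN1r -ipZr rmorphN1 scaleN1r. Qed.

Lemma ipNl u v : ip (- u) v = - ip u v.
Proof. by rewrite ipC ipNr ipC. Qed.

Lemma ip0r u : ip u 0 = 0.
Proof. by rewrite /ip mulmx0 mxE. Qed.

Lemma ip_suml I (s : seq I) (P : pred I) (F : I -> 'cV[C]_N) u :
  ip (\sum_(i <- s | P i) F i) u = \sum_(i <- s | P i) ip (F i) u.
Proof.
apply: (big_morph (ip^~ u) (fun x y => ipDl x y u)).
by rewrite ipC ip0r.
Qed.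

Lemma ip_adj A u v : ip (A *m u) v = ip u (adj A *m v).
Proof. by rewrite /ip adjM mulmxA. Qed.

Lemma ipE u v : ip u v = \sum_i (complex.Re (u i 0) * complex.Re (v i 0) +
  complex.Im (u i 0) * complex.Im (v i 0)).
Proof.
rewrite /ip mxE Re_sum; apply: eq_bigr => i _; rewrite !mxE.
by case: (u i 0) (v i 0) => [a b] [c d] /=; rewrite mulNr opprK.
Qed.

Lemma ip_ge0 u : 0 <= ip u u.
Proof. by rewrite ipE; apply: sumr_ge0 => i _; rewrite -!expr2 addr_ge0 ?sqr_ge0. Qed.

Lemma ip_eq0 u : ip u u = 0 -> u = 0.
Proof.
rewrite ipE => /eqP; rewrite psumr_eq0 => [|i _]; last first.
  by rewrite -!expr2 addr_ge0 ?sqr_ge0.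
move=> /allP H; apply/matrixP => i j; rewrite (ord1 j) mxE.
have := H i (mem_index_enum i); rewrite -!expr2 paddr_eq0 ?sqr_ge0 // !sqrf_eq0.
by case: (u i 0) => [a b] /= /andP[/eqP-> /eqP->].
Qed.

Lemma ip_gt0 u : u != 0 -> 0 < ip u u.
Proof.
move=> u0; rewrite lt_neqAle ip_ge0 andbT eq_sym.
by apply: contra u0 => /eqP/ip_eq0->.
Qed.

(** The Hermitian square of u is a real number. *)
Lemma ip_scale (z : C) u : ip (z *: u) u = complex.Re z * ip u u.
Proof.
rewrite /ip adjZ -scalemxAl mxE; set x := (_ *m _) 0 0.
have : conjc x = x.
  have E : adj (adj u *m u) = adj u *m u by rewrite adjM adjK.
  by rewrite /x -[in RHS]E [RHS]mxE [in RHS]mxE.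
case: z x => [a b] [c d] /= [/eqP]; rewrite eq_sym -addr_eq0 -mulr2n mulrn_eq0 /=.
by move=> /eqP->; rewrite mulr0 subr0.
Qed.

Lemma ip_scale2 (z : C) u v :
  ip (z *: u) (z *: v) = (complex.Re z ^+ 2 + complex.Im z ^+ 2) * ip u v.
Proof.
rewrite /ip adjZ -scalemxAl -scalemxAr scalerA mxE; set x := (_ *m _) 0 0.
by case: z x => [a b] [c d] /=; ring.
Qed.

Lemma hnormE u : hnorm u = Num.sqrt (ip u u).
Proof. by rewrite /hnorm ipE; congr Num.sqrt; apply: eq_bigr => i _; rewrite !expr2. Qed.

Lemma hnorm_sqr u : hnorm u ^+ 2 = ip u u.
Proof. by rewrite hnormE sqr_sqrtr // ip_ge0. Qed.

Lemma hnorm_ge0 u : 0 <= hnorm u.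
Proof. by rewrite hnormE sqrtr_ge0. Qed.

Lemma cauchy_schwarz u v : `|ip u v| <= hnorm u * hnorm v.
Proof.
rewrite -ler_sqr ?nnegrE ?mulr_ge0 ?hnorm_ge0 // exprMn !hnorm_sqr real_normK ?num_real //.
have [->|v0] := eqVneq v 0; first by rewrite !ip0r mulr0 expr0n.
have vv := ip_gt0 v0.
have := ip_ge0 ((ip v v)%:C *: u - (ip u v)%:C *: v).
rewrite ipDl !ipDr !(ipNl, ipNr) !(ipZl, ipZr) (ipC v u).
move: (ip u u) (ip u v) (ip v v) vv => a b c c0 H.
rewrite -(ler_pM2l c0) -subr_ge0; apply: le_trans H _.
by rewrite le_eqVlt; apply/orP; left; apply/eqP; ring.
Qed.

Lemma hnormD u v : hnorm (u + v) <= hnorm u + hnorm v.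
Proof.
rewrite -ler_sqr ?nnegrE ?addr_ge0 ?hnorm_ge0 // hnorm_sqr ipDl !ipDr (ipC v u).
have := cauchy_schwarz u v => /(le_trans (ler_norm _)).
rewrite sqrrD !hnorm_sqr; lra.
Qed.

Lemma hnorm0 : hnorm (0 : 'cV[C]_N) = 0.
Proof. by rewrite hnormE ip0r sqrtr0. Qed.

Lemma hnormZ (z : C) u :
  hnorm (z *: u) = Num.sqrt (complex.Re z ^+ 2 + complex.Im z ^+ 2) * hnorm u.
Proof. by rewrite !hnormE ip_scale2 sqrtrM // addr_ge0 ?sqr_ge0. Qed.

Lemma hnorm_sum I (s : seq I) (F : I -> 'cV[C]_N) :
  hnorm (\sum_(i <- s) F i) <= \sum_(i <- s) hnorm (F i).
Proof.
elim/big_ind2: _ => //; first by rewrite hnorm0.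
by move=> x1 x2 y1 y2 h1 h2; apply: le_trans (hnormD _ _) _; exact: lerD.
Qed.

Definition norm_le A (K : R) := forall v, hnorm (A *m v) <= K * hnorm v.

Lemma norm_le_exists A : exists K, norm_le A K.
Proof.
exists (\sum_j hnorm (col j A)) => v.
have -> : A *m v = \sum_j v j 0 *: col j A.
  apply/matrixP => i k; rewrite summxE (ord1 k) mxE; apply: eq_bigr => j _.
  by rewrite !mxE mulrC.
apply: le_trans (hnorm_sum _ _) _; rewrite mulr_suml; apply: ler_sum => j _.
rewrite hnormZ mulrC; apply: ler_wpM2l; first exact: hnorm_ge0.
rewrite /hnorm; apply: ler_wsqrtr; rewrite (bigD1 j) //= lerDl.
by apply: sumr_ge0 => i _; rewrite addr_ge0 ?sqr_ge0.
Qed.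

Let unit_ball_image A := [set hnorm (A *m v) | v in [set v | hnorm v <= 1]].

Lemma opnorm_has_sup A : has_sup (unit_ball_image A).
Proof.
split; first by exists (hnorm (A *m 0)), 0 => //=; rewrite hnorm0.
have [K HK] := norm_le_exists A; exists (Num.max K 0) => _ [v v1 <-].
apply: le_trans (HK v) _; apply: (@le_trans _ _ (Num.max K 0 * hnorm v)).
  by apply: ler_wpM2r; rewrite ?hnorm_ge0 // le_max lexx.
by rewrite -[leRHS]mulr1; apply: ler_wpM2l; rewrite // le_max lexx orbT.
Qed.

Lemma opnorm_norm_le A : norm_le A (opnorm A).
Proof.
move=> v; have [v0|v0] := eqVneq (hnorm v) 0.
  have -> : v = 0 by apply: ip_eq0; rewrite -hnorm_sqr v0 expr0n.
  by rewrite mulmx0 hnorm0 mulr0.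
have vp : 0 < hnorm v by rewrite lt_neqAle eq_sym v0 hnorm_ge0.
rewrite -ler_pdivrMr //.
have nZ w : hnorm (((hnorm v)^-1)%:C *: w) = hnorm w / hnorm v.
  rewrite hnormZ /= expr0n addr0 sqrtr_sqr gtr0_norm ?invr_gt0 // mulrC //.
apply: sup_upper_bound; first exact: opnorm_has_sup.
exists (((hnorm v)^-1)%:C *: v); first by rewrite /= nZ divff.
by rewrite -scalemxAr nZ.
Qed.

Lemma opnorm_le A K : 0 <= K -> norm_le A K -> opnorm A <= K.
Proof.
move=> K0 H; apply: ge_sup; first by have [] := opnorm_has_sup A.
move=> _ [v v1 <-]; apply: le_trans (H v) _.
by rewrite -[leRHS]mulr1; apply: ler_wpM2l.
Qed.

Lemma opnorm_ge0 A : 0 <= opnorm A.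
Proof.
apply: le_trans (hnorm_ge0 (A *m 0)) _; apply: sup_upper_bound.
  exact: opnorm_has_sup.
by exists 0 => //=; rewrite hnorm0.
Qed.

Lemma ip_opnorm A v : - (opnorm A * ip v v) <= ip (A *m v) v.
Proof.
rewrite -hnorm_sqr expr2 mulrA lerNl -ipNl.
apply: le_trans (ler_norm _) _; rewrite ipNl normrN.
apply: le_trans (cauchy_schwarz _ _) _; apply: ler_wpM2r; first exact: hnorm_ge0.
exact: opnorm_norm_le.
Qed.

Lemma norm_leD A B K L : norm_le A K -> norm_le B L -> norm_le (A + B) (K + L).
Proof.
move=> HA HB v; rewrite mulmxDl mulrDl; apply: le_trans (hnormD _ _) _.
exact: lerD.
Qed.

End InnerProduct.

(** If the P_i form a resolution of the identity and each intertwines A with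
   A', then A is block diagonal with blocks A'. *)
Lemma norm_le_slice N N' (I : finType) (P : I -> 'M[C]_(N', N)) A A' K :
  \sum_i adj (P i) *m P i = 1%:M -> (forall i, P i *m A = A' *m P i) ->
  0 <= K -> norm_le A' K -> norm_le A K.
Proof.
move=> P1 PA K0 HA' v.
have sq w : ip w w = \sum_i ip (P i *m w) (P i *m w).
  rewrite -[X in ip X _](mul1mx w) -P1 mulmx_suml ip_suml; apply: eq_bigr => i _.
  by rewrite /ip !adjM adjK !mulmxA.
rewrite -ler_sqr ?nnegrE ?mulr_ge0 ?hnorm_ge0 // exprMn !hnorm_sqr !sq mulr_sumr.
apply: ler_sum => i _; rewrite mulmxA PA -mulmxA -!hnorm_sqr -exprMn.
by rewrite ler_sqr ?nnegrE ?mulr_ge0 ?hnorm_ge0.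
Qed.

End Adjoint.

(** * Clifford relations *)

Lemma sum_delta (R : pzRingType) (V : lmodType R) (I : finType) (F : I -> V) i :
  \sum_j (j == i)%:R *: F j = F i.
Proof.
rewrite (bigD1 i) //= eqxx scale1r big1 ?addr0 // => j /negbTE ->.
by rewrite scale0r.
Qed.

Lemma sum_lt (V : zmodType) n (f : 'I_n -> 'I_n -> V) :
  (forall i j, f i j = f j i) -> (forall i, f i i = 0) ->
  \sum_i \sum_j f i j = (\sum_(i < n) \sum_(j < n | (i < j)%N) f i j) *+ 2.
Proof.
move=> fC f0; rewrite mulr2n [X in _ = _ + X](exchange_big_dep xpredT) //=.
rewrite -big_split /=; apply: eq_bigr => i _.
rewrite (bigID (fun j : 'I_n => (i < j)%N)) /=; congr (_ + _).
rewrite (bigD1 i) ?ltnn //= f0 add0r; apply: eq_big => [j|j _]; last exact: fC.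
by rewrite -leqNgt ltn_neqAle andbC.
Qed.

Lemma half_eq (R : realFieldType) (x y d : R) : x + x = - (2 * d) * y -> x = - d * y.
Proof. lra. Qed.

Lemma third_eq (R : realFieldType) (x y z : R) :
  x + (x - 4 * y * z) + (x - 2 * y * z) = 0 -> x = 2 * y * z.
Proof. lra. Qed.

Lemma self_opp (R : realFieldType) (x : R) : x = - x -> x = 0.
Proof. lra. Qed.

Section Clifford.
Variables (R : realType) (n N : nat) (gm : 'I_n -> 'M[R[i]]_N).
Hypothesis gmC : forall i j,
  gm i *m gm j + gm j *m gm i = (- (2 * (i == j)%:R))%:M.
Implicit Types (w : 'M[R]_n) (v : 'rV[R]_n).

Definition clv v : 'M[R[i]]_N := \sum_s (v 0 s)%:C *: gm s.

(** The element of Cl_n which acts on vectors by the antisymmetric matrix w: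
   this is the inverse of lambda_*, with lambda_* (e_i e_j) = 2 E_ij. *)
Definition quad w : 'M[R[i]]_N :=
  \sum_s \sum_t (4^-1 * w s t)%:C *: (gm s *m gm t).

Lemma gm_swap s t : gm s *m gm t = (- (2 * (s == t)%:R))%:M - gm t *m gm s.
Proof. by rewrite -gmC addrK. Qed.

Lemma clvD v v' : clv (v + v') = clv v + clv v'.
Proof.
rewrite /clv -big_split; apply: eq_bigr => s _ /=.
by rewrite mxE rmorphD scalerDl.
Qed.

Lemma clvZ a v : clv (a *: v) = a%:C *: clv v.
Proof.
rewrite /clv scaler_sumr; apply: eq_bigr => s _.
by rewrite mxE rmorphM scalerA.
Qed.

Lemma clvB v v' : clv (v - v') = clv v - clv v'.
Proof. by rewrite -scaleN1r clvD clvZ rmorphN1 scaleN1r. Qed.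

Lemma clv_sum I (r : seq I) (F : I -> 'rV[R]_n) :
  clv (\sum_(i <- r) F i) = \sum_(i <- r) clv (F i).
Proof.
apply: (big_morph clv clvD); rewrite /clv big1 // => s _.
by rewrite mxE scale0r.
Qed.

Lemma clv_delta s : clv (delta_mx 0 s) = gm s.
Proof.
rewrite -[RHS](sum_delta gm); apply: eq_bigr => t _.
by rewrite mxE /=; case: (t == s).
Qed.

Lemma quadD w w' : quad (w + w') = quad w + quad w'.
Proof.
rewrite /quad -big_split; apply: eq_bigr => s _; rewrite -big_split.
by apply: eq_bigr => t _ /=; rewrite mxE mulrDr rmorphD scalerDl.
Qed.

Lemma quadZ a w : quad (a *: w) = a%:C *: quad w.
Proof.
rewrite /quad scaler_sumr; apply: eq_bigr => s _; rewrite scaler_sumr.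
by apply: eq_bigr => t _; rewrite mxE mulrCA rmorphM scalerA.
Qed.

Lemma quadN w : quad (- w) = - quad w.
Proof. by rewrite -scaleN1r quadZ rmorphN1 scaleN1r. Qed.

Lemma quadB w w' : quad (w - w') = quad w - quad w'.
Proof. by rewrite quadD quadN. Qed.

Lemma quad0 : quad 0 = 0.
Proof. by rewrite -(scale0r (0 : 'M[R]_n)) quadZ scale0r. Qed.

Lemma quad_sum I (r : seq I) (F : I -> 'M[R]_n) :
  quad (\sum_(i <- r) F i) = \sum_(i <- r) quad (F i).
Proof. exact: (big_morph quad quadD quad0). Qed.

Lemma antisym_E w s t : w^T = - w -> w s t = - w t s.
Proof. by move=> wT; have := congr1 (fun A : 'M[R]_n => A t s) wT; rewrite !mxE. Qed.

Lemma antisym_diag w s : w^T = - w -> w s s = 0.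
Proof.
move=> /antisym_E-/(_ s s)/eqP; rewrite -addr_eq0 -mulr2n mulrn_eq0 /=.
by move/eqP.
Qed.

Lemma quad_lt w : w^T = - w ->
  \sum_(i < n) \sum_(j < n | (i < j)%N) (2^-1 * w i j)%:C *: (gm i *m gm j) =
  quad w.
Proof.
move=> wT; rewrite /quad sum_lt => [|i j|i].
- rewrite -sumrMnl; apply: eq_bigr => i _; rewrite -sumrMnl; apply: eq_bigr => j _.
  rewrite scalerMnl -rmorphMn; congr (_%:C *: _).
  by rewrite -mulr_natr; field.
- rewrite (gm_swap i j) scalerDr scalerN (antisym_E i j wT).
  case: eqVneq => [->|ij]; first by rewrite antisym_diag // oppr0 mulr0 !scale0r subr0.
  by rewrite mulr0 oppr0 raddf0 scaler0 add0r mulrN rmorphN scaleNr opprK.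
by rewrite antisym_diag // mulr0 scale0r.
Qed.

Lemma comm_gm2 s t u : gm s *m gm t *m gm u - gm u *m (gm s *m gm t) =
  (2 * (u == s)%:R)%:C *: gm t - (2 * (t == u)%:R)%:C *: gm s.
Proof.
rewrite -mulmxA (gm_swap t u) mulmxBr [gm s *m (gm u *m _)]mulmxA (gm_swap s u).
rewrite mulmxBl opprB -[gm u *m gm s *m gm t]mulmxA.
rewrite [gm u *m _ - _]addrC addrA addrK.
rewrite mul_mx_scalar mul_scalar_mx [u == s]eq_sym.
rewrite !rmorphM /= !(rmorph_nat (real_complex R)).
by rewrite !scaleNr opprK addrC.
Qed.

Lemma comm_quad_gm w u : w^T = - w ->
  quad w *m gm u - gm u *m quad w = clv (row u w).
Proof.
move=> wT; rewrite /quad mulmx_suml mulmx_sumr -sumrB.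
transitivity (\sum_s \sum_t ((s == u)%:R *: ((2^-1 * w s t)%:C *: gm t) -
                             (t == u)%:R *: ((2^-1 * w s t)%:C *: gm s))).
  apply: eq_bigr => s _; rewrite mulmx_suml mulmx_sumr -sumrB; apply: eq_bigr => t _.
  rewrite -scalemxAl -scalemxAr -scalerBr comm_gm2 scalerBr !scalerA [u == s]eq_sym.
  rewrite -!rmorphM /= -!(rmorph_nat (real_complex R)) -!rmorphM /=.
  by congr (_%:C *: _ - _%:C *: _); field.
under eq_bigr do rewrite sumrB (sum_delta (fun t => (2^-1 * w _ t)%:C *: gm _)).
rewrite sumrB exchange_big /=.
under eq_bigr do rewrite (sum_delta (fun s => (2^-1 * w s _)%:C *: gm _)).
rewrite -sumrB; apply: eq_bigr => t _; rewrite -scalerBl -rmorphB /= mxE.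
by rewrite (antisym_E t u wT); congr (_%:C *: _); field.
Qed.

Lemma comm_quad_clv w v : w^T = - w ->
  quad w *m clv v - clv v *m quad w = clv (v *m w).
Proof.
move=> wT; rewrite {1 2}/clv mulmx_sumr mulmx_suml -sumrB mulmx_sum_row clv_sum.
apply: eq_bigr => s _; rewrite -scalemxAr -scalemxAl -scalerBr comm_quad_gm //.
by rewrite clvZ.
Qed.

(** Matrices act on row vectors from the right, whence the order of the factors
   on the right hand side. *)
Lemma comm_quad_quad w w' : w^T = - w ->
  quad w *m quad w' - quad w' *m quad w = quad (w' *m w - w *m w').
Proof.
move=> wT.
have D X s t : X *m (gm s *m gm t) - gm s *m gm t *m X =
    (X *m gm s - gm s *m X) *m gm t + gm s *m (X *m gm t - gm t *m X).
  by rewrite mulmxBl mulmxBr !mulmxA addrA subrK.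
have -> : w' *m w - w *m w' = w' *m w + w^T *m w' by rewrite wT mulNmx.
rewrite quadD {2 3}/quad mulmx_sumr mulmx_suml -sumrB.
transitivity (\sum_s \sum_t \sum_u ((4^-1 * (w' s t * w s u))%:C *: (gm u *m gm t)
    + (4^-1 * (w' s t * w t u))%:C *: (gm s *m gm u))).
  apply: eq_bigr => s _; rewrite mulmx_sumr mulmx_suml -sumrB; apply: eq_bigr => t _.
  rewrite -scalemxAr -scalemxAl -scalerBr D !comm_quad_gm // /clv.
  rewrite mulmx_suml mulmx_sumr -big_split /= scaler_sumr; apply: eq_bigr => u _.
  by rewrite !mxE -scalemxAl -scalemxAr scalerDr !scalerA -!rmorphM /= !mulrA.
rewrite [RHS]addrC; under eq_bigr do under eq_bigr do rewrite big_split /=.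
under eq_bigr do rewrite big_split /=.
rewrite big_split /=; congr (_ + _).
  under eq_bigr do rewrite exchange_big /=.
  rewrite exchange_big /=; apply: eq_bigr => u _.
  rewrite exchange_big /=; apply: eq_bigr => t _.
  rewrite -scaler_suml -rmorph_sum /= mxE mulr_sumr; congr (_%:C *: _).
  by apply: eq_bigr => s _; rewrite mxE [w s u * _]mulrC.
apply: eq_bigr => s _; rewrite exchange_big /=; apply: eq_bigr => u _.
by rewrite -scaler_suml -rmorph_sum /= mxE mulr_sumr.
Qed.

Hypothesis gm_skew : forall i, adj (gm i) = - gm i.

Lemma adj_quad w : w^T = - w -> adj (quad w) = - quad w.
Proof.
move=> wT; rewrite /quad adj_sum; under eq_bigr do rewrite adj_sum.
rewrite exchange_big /= -sumrN; apply: eq_bigr => s _.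
rewrite -sumrN; apply: eq_bigr => t _.
rewrite adjZ conjc_real adjM !gm_skew mulNmx mulmxN opprK (antisym_E s t wT).
by rewrite mulrN rmorphN scaleNr opprK.
Qed.

Lemma adj_clv v : adj (clv v) = - clv v.
Proof.
rewrite /clv adj_sum -sumrN; apply: eq_bigr => s _.
by rewrite adjZ conjc_real gm_skew scalerN.
Qed.

Lemma clv_mul v v' :
  clv v *m clv v' + clv v' *m clv v = (- (2 * ((v *m v'^T) 0 0)%:C))%:M.
Proof.
rewrite {2 3}/clv mulmx_sumr mulmx_suml -big_split /=.
transitivity (\sum_s ((- 2 * (v 0 s * v' 0 s))%:C%:M : 'M[R[i]]_N)).
  apply: eq_bigr => s _; rewrite -scalemxAr -scalemxAl -scalerDr.
  have -> : clv v *m gm s + gm s *m clv v = (- 2 * v 0 s)%:C%:M.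
    rewrite /clv mulmx_suml mulmx_sumr -big_split /=.
    rewrite -[RHS](sum_delta (fun t => (- 2 * v 0 t)%:C%:M)); apply: eq_bigr => t _.
    rewrite -scalemxAl -scalemxAr -scalerDr gmC scale_scalar_mx scale_scalar_mx.
    by congr (_%:M); case: (t == s); rewrite ?mulr0 ?oppr0 ?mulr0 ?mul0r //= !mulr1 mul1r;
      rewrite rmorphM rmorphN /= (rmorph_nat (real_complex R) 2) mulrC.
  by rewrite scale_scalar_mx -rmorphM; congr (_%:C%:M); ring.
rewrite -raddf_sum -rmorph_sum /= -mulr_sumr rmorphM rmorphN /=.
rewrite (rmorph_nat (real_complex R) 2) mulNr mxE; congr (- (_ * _%:C))%:M.
by apply: eq_bigr => s _; rewrite mxE.
Qed.

Lemma clv_sqr v : clv v *m clv v = (- ((v *m v^T) 0 0)%:C)%:M.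
Proof.
have two0 : (2 : R[i]) != 0 by rewrite pnatr_eq0.
apply: (scalerI two0).
by rewrite scaler_nat mulr2n clv_mul scale_scalar_mx mulrN.
Qed.

(** ** The curvature term *)

Section Contraction.
Variables (rh : 'I_n -> 'I_n -> 'M[R]_n) (psi : 'cV[R[i]]_N).
Hypothesis rh_antisym_idx : forall s t u (v : 'I_n), rh s t u v = - rh t s u v.
Hypothesis rh_antisym : forall s t u (v : 'I_n), rh s t u v = - rh s t v u.
Hypothesis rh_bianchi : forall s t u (v : 'I_n), rh s t u v + rh t u s v + rh u s t v = 0.

Let q := ip psi psi.
Let m4 s t u (v : 'I_n) := ip (gm s *m gm t *m gm u *m gm v *m psi) psi.

(** For s != t the operator e_s e_t is skew, so the real part of its expectation
   vanishes. *)
Lemma ip_gm2 s t : ip (gm s *m gm t *m psi) psi = - (s == t)%:R * q.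
Proof.
have H i j : ip (gm i *m gm j *m psi) psi = - ip (gm j *m psi) (gm i *m psi).
  by rewrite -mulmxA ip_adj gm_skew mulNmx ipNr.
have E : ip (gm s *m gm t *m psi) psi = ip (gm t *m gm s *m psi) psi.
  by rewrite !H ipC.
have : ip (gm s *m gm t *m psi) psi + ip (gm t *m gm s *m psi) psi =
    - (2 * (s == t)%:R) * q.
  rewrite -ipDl -mulmxDl gmC mul_scalar_mx ip_scale; congr (_ * _).
  by case: (s == t); rewrite ?mulr0 ?mulr1 //= ?oppr0.
by rewrite -E => /half_eq.
Qed.

Let realc (k : nat) : - (2 * k%:R) = (- (2 * k%:R))%:C :> R[i].
Proof. by rewrite rmorphN rmorphM !rmorph_nat. Qed.

Lemma m4_swap12 s t u (v : 'I_n) : m4 s t u v = 2 * (s == t)%:R * (u == v)%:R * q - m4 t s u v.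
Proof.
rewrite /m4 (gm_swap s t) !mulmxBl ipDl ipNl; congr (_ - _).
rewrite mul_scalar_mx -!scalemxAl realc ipZl ip_gm2.
by ring.
Qed.

Lemma m4_swap23 s t u (v : 'I_n) : m4 s t u v = 2 * (t == u)%:R * (s == v)%:R * q - m4 s u t v.
Proof.
rewrite /m4 -(mulmxA (gm s)) (gm_swap t u) mulmxBr !mulmxBl ipDl ipNl -!mulmxA.
congr (_ - _).
rewrite mul_scalar_mx -scalemxAr realc ipZl mulmxA ip_gm2.
by ring.
Qed.

Lemma sum_deltaR (F : 'I_n -> R) i : \sum_j (j == i)%:R * F j = F i.
Proof. exact: (@sum_delta R R^o). Qed.

Let S := \sum_s \sum_t rh s t t s.

(** By the Bianchi identity the sums of m4 against the three cyclic rotations of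
   rh in its first three indices add up to zero. Each of them equals T up to the
   contractions produced by rotating the Clifford factors, so that 3 T = 6 S q
   where T is the left hand side. *)
Lemma contraction_m4 : \sum_s \sum_t \sum_u \sum_v rh s t u v * m4 s t u v = 2 * S * q.
Proof.
set T := LHS.
pose sum4 (F : 'I_n -> 'I_n -> 'I_n -> 'I_n -> R) := \sum_s \sum_t \sum_u \sum_v F s t u v.
have TE : sum4 (fun s t u (v : 'I_n) => rh s t u v * m4 s t u v) = T by [].
have rot F : sum4 (fun s t u (v : 'I_n) => F t u s v) = sum4 F.
  rewrite /sum4 exchange_big /=; apply: eq_bigr => t _.
  by rewrite exchange_big.
have rot2 F : sum4 (fun s t u (v : 'I_n) => F u s t v) = sum4 F.
  by rewrite -[RHS]rot -[RHS](rot (fun s t u (v : 'I_n) => F t u s v)).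
have s4D F G : sum4 (fun s t u (v : 'I_n) => F s t u v + G s t u v) = sum4 F + sum4 G.
  rewrite /sum4 -big_split; apply: eq_bigr => s _; rewrite -big_split.
  apply: eq_bigr => t _; rewrite -big_split; apply: eq_bigr => u _.
  by rewrite -big_split.
have s4E F G : (forall s t u (v : 'I_n), F s t u v = G s t u v) -> sum4 F = sum4 G.
  move=> FG; apply: eq_bigr => s _; apply: eq_bigr => t _; apply: eq_bigr => u _.
  by apply: eq_bigr => v _.
have s4Z a F : sum4 (fun s t u (v : 'I_n) => a * F s t u v) = a * sum4 F.
  rewrite /sum4 mulr_sumr; apply: eq_bigr => s _; rewrite mulr_sumr.
  apply: eq_bigr => t _; rewrite mulr_sumr; apply: eq_bigr => u _.
  by rewrite mulr_sumr.
pose d (i j : 'I_n) : R := (i == j)%:R.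
have c13 : sum4 (fun s t u (v : 'I_n) => d u s * (d v t * rh s t u v)) = - S.
  rewrite /sum4 /S -sumrN; apply: eq_bigr => s _; rewrite -sumrN; apply: eq_bigr => t _.
  under eq_bigr do rewrite -mulr_sumr sum_deltaR.
  by rewrite sum_deltaR rh_antisym.
have c23 : sum4 (fun s t u (v : 'I_n) => d u t * (d v s * rh s t u v)) = S.
  rewrite /sum4 /S; apply: eq_bigr => s _; apply: eq_bigr => t _.
  under eq_bigr do rewrite -mulr_sumr sum_deltaR.
  by rewrite sum_deltaR.
have c12 : sum4 (fun s t u (v : 'I_n) => d t s * (d v u * rh s t u v)) = 0.
  rewrite /sum4 big1 // => s _; rewrite (eq_bigr (fun t => d t s * \sum_u \sum_v d v u * rh s t u v)).
    rewrite sum_deltaR; apply: big1 => u _; rewrite sum_deltaR.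
    exact: self_opp (rh_antisym_idx s s u u).
  move=> t _; rewrite mulr_sumr; apply: eq_bigr => u _.
  by rewrite mulr_sumr.
(* rotating the first three Clifford factors takes two exchanges, each of which
   produces a contraction of rh *)
have T1 : sum4 (fun s t u (v : 'I_n) => rh t u s v * m4 s t u v) = T - 4 * S * q.
  transitivity (sum4 (fun s t u (v : 'I_n) => rh t u s v * m4 t u s v +
     ((- 2 * q) * (d s u * (d v t * rh t u s v)) + (2 * q) * (d s t * (d v u * rh t u s v))))).
    apply: s4E => s t u v; rewrite (m4_swap12 s t) (m4_swap23 t s).
    rewrite -/(d s t) -/(d u v) -/(d s u) -/(d t v) /d [u == v]eq_sym [t == v]eq_sym.
    by ring.
  rewrite (rot (fun s t u (v : 'I_n) => rh s t u v * m4 s t u v +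
     ((- 2 * q) * (d u t * (d v s * rh s t u v)) + (2 * q) * (d u s * (d v t * rh s t u v))))).
  rewrite !s4D !s4Z c23 c13 TE. ring.
have T2 : sum4 (fun s t u (v : 'I_n) => rh u s t v * m4 s t u v) = T - 2 * S * q.
  transitivity (sum4 (fun s t u (v : 'I_n) => rh u s t v * m4 u s t v +
     ((- 2 * q) * (d s u * (d v t * rh u s t v)) + (2 * q) * (d t u * (d v s * rh u s t v))))).
    apply: s4E => s t u v; rewrite (m4_swap23 s t) (m4_swap12 s u).
    rewrite -/(d t u) -/(d s v) -/(d s u) -/(d t v) /d [s == v]eq_sym [t == v]eq_sym.
    by ring.
  rewrite (rot2 (fun s t u (v : 'I_n) => rh s t u v * m4 s t u v +
     ((- 2 * q) * (d t s * (d v u * rh s t u v)) + (2 * q) * (d u s * (d v t * rh s t u v))))).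
  rewrite !s4D !s4Z c12 c13 TE; ring.
have : sum4 (fun s t u (v : 'I_n) => (rh s t u v + rh t u s v + rh u s t v) * m4 s t u v) = 0.
  rewrite /sum4; apply: big1 => s _; apply: big1 => t _; apply: big1 => u _.
  by apply: big1 => v _; rewrite rh_bianchi mul0r.
have -> : sum4 (fun s t u (v : 'I_n) => (rh s t u v + rh t u s v + rh u s t v) * m4 s t u v) =
    T + (T - 4 * S * q) + (T - 2 * S * q).
  by rewrite -T1 -T2 -!s4D; apply: s4E => s t u v; rewrite !mulrDl.
exact: third_eq.
Qed.

Lemma contraction_quad :
  ip ((\sum_s \sum_t gm s *m gm t *m quad (rh s t)) *m psi) psi = 2^-1 * S * q.
Proof.
transitivity (4^-1 * \sum_s \sum_t \sum_u \sum_v rh s t u v * m4 s t u v); last first.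
  by rewrite contraction_m4; field.
rewrite mulmx_suml ip_suml mulr_sumr; apply: eq_bigr => s _.
rewrite mulmx_suml ip_suml mulr_sumr; apply: eq_bigr => t _.
rewrite /quad mulmx_sumr mulmx_suml ip_suml mulr_sumr; apply: eq_bigr => u _.
rewrite mulmx_sumr mulmx_suml ip_suml mulr_sumr; apply: eq_bigr => v _.
by rewrite -scalemxAr -scalemxAl ipZl !mulmxA mulrA.
Qed.

End Contraction.

End Clifford.

(** * Tensor powers *)

Section Tensor.
Variable R : realType.
Local Notation C := R[i].

Lemma tensDl m n p q (A B : 'M[C]_(m, n)) (X : 'M[C]_(p, q)) :
  (A + B) *t X = A *t X + B *t X.
Proof. by apply/matrixP => i j; rewrite !mxE mulrDl. Qed.

Lemma tensDr m n p q (A B : 'M[C]_(m, n)) (X : 'M[C]_(p, q)) :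
  X *t (A + B) = X *t A + X *t B.
Proof. by apply/matrixP => i j; rewrite !mxE mulrDr. Qed.

Lemma tensZl m n p q a (A : 'M[C]_(m, n)) (X : 'M[C]_(p, q)) :
  (a *: A) *t X = a *: (A *t X).
Proof. by apply/matrixP => i j; rewrite !mxE mulrA. Qed.

Lemma tensZr m n p q a (A : 'M[C]_(m, n)) (X : 'M[C]_(p, q)) :
  X *t (a *: A) = a *: (X *t A).
Proof. by apply/matrixP => i j; rewrite !mxE mulrCA. Qed.

Lemma tensNl m n p q (A : 'M[C]_(m, n)) (X : 'M[C]_(p, q)) :
  (- A) *t X = - (A *t X).
Proof. by rewrite -scaleN1r tensZl scaleN1r. Qed.

Lemma tensNr m n p q (A : 'M[C]_(m, n)) (X : 'M[C]_(p, q)) :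
  X *t (- A) = - (X *t A).
Proof. by rewrite -scaleN1r tensZr scaleN1r. Qed.

Lemma tens_sumr m n p q I (s : seq I) (P : pred I) (F : I -> 'M[C]_(m, n))
    (X : 'M[C]_(p, q)) :
  X *t (\sum_(i <- s | P i) F i) = \sum_(i <- s | P i) X *t F i.
Proof.
by apply: (big_morph (fun A : 'M[C]_(m, n) => X *t A)) => [A B|]; rewrite ?tensDr ?tensmx0.
Qed.

Lemma tens11 m n : (1%:M : 'M[C]_m) *t (1%:M : 'M[C]_n) = 1%:M.
Proof.
apply/matrixP => i j.
case: (mxtens_indexP i) => i1 i2; case: (mxtens_indexP j) => j1 j2.
rewrite tensmxE !mxE (can_eq (@mxtens_indexK m n)) xpair_eqE.
by case: (i1 == j1); case: (i2 == j2); rewrite /= ?mulr0 ?mul0r ?mulr1.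
Qed.

Section Derivation.
Variable N : nat.
Implicit Types A B : 'M[C]_N.

Lemma tens_derD A B m : tens_der (A + B) m = tens_der A m + tens_der B m.
Proof.
elim: m => [|m IH] /=; first by rewrite addr0.
by rewrite IH tensDl tensDr addrACA.
Qed.

Lemma tens_derZ a A m : tens_der (a *: A) m = a *: tens_der A m.
Proof.
elim: m => [|m IH] /=; first by rewrite scaler0.
by rewrite IH tensZl tensZr scalerDr.
Qed.

Lemma tens_derN A m : tens_der (- A) m = - tens_der A m.
Proof. by rewrite -scaleN1r tens_derZ scaleN1r. Qed.

Lemma tens_der0 m : tens_der (0 : 'M[C]_N) m = 0.
Proof. by rewrite -(scale0r (0 : 'M[C]_N)) tens_derZ scale0r. Qed.

Lemma tens_der_sum I (s : seq I) (P : pred I) (F : I -> 'M[C]_N) m :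
  tens_der (\sum_(i <- s | P i) F i) m = \sum_(i <- s | P i) tens_der (F i) m.
Proof.
exact: (big_morph (fun A => tens_der A m) (fun A B => tens_derD A B m) (tens_der0 m)).
Qed.

Lemma adj_tens_der A m : adj (tens_der A m) = tens_der (adj A) m.
Proof.
elim: m => [|m IH] /=; first by rewrite adj0.
by rewrite adjD !adj_tens !adj1 IH.
Qed.

Lemma tens_der_comm A B m :
  tens_der A m *m tens_der B m - tens_der B m *m tens_der A m =
  tens_der (A *m B - B *m A) m.
Proof.
elim: m => [|m IH] /=; first by rewrite mulmx0 subr0.
rewrite !(mulmxDl, mulmxDr) !tensmx_mul !mul1mx !mulmx1 -IH.
rewrite tensDl tensNl tensDr tensNr.
move: ((A *m B) *t _) ((B *m A) *t _) (A *t _) (B *t _) => x y z w.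
move: (1%:M *t _) (1%:M *t _) => u v.
by apply/matrixP => i j; rewrite !mxE; ring.
Qed.

Lemma tens_pow_unitary A m : adj A *m A = 1%:M ->
  adj (tens_pow A m) *m tens_pow A m = 1%:M.
Proof.
move=> AA; elim: m => [|m IH] /=; first by rewrite adj1 mulmx1.
by rewrite adj_tens tensmx_mul AA IH tens11.
Qed.

End Derivation.

(** ** The norm of a sum over the tensor factors *)

Section TwistedNorm.
Variables (n r N N2 : nat) (c : 'I_r -> 'I_r -> 'I_n -> 'I_n -> R).
Variables (X : 'I_n -> 'I_n -> 'M[C]_N) (Y : 'I_r -> 'I_r -> 'M[C]_N2).

(** The shape of Theta, with the action of the f_h f_l on the tensor power left
   open: being linear in Z, it compares the actions for different powers. *)
Definition twist k k' (Z : 'M[C]_N2 -> 'M[C]_(k, k')) : 'M[C]_(N * k, N * k') :=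
  \sum_(h < r) \sum_(l < r | (h < l)%N) \sum_(i < n) \sum_(j < n | (i < j)%N)
    (c h l i j)%:C *: (X i j *t Z (Y h l)).

Lemma twistD k k' (Z Z' : 'M[C]_N2 -> 'M[C]_(k, k')) :
  twist (fun y => Z y + Z' y) = twist Z + twist Z'.
Proof.
rewrite /twist -big_split; apply: eq_bigr => h _.
rewrite -big_split; apply: eq_bigr => l _; rewrite -big_split; apply: eq_bigr => i _.
rewrite -big_split; apply: eq_bigr => j _ /=.
by rewrite tensDr scalerDr.
Qed.

Lemma twist0 k k' : twist (fun=> 0 : 'M[C]_(k, k')) = 0.
Proof.
rewrite /twist; do 4 apply: big1 => ? _.
by rewrite tensmx0 scaler0.
Qed.

Lemma twist_mull k k' k'' (P : 'M[C]_(k'', k)) (Z : 'M[C]_N2 -> 'M[C]_(k, k')) :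
  (1%:M *t P) *m twist Z = twist (fun y => P *m Z y).
Proof.
rewrite /twist mulmx_sumr; apply: eq_bigr => h _.
rewrite mulmx_sumr; apply: eq_bigr => l _; rewrite mulmx_sumr; apply: eq_bigr => i _.
rewrite mulmx_sumr; apply: eq_bigr => j _.
by rewrite -scalemxAr tensmx_mul mul1mx.
Qed.

Lemma twist_mulr k k' k'' (P : 'M[C]_(k', k'')) (Z : 'M[C]_N2 -> 'M[C]_(k, k')) :
  twist Z *m (1%:M *t P) = twist (fun y => Z y *m P).
Proof.
rewrite /twist mulmx_suml; apply: eq_bigr => h _.
rewrite mulmx_suml; apply: eq_bigr => l _; rewrite mulmx_suml; apply: eq_bigr => i _.
rewrite mulmx_suml; apply: eq_bigr => j _.
by rewrite -scalemxAl tensmx_mul mulmx1.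
Qed.

(** The projection of C^N2 (x) C^L, a direct sum of N2 copies of C^L, to the
   j-th copy. *)
Definition slice L (j : 'I_N2) : 'M[C]_(L, N2 * L) :=
  \matrix_(l, k) (k == mxtens_index (j, l))%:R.

Lemma slice_tens L (j : 'I_N2) (B : 'M[C]_L) :
  slice L j *m (1%:M *t B) = B *m slice L j.
Proof.
apply/matrixP => l k; case: (mxtens_indexP k) => k1 k2.
rewrite !mxE (bigD1 (mxtens_index (j, l))) //= big1 ?addr0; last first.
  by move=> i ne; rewrite mxE (negbTE ne) mul0r.
rewrite tensmxE !mxE eqxx mul1r (bigD1 k2) //= big1 ?addr0; last first.
  move=> i ne; rewrite mxE (can_eq (@mxtens_indexK _ _)) xpair_eqE.
  by rewrite [k2 == i]eq_sym (negbTE ne) andbF mulr0.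
by rewrite mxE (can_eq (@mxtens_indexK _ _)) xpair_eqE eqxx andbT mulrC eq_sym.
Qed.

Lemma slice_resolution L : \sum_j adj (slice L j) *m slice L j = 1%:M.
Proof.
apply/matrixP => k k'; rewrite summxE !mxE.
case: (mxtens_indexP k) => k1 k2; rewrite (bigD1 k1) //= big1 ?addr0.
  rewrite mxE (bigD1 k2) //= big1 ?addr0; last first.
    move=> i ne; rewrite !mxE (can_eq (@mxtens_indexK _ _)) xpair_eqE.
    by rewrite [k2 == i]eq_sym (negbTE ne) andbF rmorph0 mul0r.
  by rewrite !mxE eqxx rmorph1 mul1r eq_sym.
move=> j ne; rewrite mxE big1 // => i _; rewrite !mxE.
rewrite (can_eq (@mxtens_indexK _ _)) xpair_eqE [k1 == j]eq_sym (negbTE ne).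
by rewrite rmorph0 mul0r.
Qed.

(** Each of the m summands acts like the operator for m = 1 on C^N and one of the
   factors C^N2, and trivially on the others. The induction splits off the first
   of these factors: P_j cuts the space into copies on which the operator for m
   acts, and P_l into copies on which the operator for 1 acts. *)
Lemma twist_norm_le K m : 0 <= K ->
  norm_le (twist (fun y => tens_der y 1)) K ->
  norm_le (twist (fun y => tens_der y m)) (m%:R * K).
Proof.
move=> K0 H1; elim: m => [|m IH].
  by move=> v; rewrite twist0 mul0mx hnorm0 !mul0r.
rewrite [X in norm_le X](_ : _ = twist (fun y => y *t (1%:M : 'M[C]_(tens_dim N2 m))) +
   twist (fun y => (1%:M : 'M[C]_N2) *t tens_der y m)); last exact: twistD.
rewrite -natr1 mulrDl mul1r addrC; apply: norm_leD.
  apply: (norm_le_slice (P := fun j : 'I_N2 => 1%:M *t slice (tens_dim N2 m) j)) IH => //.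
  - under eq_bigr do rewrite adj_tens adj1 tensmx_mul mulmx1.
    by rewrite -tens_sumr slice_resolution tens11.
  - move=> j; rewrite twist_mull twist_mulr; congr (twist _).
    by apply/funext => y; exact: slice_tens.
  by rewrite mulr_ge0.
apply: (norm_le_slice (P := fun l : 'I_(tens_dim N2 m) =>
  1%:M *t ((1%:M : 'M[C]_N2) *t (delta_mx 0 l : 'M[C]_(1, tens_dim N2 m))))) H1 => //.
- under eq_bigr do rewrite !adj_tens !adj1 !tensmx_mul !mulmx1.
  rewrite -tens_sumr -tens_sumr [X in _ *t (_ *t X)](_ : _ = 1%:M) ?tens11 //.
  rewrite mx1_sum_delta; apply: eq_bigr => l _.
  by rewrite /adj map_delta_mx trmx_delta mul_delta_mx.
move=> l; rewrite twist_mull twist_mulr; congr (twist _); apply/funext => y /=.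
by rewrite tensmx0 addr0 !tensmx_mul !mul1mx !mulmx1.
Qed.

End TwistedNorm.

End Tensor.

(** * Unitarity of the spin representation *)

Section Kappa.
Variables (R : realType) (n : nat) (K : spinor_rep R n).
Local Notation gm := (gam K).

Lemma gam_adj i : adj (gm i) = - gm i.
Proof. exact: gam_skew. Qed.

Lemma gam_sqr i : gm i *m gm i = - 1%:M.
Proof.
have two0 : (2 : R[i]) != 0 by rewrite pnatr_eq0.
apply: (scalerI two0); rewrite scaler_nat mulr2n gam_clifford eqxx mulr1.
by rewrite scalerN scale_scalar_mx mulr1 raddfN.
Qed.

Lemma gam_anti i j : i != j -> gm i *m gm j = - (gm j *m gm i).
Proof.
move=> /negbTE ij; apply/eqP; rewrite -addr_eq0 gam_clifford ij mulr0 oppr0.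
by rewrite raddf0.
Qed.

Definition symd (A B : {set 'I_n}) : {set 'I_n} := ((A :\: B) :|: (B :\: A))%SET.

Lemma in_symd1 i B j : (j \in symd [set i]%SET B) = if j == i then i \notin B else j \in B.
Proof.
by rewrite !inE; case: eqVneq => [->|ji]; rewrite ?andbT ?andbF ?orbF // orFb andbT.
Qed.

(** Moving e_i to its place in the ordered product costs a sign for every j < i
   in B, and cancelling e_i e_i = -1 costs one more if i belongs to B. *)
Lemma gam_prod_seq i (B : {set 'I_n}) (s : seq 'I_n) :
  sorted (fun x y : 'I_n => (x < y)%N) s -> i \in s ->
  gm i * \prod_(j <- s | j \in B) gm j =
  (-1) ^+ count (fun j : 'I_n => (j \in B) && (j <= i)%N) s *:
    \prod_(j <- s | j \in symd [set i]%SET B) gm j.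
Proof.
have mulE (x y : 'M[R[i]]_(2 ^ n./2)) : x * y = x *m y by [].
have tr : transitive (fun x y : 'I_n => (x < y)%N) by move=> ? ? ?; exact: ltn_trans.
elim: s => // j s IH js; have /allP jmin := order_path_min tr js.
rewrite inE !big_cons in_symd1 /=; case: (eqVneq i j) => [ij _|ij /= si].
  rewrite -ij leqnn andbT in jmin *.
  have rest : \prod_(k <- s | k \in symd [set i]%SET B) gm k = \prod_(k <- s | k \in B) gm k.
    rewrite big_seq_cond [RHS]big_seq_cond; apply: eq_bigl => k.
    rewrite in_symd1; case: eqVneq => // ->.
    by case: (boolP (i \in s)) => // /jmin; rewrite ltnn.
  have c0 : count (fun k : 'I_n => (k \in B) && (k <= i)%N) s = 0%N.
    apply/eqP; rewrite -leqn0 leqNgt -has_count; apply/hasPn => k /jmin.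
    by rewrite negb_and -ltnNge orbC => ->.
  rewrite rest c0 addn0; case: (boolP (i \in B)) => iB /=.
    by rewrite expr1 mulrA -[gm i * gm i]/(gm i *m gm i) gam_sqr mulN1r scaleN1r.
  by rewrite expr0 scale1r.
have {}IH := IH (path_sorted js) si.
have ji : (j < i)%N := jmin i si.
rewrite (ltnW ji) andbT; case: (boolP (j \in B)) => jB /=.
  rewrite mulrA -[gm i * gm j]/(gm i *m gm j) gam_anti // mulNr.
  rewrite -[gm j *m gm i]/(gm j * gm i) -mulrA IH add1n exprS mulN1r scaleNr.
  by rewrite (mulE _ (_ *: _)) -scalemxAr.
by rewrite IH add0n.
Qed.

Definition gprod (B : {set 'I_n}) : 'M[R[i]]_(2 ^ n./2) := \prod_(j in B) gm j.

Lemma gam_prod i (B : {set 'I_n}) :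
  gm i *m gprod B = (cl_sign R [set i]%SET B)%:C *: gprod (symd [set i]%SET B).
Proof.
have srt : sorted (fun x y : 'I_n => (x < y)%N) (index_enum 'I_n).
  rewrite [index_enum _]unlock -enumT.
  by have := iota_ltn_sorted 0 n; rewrite -val_enum_ord sorted_map.
rewrite -[LHS]/(gm i * _) /gprod (gam_prod_seq B srt) ?mem_index_enum //.
rewrite /cl_sign rmorphXn rmorphN1; congr (_ ^+ _ *: _).
rewrite -sum1_count sum1_card -(card_imset _ (f := pair i)); last by move=> x y [].
apply: eq_card => -[a b]; apply/imsetP/idP => [[j jB [-> ->]]|].
  by apply: mem_set; rewrite /= finset.in_set1 eqxx.
move/set_mem => /= /and3P[]; rewrite finset.in_set1 => /eqP -> bB bi.
by exists b => //; rewrite -topredE /= bB.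
Qed.

(** Elements of Spin(n) are products of vectors, so this case of the
   multiplicativity of kappa gives its value on all of them. *)
Lemma kappa_vec_mul v y : kappa K (cl_mul (cl_vec v) y) = clv gm v *m kappa K y.
Proof.
rewrite /kappa -/(gprod _).
transitivity (\sum_A \sum_B (cl_sign R A B * cl_vec v A * y B)%:C *: gprod (symd A B)).
  under eq_bigr do rewrite ffunE rmorph_sum scaler_suml.
  rewrite exchange_big /=; apply: eq_bigr => A _.
  under eq_bigr do rewrite rmorph_sum scaler_suml.
  rewrite (exchange_big_dep xpredT) //=; apply: eq_bigr => B _.
  by rewrite (big_pred1 (symd A B)) // => C; rewrite eq_sym.
transitivity (\sum_B \sum_i (v 0 i * y B)%:C *: (gm i *m gprod B)); last first.
  rewrite mulmx_sumr; apply: eq_bigr => B _; rewrite mulmx_suml.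
  apply: eq_bigr => i _; rewrite -scalemxAl -scalemxAr scalerA.
  by rewrite rmorphM.
rewrite exchange_big /=; apply: eq_bigr => B _.
under eq_bigr do rewrite ffunE mulr_sumr mulr_suml rmorph_sum scaler_suml.
rewrite exchange_big /=; apply: eq_bigr => i _.
rewrite (bigD1 [set i]%SET) //= eqxx big1 ?addr0 => [|A /negbTE ->].
  by rewrite gam_prod scalerA -rmorphM mulr1; congr (_%:C *: _); ring.
by rewrite !mulr0 mul0r scale0r.
Qed.

Lemma kappa_one : kappa K (cl_one R n) = 1%:M.
Proof.
rewrite /kappa (bigD1 finset.set0) //= ffunE eqxx scale1r big_set0 big1 ?addr0 //.
by move=> A /negbTE A0; rewrite ffunE A0 scale0r.
Qed.

(** Clifford multiplication by a unit vector is skew with square -1, hence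
   unitary. *)
Lemma kappa_unitary x : @Spin R n x -> adj (kappa K x) *m kappa K x = 1%:M.
Proof.
move=> [us [_ unit ->]]; elim: us unit => [|u us IH] unit /=.
  by rewrite kappa_one adj1 mulmx1.
have cc : adj (clv gm u) *m clv gm u = 1%:M.
  rewrite (adj_clv gam_adj) mulNmx (clv_sqr (gam_clifford K)) unit ?mem_head //.
  by rewrite mxE eqxx -scaleN1r scale_scalar_mx mulN1r opprK.
rewrite kappa_vec_mul adjM mulmxA -(mulmxA _ _ (clv gm u)) cc mulmx1.
apply: IH => w ws.
by apply: unit; rewrite inE ws orbT.
Qed.

End Kappa.

Section SpinAction.
Variables (R : realType) (n r m : nat) (Kn : spinor_rep R n) (Kr : spinor_rep R r).

Lemma spin_action_isometry x y u : @Spin R n x -> @Spin R r y ->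
  ip (spin_action Kn Kr m x y *m u) (spin_action Kn Kr m x y *m u) = ip u u.
Proof.
move=> sx sy; rewrite ip_adj mulmxA /spin_action adj_tens tensmx_mul.
by rewrite kappa_unitary // tens_pow_unitary ?kappa_unitary // tens11 mul1mx.
Qed.

(** ** The connection on the twisted spinor space *)

Definition gamT i : 'M[R[i]]_(spinor_dim n r m) := cliffT r m (gam Kn i).

Lemma gamT_clifford i j :
  gamT i *m gamT j + gamT j *m gamT i = (- (2 * (i == j)%:R))%:M.
Proof.
rewrite /gamT /cliffT !tensmx_mul !mulmx1 -tensDl gam_clifford.
by rewrite -[X in X *t _]scalemx1 tensZl tens11 scalemx1.
Qed.

Lemma gamT_adj i : adj (gamT i) = - gamT i.
Proof. by rewrite /gamT /cliffT adj_tens adj1 gam_adj tensNl. Qed.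

Definition quadF (w : 'M[R]_r) : 'M[R[i]]_(spinor_dim n r m) :=
  1%:M *t tens_der (quad (gam Kr) w) m.

Lemma quadFD w w' : quadF (w + w') = quadF w + quadF w'.
Proof. by rewrite /quadF quadD tens_derD tensDr. Qed.

Lemma quadFZ a w : quadF (a *: w) = a%:C *: quadF w.
Proof. by rewrite /quadF quadZ tens_derZ tensZr. Qed.

Lemma quadFB w w' : quadF (w - w') = quadF w - quadF w'.
Proof. by rewrite -scaleN1r quadFD quadFZ rmorphN1 scaleN1r. Qed.

Lemma quadF_sum I (s : seq I) (F : I -> 'M[R]_r) :
  quadF (\sum_(i <- s) F i) = \sum_(i <- s) quadF (F i).
Proof.
apply: (big_morph quadF quadFD).
by rewrite -(scale0r (0 : 'M[R]_r)) quadFZ scale0r.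
Qed.

Lemma adj_quadF w : w^T = - w -> adj (quadF w) = - quadF w.
Proof.
move=> wT; rewrite /quadF adj_tens adj1 adj_tens_der (adj_quad (@gam_adj _ _ Kr)) //.
by rewrite tens_derN tensNr.
Qed.

Lemma comm_quadF w w' : w^T = - w ->
  quadF w *m quadF w' - quadF w' *m quadF w = quadF (w' *m w - w *m w').
Proof.
move=> wT; rewrite /quadF !tensmx_mul !mul1mx -tensNr -tensDr tens_der_comm.
by rewrite (comm_quad_quad (gam_clifford Kr)).
Qed.

Lemma quadF_gamT w i : quadF w *m gamT i = gamT i *m quadF w.
Proof. by rewrite /quadF /gamT /cliffT !tensmx_mul !mul1mx !mulmx1. Qed.

Lemma quadF_clv w v : quadF w *m clv gamT v = clv gamT v *m quadF w.
Proof.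
rewrite /clv mulmx_sumr mulmx_suml; apply: eq_bigr => z _.
by rewrite -scalemxAr -scalemxAl quadF_gamT.
Qed.

Lemma quadF_quad w w' : quadF w *m quad gamT w' = quad gamT w' *m quadF w.
Proof.
rewrite /quad mulmx_sumr mulmx_suml; apply: eq_bigr => y _.
rewrite mulmx_sumr mulmx_suml; apply: eq_bigr => z _.
by rewrite -scalemxAr -scalemxAl mulmxA quadF_gamT -!mulmxA quadF_gamT.
Qed.

Lemma quadT_lt w : w^T = - w ->
  \sum_(i < n) \sum_(j < n | (i < j)%N)
    (2^-1 * w i j)%:C *: cliffT r m (gam Kn i *m gam Kn j) = quad gamT w.
Proof.
move=> wT; rewrite -(quad_lt gamT_clifford wT); apply: eq_bigr => i _.
apply: eq_bigr => j _; congr (_ *: _).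
by rewrite /gamT /cliffT tensmx_mul mulmx1.
Qed.

Lemma quadF_lt w : w^T = - w ->
  \sum_(h < r) \sum_(l < r | (h < l)%N) (2^-1 * w h l)%:C *: cliffF n Kr m h l =
  quadF w.
Proof.
move=> wT; rewrite /quadF -(quad_lt (gam_clifford Kr) wT).
rewrite tens_der_sum tens_sumr; apply: eq_bigr => h _.
rewrite tens_der_sum tens_sumr; apply: eq_bigr => l _.
by rewrite tens_derZ tensZr.
Qed.

(** Summing the curvature of F over all pairs of frame vectors counts every
   pair twice, and quadF counts every pair (k, l) with weight 1/2. *)
Lemma twisting_term (w : 'I_n -> 'I_n -> 'M[R]_r) :
  (forall s t, w s t = - w t s) -> (forall s t, (w s t)^T = - w s t) ->
  \sum_s \sum_t gamT s *m gamT t *m quadF (w s t) =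
  \sum_(h < r) \sum_(l < r | (h < l)%N) \sum_(i < n) \sum_(j < n | (i < j)%N)
    (w i j h l)%:C *: (cliffT r m (gam Kn i *m gam Kn j) *m cliffF n Kr m h l).
Proof.
move=> wA wT.
have w0 s : w s s = 0.
  apply/eqP; have /eqP := wA s s; rewrite -addr_eq0 -mulr2n -scaler_nat.
  by rewrite scaler_eq0 pnatr_eq0.
have qN x : quadF (- x) = - quadF x.
  by rewrite -scaleN1r quadFZ rmorphN1 scaleN1r.
rewrite sum_lt => [|s t|s]; first last.
- by rewrite w0 -(scale0r (0 : 'M[R]_r)) quadFZ scale0r mulmx0.
- rewrite (wA s t) qN (gm_swap gamT_clifford).
  case: eqVneq => [->|st]; first by rewrite w0 -(scale0r (0 : 'M[R]_r)) quadFZ scale0r oppr0 !mulmx0.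
  by rewrite mulr0 oppr0 raddf0 sub0r mulNmx mulmxN opprK.
transitivity (\sum_(i < n) \sum_(j < n | (i < j)%N)
    \sum_(h < r) \sum_(l < r | (h < l)%N)
    (w i j h l)%:C *: (cliffT r m (gam Kn i *m gam Kn j) *m cliffF n Kr m h l)).
  rewrite -sumrMnl; apply: eq_bigr => i _; rewrite -sumrMnl; apply: eq_bigr => j _.
  rewrite -quadF_lt // mulmx_sumr -sumrMnl; apply: eq_bigr => h _.
  rewrite mulmx_sumr -sumrMnl; apply: eq_bigr => l _.
  rewrite -scalemxAr scalerMnl.
  have -> : (2^-1 * w i j h l)%:C *+ 2 = (w i j h l)%:C.
    by rewrite -rmorphMn; congr (_%:C); rewrite -mulr_natr; field.
  by rewrite /gamT /cliffT tensmx_mul mulmx1.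
rewrite pair_big_dep /= [RHS]pair_big_dep /=.
under eq_bigr do rewrite pair_big_dep /=.
under [RHS]eq_bigr do rewrite pair_big_dep /=.
exact: exchange_big.
Qed.

End SpinAction.

(** * Differentiating spinor fields *)

Section WeakDerivative.
Variables (R : realType) (n N : nat) (M : manifold R n).
Variables (W : set M) (c : chart M) (p : M).
Hypotheses (oW : open W) (Wp : W p) (cp : dom c p).
Local Notation V := 'cV[R[i]]_N.
Implicit Types (F G : M -> V) (u v w : V).

(** A vector is determined by its real inner products, so that a spinor field
   is differentiated by differentiating real functions only. *)
Definition vsmooth F := forall w, smooth_on W (fun q => ip w (F q)).
Definition vderiv j F v := forall w, pd c j (fun q => ip w (F q)) p = ip w v.

Lemma ip_inj u v : (forall w, ip w u = ip w v) -> u = v.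
Proof.
move=> H; apply/eqP; rewrite -subr_eq0; apply/eqP; apply: ip_eq0.
by rewrite ipDr ipNr H subrr.
Qed.

(** The orthonormal basis e_i, sqrt(-1) e_i of C^N as a real vector space. *)
Definition rbasis (b : 'I_N * bool) : V :=
  (if b.2 then 'i%C else 1) *: delta_mx b.1 0.

Lemma ip_basis u v : ip u v = \sum_b ip (rbasis b) u * ip (rbasis b) v.
Proof.
have coord (x : V) i : ip (rbasis (i, false)) x = complex.Re (x i 0) /\
    ip (rbasis (i, true)) x = complex.Im (x i 0).
  rewrite !ipE; split; rewrite (bigD1 i) //= big1 ?addr0 => [|j /negbTE ji].
  - by rewrite !mxE !eqxx /=; ring.
  - by rewrite !mxE ji /=; ring.
  - by rewrite !mxE !eqxx /=; ring.
  - by rewrite !mxE ji /=; ring.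
rewrite ipE -(pair_bigA _ (fun i b => ip (rbasis (i, b)) u * ip (rbasis (i, b)) v)) /=.
apply: eq_bigr => i _; rewrite big_bool /= !(coord _ i).1 !(coord _ i).2.
by rewrite addrC.
Qed.

Lemma vsmooth_ip F G : vsmooth F -> vsmooth G -> smooth_on W (fun q => ip (F q) (G q)).
Proof.
move=> sF sG.
apply: (@smooth_on_ext _ _ _ _
  (fun q => \sum_b ip (rbasis b) (F q) * ip (rbasis b) (G q))) => //.
  by move=> q _; rewrite -ip_basis.
by apply: smooth_on_sum => // b _; apply: smooth_onM.
Qed.

Lemma pd_ip j F G (F' G' : V) : vsmooth F -> vsmooth G -> vderiv j F F' -> vderiv j G G' ->
  pd c j (fun q => ip (F q) (G q)) p = ip F' (G p) + ip (F p) G'.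
Proof.
move=> sF sG dF dG.
transitivity (pd c j (fun q => \sum_b ip (rbasis b) (F q) * ip (rbasis b) (G q)) p).
  by apply: (pd_ext oW Wp cp) => q _; exact: ip_basis.
rewrite (pd_sum oW Wp cp) => [|b _]; last exact: smooth_onM.
rewrite (ip_basis F') (ip_basis (F p)) -big_split; apply: eq_bigr => b _ /=.
by rewrite (pdM Wp cp) // dF dG.
Qed.

Lemma vsmoothD F G : vsmooth F -> vsmooth G -> vsmooth (fun q => F q + G q).
Proof.
move=> sF sG w; apply: smooth_on_ext (smooth_onD oW (sF w) (sG w)) => // q _.
by rewrite ipDr.
Qed.

Lemma vderivD j F G (F' G' : V) : vsmooth F -> vsmooth G -> vderiv j F F' -> vderiv j G G' ->
  vderiv j (fun q => F q + G q) (F' + G').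
Proof.
move=> sF sG dF dG w; rewrite ipDr -dF -dG -(pdD Wp cp) //.
by apply: (pd_ext oW Wp cp) => q _; rewrite ipDr.
Qed.

(** The Killing equation expresses the derivative of psi through matrices that
   depend linearly on the connection forms and the coframe; this is the product
   rule for them. *)
Section LinearAction.
Variables (k l : nat) (L : 'M[R]_(k, l) -> 'M[R[i]]_N) (A : M -> 'M[R]_(k, l)).
Hypotheses (LD : forall x y, L (x + y) = L x + L y).
Hypothesis LZ : forall a x, L (a *: x) = a%:C *: L x.
Hypothesis sA : smooth_mx W A.

Let L_delta x u w : ip w (L x *m u) =
  \sum_i \sum_j x i j * ip (adj (L (delta_mx i j)) *m w) u.
Proof.
have L0 : L 0 = 0 by rewrite -(scale0r (0 : 'M[R]_(k, l))) LZ scale0r.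
have Ls I (s : seq I) (H : I -> 'M[R]_(k, l)) :
    L (\sum_(i <- s) H i) = \sum_(i <- s) L (H i).
  exact: (big_morph L LD L0).
rewrite {1}(matrix_sum_delta x) Ls mulmx_suml ipC ip_suml; apply: eq_bigr => i _.
rewrite Ls mulmx_suml ip_suml; apply: eq_bigr => j _.
by rewrite LZ -scalemxAl ipZl ip_adj ipC.
Qed.

Lemma vsmooth_lin F : vsmooth F -> vsmooth (fun q => L (A q) *m F q).
Proof.
move=> sF w; apply: (@smooth_on_ext _ _ _ _ (fun q => \sum_i \sum_j
    A q i j * ip (adj (L (delta_mx i j)) *m w) (F q))) => //.
apply: smooth_on_sum; [exact: oW|move=> i _].
apply: smooth_on_sum; [exact: oW|move=> j _].
exact: smooth_onM oW (sA i j) (sF _).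
Qed.

Lemma vderiv_lin j F (F' : V) : vsmooth F -> vderiv j F F' ->
  vderiv j (fun q => L (A q) *m F q) (L (dmx c j A p) *m F p + L (A p) *m F').
Proof.
move=> sF dF w.
transitivity (pd c j (fun q => \sum_i \sum_h
    A q i h * ip (adj (L (delta_mx i h)) *m w) (F q)) p).
  by apply: (pd_ext oW Wp cp) => q _; rewrite L_delta.
rewrite (pd_sum oW Wp cp) => [|i _]; last first.
  by apply: smooth_on_sum; [exact: oW|move=> h _; exact: smooth_onM oW (sA i h) (sF _)].
rewrite ipDr !L_delta -big_split; apply: eq_bigr => i _ /=.
rewrite (pd_sum oW Wp cp) => [|h _]; last exact: smooth_onM oW (sA i h) (sF _).
rewrite -big_split; apply: eq_bigr => h _ /=.
by rewrite (pdM Wp cp) // dF [dmx _ _ _ _ _ _]mxE.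
Qed.

End LinearAction.

End WeakDerivative.

(** * The integrability condition of the Killing equation *)

Lemma addr3ACA (V : zmodType) (a1 b1 a2 b2 a3 b3 : V) :
  a1 + b1 + (a2 + b2) + (a3 + b3) = a1 + a2 + a3 + (b1 + b2 + b3).
Proof. by rewrite (addrACA a1 b1) (addrACA (a1 + a2)). Qed.

Lemma sub3 (R : pzRingType) (V : lmodType R) (x x' y y' z z' : V) (mu : R) :
  - x - y + mu *: z - (- x' - y' + mu *: z') =
  - (x - x') - (y - y') + mu *: (z - z').
Proof.
rewrite scalerBr 2!opprD !opprK addrACA; congr (_ + _).
by rewrite [- (x - x')]opprB [- (y - y')]opprB addrACA [- x + x']addrC [- y + y']addrC.
Qed.

(** H says that the mixed second derivatives of psi agree; br expands the bracket
   of the connection matrices, and the vanishing of t - k, the torsion, removes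
   the terms linear in mu. *)
Lemma killing_algebra (R : comPzRingType) N (dij dji Bi Bj x x' y y' z t k : 'M[R]_N)
    (psi : 'cV[R]_N) (mu : R) :
  dij *m psi + Bj *m (Bi *m psi) = dji *m psi + Bi *m (Bj *m psi) ->
  Bj *m Bi - Bi *m Bj = x + y - mu *: k - mu ^+ 2 *: z -> t - k = 0 ->
  dij - dji = - x' - y' + mu *: t ->
  ((x' - x) + (y' - y)) *m psi = - (mu ^+ 2) *: (z *m psi).
Proof.
move=> H br /subr0_eq tk dd; apply/eqP; rewrite -subr_eq0; apply/eqP.
have : (dij - dji + (Bj *m Bi - Bi *m Bj)) *m psi = 0.
  rewrite mulmxDl !mulmxBl -!mulmxA addrACA H -opprD subrr //.
rewrite dd br tk => /(congr1 (fun u => - u)); rewrite oppr0 => E.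
rewrite -[RHS]E -mulNmx scalemxAl -mulmxBl; congr (_ *m _).
by apply/matrixP => i j; rewrite !mxE; ring.
Qed.

(** S1, S2 and E stand for the spin connection, the auxiliary connection and
   Clifford multiplication. S2 acts on other tensor factors than S1 and E, so it
   only meets itself in the bracket. *)
Lemma bracket_expand (R : comPzRingType) N (S1a S1b S2a S2b Ea Eb : 'M[R]_N) (mu : R) :
  S2b *m S1a = S1a *m S2b -> S2a *m S1b = S1b *m S2a ->
  S2b *m Ea = Ea *m S2b -> S2a *m Eb = Eb *m S2a ->
  (- S1b - S2b + mu *: Eb) *m (- S1a - S2a + mu *: Ea) -
    (- S1a - S2a + mu *: Ea) *m (- S1b - S2b + mu *: Eb) =
  (S1b *m S1a - S1a *m S1b) + (S2b *m S2a - S2a *m S2b) -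
  mu *: ((S1b *m Ea - Ea *m S1b) - (S1a *m Eb - Eb *m S1a)) -
  mu ^+ 2 *: (Ea *m Eb - Eb *m Ea).
Proof.
move=> H1 H2 H3 H4.
rewrite !(mulmxDl, mulmxDr, mulNmx, mulmxN) -!scalemxAl -!scalemxAr H1 H2 H3 H4.
move: (S1b *m S1a) (S1a *m S1b) (S2b *m S2a) (S2a *m S2b) => x1 x2 x3 x4.
move: (S1b *m Ea) (Ea *m S1b) (S1a *m Eb) (Eb *m S1a) => x5 x6 x7 x8.
move: (Ea *m Eb) (Eb *m Ea) (S1a *m S2b) (S1b *m S2a) (Ea *m S2b) (Eb *m S2a).
by move=> x9 y1 y2 y3 y4 y5; apply/matrixP => i j; rewrite !mxE; ring.
Qed.

Section KillingSpinor.
Variables (R : realType) (n r m : nat) (M : manifold R n) (g : metric M).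
Variables (Q : principal_bundle M (SO R r)) (D : metric_connection Q).
Variables (k : spin_kind) (P : spin_structure g Q k).
Variables (Kn : spinor_rep R n) (Kr : spinor_rep R r) (mu : R[i]).
Variable phi : P -> 'cV[R[i]]_(spinor_dim n r m).
Hypothesis phi_section : spinor_section Kn Kr phi.
Hypothesis phi_killing : killing D Kn Kr mu phi.

Section Chart.
Variables (a : triv P) (c : chart M).
Local Notation U := (tdom a).
Local Notation W := (tdom a `&` dom c).
Local Notation e := (local_e a).
Local Notation s := (local_f a).
Local Notation psi := (fun q : M => phi (sec a q)).
Local Notation gT := (gamT r m Kn).
Local Notation cf := (coframe g c e).
Local Notation om := (om g c e).
Local Notation th := (th D c s).
Local Notation E := (frame_in c e).
Local Notation N := (spinor_dim n r m).

Let oU : open U := tdom_open a.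
Let oW : open W := openI oU (@dom_open _ _ M c).
Let e_smooth : smooth_frame U e := frT_smooth a.
Let s_smooth : smooth_section U s := @frF_smooth _ _ _ _ _ _ _ P a.

Let e_ortho q : U q -> e q *m gram g q *m (e q)^T = 1%:M.
Proof. by move=> Uq; rewrite -[in gram g q](sec_proj Uq); exact: frT_orthonormal. Qed.

Definition cl_coord j q : 'M[R[i]]_N := clv gT (row j (cf q)).

(** The Killing equation in components: d_j psi = conn j psi. *)
Definition conn j q : 'M[R[i]]_N :=
  - quad gT (om j q) - quadF n m Kr (th j q) + mu *: cl_coord j q.

Lemma psi_smooth : vsmooth W psi.
Proof.
have [_ sphi] := phi_section; move=> w.
apply: (@smooth_on_ext _ _ _ _ (fun q => \sum_i (complex.Re (w i 0) * complex.Re (psi q i 0)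
    + complex.Im (w i 0) * complex.Im (psi q i 0)))) => //.
  by move=> q _; rewrite ipE.
apply: smooth_on_sum => // i _; have [sR sI] := sphi a i.
have sub : W `<=` U by move=> x [].
apply: smooth_onD => //; apply: smooth_onM => //; try exact: smooth_on_cst.
  exact: smooth_on_sub sR.
exact: smooth_on_sub sI.
Qed.

Lemma psi_deriv j q : W q -> vderiv c q j psi (conn j q *m psi q).
Proof.
move=> Wq w; have [Uq cq] := Wq; have [_ sphi] := phi_section.
have K := phi_killing (delta_mx 0 j) Uq cq.
have -> : conn j q *m psi q = \col_i (pd c j (fun x => complex.Re (psi x i 0)) q +i*
    pd c j (fun x => complex.Im (psi x i 0)) q).
  move: K; rewrite /nabla /killing -/(local_e a) -/(local_f a).
  rewrite -[lc_form g c _ e q]/(om j q) -[F_form D c _ s q]/(th j q).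
  rewrite quadT_lt; last exact: (om_antisym oU e_smooth e_ortho _ Wq).
  rewrite quadF_lt; last exact: (th_antisym D oU s_smooth _ Wq).
  have -> : cliff_mul Kn m a c (delta_mx 0 j) q = cl_coord j q.
    rewrite /cliff_mul /cl_coord /clv; apply: eq_bigr => i _.
    by rewrite -mulmxA -rowE.
  by move=> H; rewrite /conn mulmxDl -scalemxAl -H -opprD mulNmx addrC addrK.
rewrite ipE.
transitivity (pd c j (fun q => \sum_i (complex.Re (w i 0) * complex.Re (psi q i 0)
    + complex.Im (w i 0) * complex.Im (psi q i 0))) q).
  by apply: (pd_ext oW Wq cq) => x _; rewrite ipE.
have sR i : smooth_on W (fun q => complex.Re (psi q i 0)).
  by apply: smooth_on_sub (sphi a i).1 => x [].
have sI i : smooth_on W (fun q => complex.Im (psi q i 0)).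
  by apply: smooth_on_sub (sphi a i).2 => x [].
have sc z := smooth_on_cst z oW.
rewrite (pd_sum oW Wq cq) => [|i _]; last by apply: smooth_onD => //; apply: smooth_onM.
apply: eq_bigr => i _; rewrite (pdD Wq cq); try by apply: smooth_onM.
rewrite !(pdM Wq cq) // !pd_cst !mul0r !add0r mxE.
by [].
Qed.

Definition dconn i j q : 'M[R[i]]_N :=
  - quad gT (dmx c i (om j) q) - quadF n m Kr (dmx c i (th j) q) +
  mu *: clv gT (row j (dmx c i cf q)).

Lemma conn_deriv i j q : W q -> vderiv c q i (fun x => conn j x *m psi x)
  (dconn i j q *m psi q + conn j q *m (conn i q *m psi q)).
Proof.
move=> Wq; have cq := Wq.2; have dpsi := psi_deriv i Wq; have spsi := psi_smooth.
pose L1 w : 'M[R[i]]_N := - quad gT w.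
pose L2 w : 'M[R[i]]_N := - quadF n m Kr w.
pose L3 v : 'M[R[i]]_N := mu *: clv gT v.
have L1D x y : L1 (x + y) = L1 x + L1 y by rewrite /L1 quadD opprD.
have L2D x y : L2 (x + y) = L2 x + L2 y by rewrite /L2 quadFD opprD.
have L3D x y : L3 (x + y) = L3 x + L3 y by rewrite /L3 clvD scalerDr.
have L1Z b x : L1 (b *: x) = b%:C *: L1 x by rewrite /L1 quadZ scalerN.
have L2Z b x : L2 (b *: x) = b%:C *: L2 x by rewrite /L2 quadFZ scalerN.
have L3Z b x : L3 (b *: x) = b%:C *: L3 x.
  by rewrite /L3 clvZ !scalerA mulrC.
have s1 : smooth_mx W (om j) := @om_smooth _ _ _ g c _ _ oU e_smooth e_ortho j.
have s2 : smooth_mx W (th j) := th_smooth D c oU s_smooth j.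
have s3 : smooth_mx W (fun x => row j (cf x)).
  move=> x y; apply: smooth_on_ext (coframe_smooth g c oU e_smooth j y) => // z _.
  by rewrite [RHS]mxE.
have d3 : dmx c i (fun x => row j (cf x)) q = row j (dmx c i cf q).
  apply/rowP => y; rewrite [LHS]mxE [RHS]mxE [RHS]mxE.
  by apply: (pd_ext oW Wq cq) => z _; rewrite [LHS]mxE.
have v1 := vderiv_lin oW Wq cq L1D L1Z s1 spsi dpsi.
have v2 := vderiv_lin oW Wq cq L2D L2Z s2 spsi dpsi.
have v3 := vderiv_lin oW Wq cq L3D L3Z s3 spsi dpsi.
have t1 := vsmooth_lin oW L1D L1Z s1 spsi.
have t2 := vsmooth_lin oW L2D L2Z s2 spsi.
have t3 := vsmooth_lin oW L3D L3Z s3 spsi.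
have := vderivD oW Wq cq (vsmoothD oW t1 t2) t3 (vderivD oW Wq cq t1 t2 v1 v2) v3.
rewrite d3 => H w; move: (H w).
rewrite (_ : _ + _ + _ = dconn i j q *m psi q + conn j q *m (conn i q *m psi q)).
  move=> <-; apply: (pd_ext oW Wq cq) => x _.
  by rewrite /conn !mulmxDl.
rewrite /dconn [conn j q]/conn /L1 /L2 /L3 /cl_coord.
by rewrite !mulmxDl; exact: addr3ACA.
Qed.

(** The torsion-free condition: in nabla_i E_j, the antisymmetric part of the
   Christoffel symbols vanishes. *)
Lemma torsion_free i j q : W q ->
  (clv gT (row j (dmx c i cf q)) - clv gT (row i (dmx c j cf q))) -
  ((quad gT (om j q) *m cl_coord i q - cl_coord i q *m quad gT (om j q)) -
   (quad gT (om i q) *m cl_coord j q - cl_coord j q *m quad gT (om i q))) = 0.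
Proof.
move=> Wq.
have oT l := om_antisym oU e_smooth e_ortho l Wq.
rewrite /cl_coord !(comm_quad_clv (@gamT_clifford _ n r m Kn)) //.
rewrite !(d_coframe oU e_smooth e_ortho _ Wq).
have rowE' x y : row x (Gam g c y q *m cf q - cf q *m om y q) =
    row x (Gam g c y q *m cf q) - row x (cf q) *m om y q.
  by rewrite linearB /= [row x (cf q *m _)]row_mul.
have GG : row j (Gam g c i q *m cf q) = row i (Gam g c j q *m cf q).
  rewrite !row_mul; congr (_ *m _); apply/rowP => l.
  by rewrite !mxE christoffelC.
rewrite !rowE' GG !clvB.
move: (clv gT (row i _)) (clv gT (_ *m om i q)) (clv gT (_ *m om j q)) => x y z.
by apply/matrixP => b d; rewrite !mxE; ring.
Qed.

(** The symmetry of the second derivatives of psi, with the first derivatives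
   replaced by means of the Killing equation; the terms linear in mu form the
   torsion of the Levi-Civita connection. *)
Lemma curvature_killing i j q : W q ->
  (quad gT (Om g c e i j q) + quadF n m Kr (Th D c s i j q)) *m psi q =
  - (mu ^+ 2) *: ((cl_coord i q *m cl_coord j q - cl_coord j q *m cl_coord i q) *m psi q).
Proof.
move=> Wq; have cq := Wq.2.
have comm : dconn i j q *m psi q + conn j q *m (conn i q *m psi q) =
            dconn j i q *m psi q + conn i q *m (conn j q *m psi q).
  apply: ip_inj => w.
  apply: etrans (esym (conn_deriv i j Wq w)) _.
  apply: etrans _ (conn_deriv j i Wq w).
  transitivity (pd c i (pd c j (fun x => ip w (psi x))) q).
    by apply: (pd_ext oW Wq cq) => x Wx; apply: esym; exact: psi_deriv.
  apply: etrans (pd_comm oW Wq cq i j (psi_smooth w)) _.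
  by apply: (pd_ext oW Wq cq) => x Wx; exact: psi_deriv.
have oT l := om_antisym oU e_smooth e_ortho l Wq.
have tT l := th_antisym D oU s_smooth l Wq.
have br := @bracket_expand _ _ (quad gT (om i q)) (quad gT (om j q))
  (quadF n m Kr (th i q)) (quadF n m Kr (th j q)) (cl_coord i q) (cl_coord j q) mu
  (quadF_quad _ _ _ _ _) (quadF_quad _ _ _ _ _) (quadF_clv _ _ _ _ _)
  (quadF_clv _ _ _ _ _).
have c1 := comm_quad_quad (@gamT_clifford _ n r m Kn) (om i q) (oT j).
have c2 := comm_quadF n m Kr (th i q) (tT j).
have dd : dconn i j q - dconn j i q =
    - quad gT (dmx c i (om j) q - dmx c j (om i) q)
    - quadF n m Kr (dmx c i (th j) q - dmx c j (th i) q) +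
    mu *: (clv gT (row j (dmx c i cf q)) - clv gT (row i (dmx c j cf q))).
  rewrite /dconn quadB quadFB; exact: sub3.
apply: etrans _ (killing_algebra comm (etrans br _) (torsion_free i j Wq) dd).
  by rewrite /Om /Th [quad _ (_ - _ - _)]quadB [quadF _ _ _ (_ - _ - _)]quadFB.
by rewrite c1 c2.
Qed.

(** ** The Lichnerowicz identity *)

Local Notation Rho := (rho g c e).

Definition Theta_frame q i j : 'M[R]_r :=
  \sum_x \sum_y (E q i x * E q j y) *: Th D c s x y q.

Lemma gT_coord q i : W q -> gT i = \sum_x (E q i x)%:C *: cl_coord x q.
Proof.
move=> Wq; rewrite -clv_delta -row1 -(frame_coframe e_ortho Wq) row_mul.
rewrite mulmx_sum_row clv_sum; apply: eq_bigr => x _.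
by rewrite clvZ [row i _ 0 x]mxE.
Qed.

Lemma curvature_killing_frame i j q : W q ->
  (quad gT (Rho q i j) + quadF n m Kr (Theta_frame q i j)) *m psi q =
  - (mu ^+ 2) *: ((gT i *m gT j - gT j *m gT i) *m psi q).
Proof.
move=> Wq.
have -> : quad gT (Rho q i j) + quadF n m Kr (Theta_frame q i j) =
    \sum_x \sum_y (E q i x * E q j y)%:C *:
      (quad gT (Om g c e x y q) + quadF n m Kr (Th D c s x y q)).
  rewrite /rho /Theta_frame quad_sum quadF_sum -big_split; apply: eq_bigr => x _ /=.
  rewrite quad_sum quadF_sum -big_split; apply: eq_bigr => y _ /=.
  by rewrite quadZ quadFZ scalerDr.
have -> : gT i *m gT j - gT j *m gT i = \sum_x \sum_y (E q i x * E q j y)%:C *: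
    (cl_coord x q *m cl_coord y q - cl_coord y q *m cl_coord x q).
  rewrite !(@gT_coord q _ Wq) mulmx_suml.
  rewrite [X in _ - X]mulmx_sumr -sumrB; apply: eq_bigr => x _.
  rewrite mulmx_sumr mulmx_suml -sumrB; apply: eq_bigr => y _.
  rewrite -!scalemxAl -!scalemxAr !scalerA.
  by rewrite [(E q j y)%:C * _]mulrC -scalerBr -rmorphM.
rewrite !mulmx_suml scaler_sumr; apply: eq_bigr => x _.
rewrite !mulmx_suml scaler_sumr; apply: eq_bigr => y _.
rewrite -!scalemxAl curvature_killing // !scalerA; congr (_ *: _).
exact: mulrC.
Qed.

Lemma gT_sqr i : gT i *m gT i = - 1%:M.
Proof.
have two0 : (2 : R[i]) != 0 by rewrite pnatr_eq0.
apply: (scalerI two0); rewrite scaler_nat mulr2n gamT_clifford eqxx mulr1.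
by rewrite scalerN scale_scalar_mx mulr1 raddfN.
Qed.

(** For i != j the summand is 2 (e_i e_j)^2 = -2, and for i = j it is 0. *)
Lemma gT_contraction :
  \sum_i \sum_j gT i *m gT j *m (gT i *m gT j - gT j *m gT i) =
  (- (2 * n%:R * (n%:R - 1)))%:M.
Proof.
have term i j : gT i *m gT j *m (gT i *m gT j - gT j *m gT i) =
    - (2 * (1 - (i == j)%:R)) *: 1%:M.
  case: (eqVneq i j) => [->|/negbTE ij].
    by rewrite subrr mulmx0 subrr mulr0 oppr0 scale0r.
  have sw : gT j *m gT i = - (gT i *m gT j).
    by rewrite (gm_swap (@gamT_clifford _ n r m Kn)) eq_sym ij mulr0 oppr0 raddf0 sub0r.
  have sq : gT i *m gT j *m (gT i *m gT j) = - 1%:M.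
    rewrite -mulmxA (mulmxA (gT j)) sw mulNmx mulmxN -!mulmxA (mulmxA (gT i)).
    by rewrite !gT_sqr mulmxN mulNmx mulmx1 opprK.
  rewrite sw opprK mulmxDr sq subr0 mulr1 scaleNr -opprD; congr (- _).
  by rewrite scaler_nat mulr2n.
under eq_bigr do under eq_bigr do rewrite term.
under eq_bigr do rewrite -scaler_suml.
rewrite -scaler_suml scalemx1; congr (_%:M).
have row_sum (i : 'I_n) : \sum_(j < n) - (2 * (1 - (i == j)%:R)) =
    - (2 * (n%:R - 1)) :> R[i].
  rewrite sumrN -mulr_sumr; congr (- (2 * _)); rewrite sumrB sumr_const card_ord.
  congr (_ - _); rewrite (bigD1 i) //= eqxx big1 ?addr0 // => j ij.
  by rewrite eq_sym (negbTE ij).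
under eq_bigr do rewrite row_sum.
by rewrite sumr_const card_ord -mulr_natl; ring.
Qed.

(** The integrability condition multiplied by e_i e_j and summed over i and j:
   the Levi-Civita curvature contracts to half the scalar curvature, the curvature
   of F to Theta, and the commutators to the number of pairs i != j. *)
Lemma killing_identity q : c = chart_at q -> W q ->
  2^-1 * scalar_curvature g q * ip (psi q) (psi q) +
    ip (Theta_op D Kn Kr m a q *m psi q) (psi q) =
  2 * n%:R * (n%:R - 1) * complex.Re (mu ^+ 2) * ip (psi q) (psi q).
Proof.
move=> cE Wq.
have scalE : scalar_curvature g q = \sum_i \sum_j Rho q i j j i.
  by rewrite (rho_scal oU e_smooth e_ortho Wq) /scalar_curvature -cE.
have ThE : Theta_op D Kn Kr m a q =
    \sum_i \sum_j gT i *m gT j *m quadF n m Kr (Theta_frame q i j).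
  rewrite twisting_term.
  - apply: eq_bigr => h _; apply: eq_bigr => l _; apply: eq_bigr => i _.
    apply: eq_bigr => j _; congr (_%:C *: _).
    rewrite (ThetaE D oU s_smooth e h l i j cE Wq) summxE; apply: eq_bigr => x _.
    by rewrite summxE; apply: eq_bigr => y _; rewrite [RHS]mxE.
  - move=> i j; rewrite /Theta_frame exchange_big -sumrN; apply: eq_bigr => x _.
    rewrite -sumrN; apply: eq_bigr => y _; rewrite mulrC -scalerN; congr (_ *: _).
    by rewrite /Th !opprB addrC.
  - move=> i j; rewrite /Theta_frame linear_sum -sumrN; apply: eq_bigr => x _.
    rewrite linear_sum -sumrN; apply: eq_bigr => y _ /=.
    rewrite linearZ /= -scalerN; congr (_ *: _).
    exact: (Th_antisym D oU s_smooth x y Wq).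
have := @contraction_quad _ _ _ _ (@gamT_clifford _ n r m Kn) (@gamT_adj _ n r m Kn)
  (Rho q) (psi q) (rho_antisym_idx g c e q) (fun i j u v => rho_antisym oU e_smooth e_ortho i j u v Wq)
  (fun i j u v => rho_bianchi oU e_smooth e_ortho i j u v Wq).
rewrite -scalE => <-; rewrite ThE -ipDl -mulmxDl -big_split /=.
under eq_bigr do rewrite -big_split /=.
under eq_bigr do under eq_bigr do rewrite -mulmxDr.
transitivity (ip (\sum_i \sum_j - (mu ^+ 2) *: ((gT i *m gT j *m
    (gT i *m gT j - gT j *m gT i)) *m psi q)) (psi q)).
  congr (ip _ _); rewrite mulmx_suml; apply: eq_bigr => i _.
  rewrite mulmx_suml; apply: eq_bigr => j _.
  by rewrite -mulmxA curvature_killing_frame // -scalemxAr mulmxA.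
under eq_bigr do rewrite -scaler_sumr -mulmx_suml.
rewrite -scaler_sumr -mulmx_suml gT_contraction mul_scalar_mx scalerA ip_scale.
congr (_ * _).
have -> : - mu ^+ 2 * - (2 * n%:R * (n%:R - 1)) = (2 * n%:R * (n%:R - 1) : R)%:C * mu ^+ 2.
  by rewrite !rmorphM rmorphB rmorph1 !rmorph_nat; ring.
by rewrite ReZ.
Qed.

(** ** The squared length of the spinor field *)

Lemma conn_skew j q : W q ->
  let A := quad gT (om j q) + quadF n m Kr (th j q) in adj A = - A.
Proof.
move=> Wq /=; rewrite adjD (adj_quad (@gamT_adj _ n r m Kn)); last first.
  exact: (om_antisym oU e_smooth e_ortho _ Wq).
by rewrite adj_quadF ?opprD //; exact: (th_antisym D oU s_smooth _ Wq).
Qed.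

(** Only Clifford multiplication contributes, as the connection is unitary. *)
Lemma grad_sqnorm j q : W q ->
  pd c j (fun x => ip (psi x) (psi x)) q = 2 * ip (psi q) (mu *: (cl_coord j q *m psi q)).
Proof.
move=> Wq; have cq := Wq.2; have dpsi := psi_deriv j Wq.
rewrite (pd_ip oW Wq cq psi_smooth psi_smooth dpsi dpsi) [in X in X + _]ipC.
rewrite /conn -opprD; set A := quad _ _ + _; have sA : adj A = - A := conn_skew j Wq.
rewrite mulmxDl mulNmx ipDr ipNr -scalemxAl.
have -> : ip (psi q) (A *m psi q) = 0.
  have := ip_adj A (psi q) (psi q); rewrite sA mulNmx ipNr ipC => /self_opp //.
by rewrite oppr0 add0r mulr_natl mulr2n.
Qed.

(** At a critical point the coordinate second derivatives are the Hessian, and the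
   sum of the squares of row j of the coframe is g_jj. By [d_coframe] the
   derivatives of the coframe and the commutators with the connection combine to
   Christoffel symbols times the gradient, which vanishes. There remain
   2 |mu|^2 from both spinors being differentiated, and -2 Re (mu^2) from Clifford
   multiplication applied twice, whose difference is 4 (Im mu)^2. *)
Lemma hess_sqnorm j q : W q ->
  (forall x, pd c x (fun z => ip (psi z) (psi z)) q = 0) ->
  pd c j (pd c j (fun x => ip (psi x) (psi x))) q =
  4 * complex.Im mu ^+ 2 * (\sum_i cf q j i ^+ 2) * ip (psi q) (psi q).
Proof.
move=> Wq crit; have cq := Wq.2; have dpsi := psi_deriv j Wq.
have {}crit x : ip (psi q) (mu *: (cl_coord x q *m psi q)) = 0.
  have := crit x; rewrite grad_sqnorm // => /eqP.
  by rewrite mulf_eq0 pnatr_eq0 /= => /eqP.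
pose L3 v : 'M[R[i]]_N := mu *: clv gT v.
have L3D x y : L3 (x + y) = L3 x + L3 y by rewrite /L3 clvD scalerDr.
have L3Z b x : L3 (b *: x) = b%:C *: L3 x by rewrite /L3 clvZ !scalerA mulrC.
have s3 : smooth_mx W (fun x => row j (cf x)).
  move=> x y; apply: smooth_on_ext (coframe_smooth g c oU e_smooth j y) => // z _.
  by rewrite [RHS]mxE.
have d3 : dmx c j (fun x => row j (cf x)) q = row j (dmx c j cf q).
  apply/rowP => y; rewrite [LHS]mxE [RHS]mxE [RHS]mxE.
  by apply: (pd_ext oW Wq cq) => z _; rewrite [LHS]mxE.
have v3 := vderiv_lin oW Wq cq L3D L3Z s3 psi_smooth dpsi.
have t3 := vsmooth_lin oW L3D L3Z s3 psi_smooth.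
transitivity (pd c j (fun x => 2 * ip (psi x) (L3 (row j (cf x)) *m psi x)) q).
  apply: (pd_ext oW Wq cq) => x Wx; rewrite grad_sqnorm //.
  by rewrite /L3 -scalemxAl.
rewrite (pdM Wq cq _ (smooth_on_cst 2 oW) (vsmooth_ip oW psi_smooth t3)) pd_cst mul0r add0r.
rewrite (pd_ip oW Wq cq psi_smooth t3 dpsi v3) d3 /L3 -/(cl_coord j q).
rewrite /conn -opprD; set A := quad gT _ + _.
have sA : adj A = - A := conn_skew j Wq.
set C := cl_coord j q; set u := psi q.
have CC : C *m C = (- (\sum_i cf q j i ^+ 2)%:C)%:M.
  rewrite /C /cl_coord (clv_sqr (@gamT_clifford _ n r m Kn)) mxE.
  by congr (- _%:C)%:M; apply: eq_bigr => i _; rewrite !mxE expr2.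
have sC : adj C = - C by rewrite /C /cl_coord (adj_clv (@gamT_adj _ n r m Kn)).
have oT := om_antisym oU e_smooth e_ortho j Wq.
have AC : A *m C - C *m A = clv gT (row j (cf q) *m om j q).
  rewrite -(comm_quad_clv (@gamT_clifford _ n r m Kn) _ oT) /A mulmxDl mulmxDr.
  by rewrite [quadF n m Kr _ *m C]quadF_clv -!/C opprD addrACA subrr addr0.
have dC : clv gT (row j (dmx c j cf q)) + (A *m C - C *m A) =
    \sum_x (Gam g c j q j x)%:C *: cl_coord x q.
  rewrite AC (d_coframe oU e_smooth e_ortho _ Wq) linearB /= [row j (cf q *m _)]row_mul.
  rewrite clvB subrK row_mul mulmx_sum_row clv_sum; apply: eq_bigr => x _.
  by rewrite clvZ [row j _ 0 x]mxE.
set gam2 := \sum_i _ in CC *.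
have e1 : ip ((- A + mu *: C) *m u) ((mu *: C) *m u) = ip u (mu *: (A *m C *m u)) +
    (complex.Re mu ^+ 2 + complex.Im mu ^+ 2) * (gam2 * ip u u).
  rewrite mulmxDl ipDl; congr (_ + _).
    by rewrite ip_adj adjN sA opprK -scalemxAl -scalemxAr mulmxA.
  rewrite -scalemxAl ip_scale2 ip_adj sC mulNmx mulmxA CC ipNr mul_scalar_mx.
  by rewrite -rmorphN ipZr mulNr opprK.
have e2 : ip u ((mu *: C) *m ((- A + mu *: C) *m u)) = - ip u (mu *: (C *m A *m u)) -
    complex.Re (mu ^+ 2) * (gam2 * ip u u).
  rewrite mulmxDl mulmxDr ipDr mulNmx mulmxN ipNr -!scalemxAl !mulmxA; congr (_ + _).
  rewrite -scalemxAr scalerA -expr2 mulmxA CC mul_scalar_mx scalerA ipC ip_scale.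
  have -> : complex.Re (mu ^+ 2 * - gam2%:C) = - gam2 * complex.Re (mu ^+ 2).
    by rewrite -rmorphN mulrC ReZ.
  by ring.
have e3 : ip u (mu *: clv gT (row j (dmx c j cf q)) *m u) +
    (ip u (mu *: (A *m C *m u)) - ip u (mu *: (C *m A *m u))) = 0.
  rewrite -ipNr -!ipDr -scalerN -scalerDr -scalemxAl -scalerDr -mulNmx -!mulmxDl dC.
  rewrite mulmx_suml scaler_sumr ipC ip_suml big1 // => x _.
  by rewrite -scalemxAl scalerA mulrC -scalerA ipZl ipC crit mulr0.
rewrite e1 ipDr e2.
have Remu : complex.Re (mu ^+ 2) = complex.Re mu ^+ 2 - complex.Im mu ^+ 2.
  by case: (mu) => x y /=; rewrite !expr2.
rewrite Remu.
move: (ip u _) (ip u _) (ip u _) e3 (ip u u) => x1 x2 x3 e3 x4.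
have -> : x3 = x1 - x2 by apply/eqP; rewrite -subr_eq0 opprB e3.
ring.
Qed.

End Chart.

End KillingSpinor.

(** * The maximum principle *)

Section SecondDerivativeTest.
Variables (R : realType) (n : nat).

(** If the second derivative at x were positive, the first one would be positive
   shortly after x on the line in direction e_i, and f would increase there by the
   mean value theorem. *)
Lemma C2_max (D : set 'rV[R]_n) (f : 'rV[R]_n -> R) x (i : 'I_n) :
  open D -> Ck 2 D f -> D x -> (forall y, D y -> f y <= f x) ->
  'D_('e_i) f x = 0 /\ 'D_('e_i) ('D_('e_i) f) x <= 0.
Proof.
move=> oD [_ df] Dx fmax; have [di [_ /(_ i)[dii _]]] := df i.
set v : 'rV[R]_n := 'e_i.
have [d /= d0 B] := (nbhs_ballP x D).1 (open_nbhs_nbhs (conj oD Dx)).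
have v1 : `|v| <= 1.
  apply: norm_le_coord => // j; rewrite mxE eqxx /=.
  by case: (j == i); rewrite ?normr1 ?normr0.
have inD (t : R) : `|t| < d -> D (t *: v + x).
  move=> td; apply: B; rewrite -ball_normE /ball_ /= opprD addrCA subrr addr0 normrN.
  rewrite normrZ; apply: le_lt_trans td.
  by rewrite -[leRHS]mulr1; apply: ler_wpM2l.
pose h (t : R) : R := f (t *: v + x).
have dh (t : R) : `|t| < d -> is_derive t 1 h ('D_v f (t *: v + x)).
  by move=> td; apply: derive_line; apply: di; exact: inD.
have h0 : h 0 = f x by rewrite /h scale0r add0r.
have D0 : 'D_v f x = 0.
  have nt (t : R) : t \in `]- d, d[%R -> `|t| < d.
    by rewrite in_itv /= ltr_norml.
  have zin : 0 \in `]- d, d[%R by rewrite in_itv /= oppr_lt0 d0.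
  have ledd : - d <= d by rewrite ge0_cp // ltW.
  have := @derive1_at_max R h (- d) d 0 ledd.
  case=> [t /nt/dh dt|||_ E]; first exact: ex_derive.
  - exact: zin.
  - by move=> t /nt td; rewrite h0; apply: fmax; exact: inD.
  have d00 : `|0 : R| < d by rewrite normr0.
  by rewrite -E (derive_val (is_derive := dh 0 d00)) scale0r add0r.
split; first exact: D0.
rewrite leNgt; apply/negP => L0.
have dvv : derivable ('D_v f) x v := dii x Dx.
have /cvgr_gt /(_ _ L0) [d1 /= d10 B1] := dvv.
pose t := Num.min d d1 / 2.
have m0 : 0 < Num.min d d1 by rewrite lt_min d0 d10.
have t0 : 0 < t by rewrite divr_gt0.
have tm : t < Num.min d d1 by rewrite ltr_pdivrMr // ltr_pMr // ltr1n.
have [td td1] : t < d /\ t < d1 by move: tm; rewrite lt_min => /andP.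
have [||s] := @MVT R h (fun s => 'D_v f (s *: v + x)) 0 t t0.
- move=> s; rewrite in_itv /= => /andP[s0 st]; apply: dh.
  by rewrite gtr0_norm // (lt_trans st).
- apply: derivable_within_continuous => s; rewrite in_itv /= => /andP[s0 st].
  have sd : `|s| < d by rewrite ger0_norm // (le_lt_trans st).
  by have [ds _] := dh s sd; exact: ds.
rewrite in_itv /= => /andP[s0 st] E.
have pos : 0 < 'D_v f (s *: v + x).
  have := B1 s; rewrite /ball_ /= sub0r normrN gtr0_norm // => /(_ (lt_trans st td1)).
  move=> /(_ (lt0r_neq0 s0)) /=; rewrite D0 subr0.
  by rewrite pmulr_rgt0 ?invr_gt0.
have : f (t *: v + x) <= f x by apply/fmax/inD; rewrite gtr0_norm.
rewrite -/(h t) -h0 -subr_le0 E subr0 leNgt => /negP; apply.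
by rewrite mulr_gt0.
Qed.

Lemma smooth_max (M : manifold R n) (U : set M) c p (f : M -> R) i :
  open U -> U p -> dom c p -> smooth_on U f -> (forall q, U q -> f q <= f p) ->
  pd c i f p = 0 /\ pd c i (pd c i f) p <= 0.
Proof.
move=> oU Up cp sf fmax.
have Ix := to_chart_image cp Up; have oI := open_chart_image (c := c) oU.
have [|E1 E2] := C2_max i oI (sf c 2%N) Ix.
  by move=> y [_ Uy] /=; rewrite to_coordK //; exact: fmax.
split; first exact: E1.
apply: le_trans E2; rewrite le_eqVlt; apply/orP; left; apply/eqP.
apply: near_eq_derive; apply: (near_open oI Ix) => x [cx _].
by rewrite /pd /deriv /= of_coordK.
Qed.

End SecondDerivativeTest.

(** * The length of a Killing spinor *)

Section Global.
Variables (R : realType) (n r m : nat) (M : manifold R n) (g : metric M).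
Variables (Q : principal_bundle M (SO R r)) (D : metric_connection Q).
Variables (k : spin_kind) (P : spin_structure g Q k).
Variables (Kn : spinor_rep R n) (Kr : spinor_rep R r).

Section Section.
Variable phi : P -> 'cV[R[i]]_(spinor_dim n r m).
Hypothesis phi_section : spinor_section Kn Kr phi.

(** Spin(n) x Spin(r) acts by isometries, so the length of the spinor field is
   a function on M. *)
Lemma sqnorm_fibre q q' : bproj q = bproj q' -> ip (phi q) (phi q) = ip (phi q') (phi q').
Proof.
move=> /act_trans[[x y] [/= sx sy] ->]; have [eqv _] := phi_section.
by rewrite -(eqv q x y sx sy) spin_action_isometry.
Qed.

Definition sqnorm p : R := let q := sec (triv_at P p) p in ip (phi q) (phi q).

Lemma sqnormE (a : triv P) p : tdom a p -> sqnorm p = ip (phi (sec a p)) (phi (sec a p)).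
Proof.
by move=> ap; apply: sqnorm_fibre; rewrite !sec_proj //; exact: triv_atP.
Qed.

Lemma sqnorm_smooth (a : triv P) : smooth_on (tdom a) sqnorm.
Proof.
have oU : open (tdom a) := tdom_open a.
have [_ sphi] := phi_section.
apply: (@smooth_on_ext _ _ _ _ (fun p => \sum_i
  (complex.Re (phi (sec a p) i 0) * complex.Re (phi (sec a p) i 0) +
   complex.Im (phi (sec a p) i 0) * complex.Im (phi (sec a p) i 0)))) => //.
  by move=> p ap; rewrite (sqnormE ap) ipE.
apply: smooth_on_sum => // i _; have [sR sI] := sphi a i.
by apply: smooth_onD => //; apply: smooth_onM.
Qed.

Lemma sqnorm_continuous : continuous sqnorm.
Proof.
move=> p; have ap := triv_atP P p; set a := triv_at P p in ap.
have cp := chart_atP p; set c := chart_at p in cp.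
have oU : open (tdom a) := tdom_open a.
have oW : open (tdom a `&` dom c) := openI oU (@dom_open _ _ M c).
have Wp : (tdom a `&` dom c) p by [].
have sc : {for to_coord c p, continuous (sqnorm \o of_coord c)}.
  exact: Ck_cont (sqnorm_smooth a c 0%N) (to_chart_image cp ap).
have cc : {for p, continuous ((sqnorm \o of_coord c) \o to_coord c)}.
  by apply: continuous_comp => //; exact: to_coord_continuous.
have E : ((sqnorm \o of_coord c) \o to_coord c) p = sqnorm p by rewrite /= to_coordK.
rewrite /prop_for /continuous_at E in cc.
have N : \forall x \near p, sqnorm (of_coord c (to_coord c x)) = sqnorm x.
  apply: filterS (open_nbhs_nbhs (conj oW Wp)) => x [_ cx].
  by rewrite to_coordK.
exact: cvg_trans (near_eq_cvg N) cc.
Qed.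

Hypothesis M_compact : compact [set: M].
Hypothesis n_gt0 : (0 < n)%N.
Variable mu : R[i].
Hypothesis phi_killing : killing D Kn Kr mu phi.

(** At a point where the length of phi is maximal, its Hessian cannot be
   positive, but it is 4 (Im mu)^2 |phi|^2 times the metric. *)
Lemma killing_constant_real q0 : phi q0 <> 0 -> complex.Im mu = 0.
Proof.
move=> phi0; pose p0 := bproj q0.
have h0 : 0 < sqnorm p0.
  rewrite /sqnorm (sqnorm_fibre (q' := q0)); last first.
    by rewrite sec_proj //; exact: triv_atP.
  by apply: ip_gt0; exact/eqP.
have [||p _ pmax] := @compact_EVT_max M R sqnorm [set: M] _ M_compact.
- by exists p0.
- by apply: continuous_subspaceT => x; exact: sqnorm_continuous.
have hp : 0 < sqnorm p by apply: lt_le_trans h0 (pmax p0 _); rewrite inE.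
have ap := triv_atP P p; set a := triv_at P p in ap.
have cp := chart_atP p; set c := chart_at p in cp.
have oU : open (tdom a) := tdom_open a.
pose f x := ip (phi (sec a x)) (phi (sec a x)).
have sf : smooth_on (tdom a) f.
  by apply: smooth_on_ext (sqnorm_smooth a) => // x; exact: sqnormE.
have fmax x : tdom a x -> f x <= f p.
  by move=> ax; rewrite /f -!sqnormE // pmax // inE.
have crit j := smooth_max j oU ap cp sf fmax.
pose j0 := Ordinal n_gt0.
have Wp : (tdom a `&` dom c) p by [].
have := (crit j0).2.
rewrite (hess_sqnorm phi_section phi_killing j0 Wp (fun j => (crit j).1)).
have fp : 0 < f p by rewrite /f -sqnormE.
rewrite -/(f p) pmulr_lle0 // => H.
have e_ortho q : tdom a q -> local_e a q *m gram g q *m (local_e a q)^T = 1%:M.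
  by move=> Uq; rewrite -[in gram g q](sec_proj Uq); exact: frT_orthonormal.
have row_gt0 : 0 < \sum_i coframe g c (local_e a) p j0 i ^+ 2.
  rewrite lt_neqAle sumr_ge0 ?andbT; last by move=> i _; exact: sqr_ge0.
  apply/eqP => /esym/eqP; rewrite psumr_eq0; last by move=> i _; exact: sqr_ge0.
  move=> /allP z; have := coframe_frame e_ortho Wp.
  move=> /(congr1 (fun A : 'M[R]_n => A j0 j0)); rewrite !mxE eqxx big1.
    by move/eqP; rewrite eq_sym oner_eq0.
  move=> i _; have /implyP/(_ isT) := z i (mem_index_enum i).
  by rewrite sqrf_eq0 => /eqP ->; rewrite mul0r.
move: H; rewrite pmulr_lle0 // pmulr_rle0 // => H.
by apply/eqP; rewrite -sqrf_eq0 eq_le H sqr_ge0.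
Qed.

(** Estimate <Theta psi, psi> >= - |Theta| |psi|^2 in the Lichnerowicz identity
   and divide by |psi|^2. *)
Lemma killing_scalar_bound q0 : phi q0 <> 0 ->
  scalar_curvature g (bproj q0) - 2 * Theta_norm D P Kn Kr m (bproj q0) <=
  4 * n%:R * (n%:R - 1) * complex.Re (mu ^+ 2).
Proof.
move=> phi0; set p := bproj q0.
have ap := triv_atP P p; have cp := chart_atP p.
set u := phi (sec (triv_at P p) p).
have u0 : 0 < ip u u.
  rewrite /u (sqnorm_fibre (q' := q0)); last by rewrite sec_proj.
  by apply: ip_gt0; exact/eqP.
have := killing_identity phi_section phi_killing (a := triv_at P p) erefl (conj ap cp).
have := ip_opnorm (Theta_op D Kn Kr m (triv_at P p) p) u.
rewrite -/(Theta_norm D P Kn Kr m p) -/u.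
move: (scalar_curvature g p) (Theta_norm D P Kn Kr m p) (ip u u) u0 => S T q q_gt0.
move: (ip _ _) (complex.Re _) => x y H1 H2.
rewrite -(ler_pM2r q_gt0).
move: (n%:R) H2 => N H2; nra.
Qed.

End Section.

Lemma Theta_norm_tensor p : Theta_norm D P Kn Kr m p <= m%:R * Theta_norm D P Kn Kr 1 p.
Proof.
set a := triv_at P p.
have E l : Theta_op D Kn Kr l a p = twist (fun h l i j => Theta D (local_e a) (local_f a) h l i j p)
   (fun i j => gam Kn i *m gam Kn j) (fun h l => gam Kr h *m gam Kr l) (fun y => tens_der y l).
  rewrite /Theta_op /twist; apply: eq_bigr => h _; apply: eq_bigr => b _.
  apply: eq_bigr => i _; apply: eq_bigr => j _; congr (_ *: _).
  by rewrite /cliffT /cliffF tensmx_mul mulmx1 mul1mx.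
rewrite /Theta_norm -/a; apply: opnorm_le.
  by rewrite mulr_ge0 ?ler0n ?opnorm_ge0.
rewrite E; apply: twist_norm_le; first exact: opnorm_ge0.
rewrite -E; exact: opnorm_norm_le.
Qed.

End Global.

Theorem corollary3p3 (R : realType) (n r m : nat) (hn : (0 < n)%N)
  (hr : (2 <= r)%N) (M : manifold R n) (M_compact : compact [set: M])
  (M_connected : connected [set: M]) (g : metric M)
  (Q : principal_bundle M (SO R r)) (D : metric_connection Q)
  (P0 : spin_structure g Q SpinTwisted)
  (k : spin_kind) (P : spin_structure g Q k) (hS : globally_defined k m)
  (Kn : spinor_rep R n) (Kr : spinor_rep R r)
  (mu : R[i]) (phi : P -> 'cV[R[i]]_(spinor_dim n r m))
  (phi_section : spinor_section Kn Kr phi) (phi_neq0 : exists q, phi q <> 0)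
  (phi_killing : killing D Kn Kr mu phi) :
  let scal := scalar_curvature g in
  let f_m := fun p : M => scal p - 2 * Theta_norm D P Kn Kr m p in
  let f_1 := fun p : M => scal p - 2 * m%:R * Theta_norm D P Kn Kr 1 p in
  let lower_m := (((4 * n%:R ^+ 2)^-1)%:E * min_on f_m)%E in
  let lower_1 := (((4 * n%:R ^+ 2)^-1)%:E * min_on f_1)%E in
  let mu2 := (complex.Re (mu ^+ 2))%:E in
  [/\ complex.Im mu = 0 \/ complex.Re mu = 0,
      (lower_m <= mu2)%E,
      (lower_1 <= lower_m)%E &
      mu2 = lower_m \/ mu2 = lower_1 -> parallel D Kn Kr phi /\ mu = 0].
Proof.
have [q0 phi0] := phi_neq0; move=> scal f_m f_1 lower_m lower_1 mu2.
have Im0 := killing_constant_real phi_section M_compact hn phi_killing phi0.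
have mu2E : complex.Re (mu ^+ 2) = complex.Re mu ^+ 2.
  by move: Im0; case: (mu) => x y /= ->; rewrite mulr0 subr0 expr2.
have n0 : 0 < n%:R :> R by rewrite ltr0n.
have K0 : 0 < (4 * n%:R ^+ 2)^-1 :> R by rewrite invr_gt0 mulr_gt0 // exprn_gt0.
pose y := complex.Re (mu ^+ 2).
have y0 : 0 <= y by rewrite /y mu2E sqr_ge0.
(* the minimum is at most the value at a point where phi does not vanish; the
   factor (n - 1) / n < 1 gained here settles the case of equality *)
have low : (lower_m <= ((n%:R - 1) / n%:R * y)%:E)%E.
  apply: (@le_trans _ _ (((4 * n%:R ^+ 2)^-1)%:E * (f_m (bproj q0))%:E)%E).
    by apply: lee_wpmul2l; [rewrite lee_fin ltW | apply: ereal_inf_lbound; exists (bproj q0)].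
  rewrite -EFinM lee_fin.
  have B := killing_scalar_bound phi_section phi_killing phi0.
  apply: (@le_trans _ _ ((4 * n%:R ^+ 2)^-1 * (4 * n%:R * (n%:R - 1) * y))).
    by apply: ler_wpM2l; [exact: ltW | exact: B].
  rewrite le_eqVlt; apply/orP; left; apply/eqP; field.
  by rewrite lt0r_neq0.
have low2 : (lower_1 <= lower_m)%E.
  apply: lee_wpmul2l; first by rewrite lee_fin ltW.
  apply: le_ereal_inf_tmp => _ [p _ <-]; apply: (@le_trans _ _ (f_1 p)%:E).
    by apply: ereal_inf_lbound; exists p.
  rewrite lee_fin /f_1 /f_m lerD2l lerN2 -mulrA ler_pM2l //.
  exact: Theta_norm_tensor.
have upper : (n%:R - 1) / n%:R * y <= y.
  by rewrite ler_piMl // ler_pdivrMr // mul1r gerBl.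
split.
- by left.
- by apply: le_trans low _; rewrite lee_fin.
- exact: low2.
move=> eq_low.
have mu2_low : (mu2 <= ((n%:R - 1) / n%:R * y)%:E)%E.
  by case: eq_low => ->; [exact: low | exact: le_trans low2 low].
have yz : y = 0.
  move: mu2_low; rewrite lee_fin -/y => H; apply/eqP; rewrite eq_le y0 andbT.
  have : n%:R * y <= (n%:R - 1) * y.
    by rewrite -ler_pdivlMl // mulrA [_^-1 * _]mulrC.
  by rewrite mulrBl mul1r lerBrDr gerDl.
have mu0 : mu = 0.
  move: yz Im0; rewrite /y mu2E => /eqP; rewrite sqrf_eq0.
  by case: (mu) => u v /= /eqP -> ->.
split=> // a c X p ap cp.
by rewrite phi_killing // mu0 scale0r.
Qed.
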